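(* Let $\mathbb{F}_q$ be a finite field with $q$ elements. (1) If $q>5$, there is no smooth plane cubic over $\mathbb{F}_q$ admitting exactly one equivalence class of linear determinantal representations over $\mathbb{F}_q$. (2) If $q\le5$ (i.e. $q\in\{2,3,4,5\}$), there is exactly one projective equivalence class of smooth plane cubics over $\mathbb{F}_q$ admitting exactly one equivalence class of linear determinantal representations over $\mathbb{F}_q$; a representative is given by $X^2Z+XYZ+Y^3+Y^2Z+YZ^2=0$ for $q=2$, by $X^2Z-Y^3+Y^2Z+YZ^2=0$ for $q=3$, by $X^2Z+\omega XYZ+Y^3+Y^2Z+\omega YZ^2=0$ for $q=4$, and by $X^2Z+Y^3+2YZ^2=0$ for $q=5$.
   Context: A smooth plane cubic $C\subset\mathbb{P}^2$ over $\mathbb{F}_q$ is defined by a ternary cubic form $F$ over $\mathbb{F}_q$. A linear determinantal representation of $C$ over $\mathbb{F}_q$ is a $3\times3$ matrix $M$ of $\mathbb{F}_q$-linear forms in $X,Y,Z$ with $F=\lambda\det(M)$ for some $\lambda\in\mathbb{F}_q^\times$; two such $M,M'$ are equivalent if $M'=AMB$ for some $A,B\in\mathrm{GL}_3(\mathbb{F}_q)$. Two smooth plane cubics $C,C'$ over $\mathbb{F}_q$ are projectively equivalent if there is an automorphism of $\mathbb{P}^2$ over $\mathbb{F}_q$ inducing an isomorphism $C\cong C'$. $\omega\in\mathbb{F}_4$ denotes an element with $\omega^2+\omega+1=0$. *)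

(* Defs.v *)
From HB Require Import structures.
From mathcomp Require Import all_boot all_order all_algebra all_field.
From mathcomp Require Import mpoly.
Set Implicit Arguments. Unset Strict Implicit. Unset Printing Implicit Defensive.
Import GRing.Theory.
Local Open Scope ring_scope.

Notation tform F := {mpoly F[3]}.

(* F (a cubic form) defines a smooth plane cubic: F is homogeneous of degree 3
   and the curve F = 0 has no singular point over any field extension of F
   (equivalently over an algebraic closure). *)
Definition smooth_cubic (F : fieldType) (P : tform F) : Prop :=
  P \is 3.-homog /\
  forall (L : fieldType) (f : {rmorphism F -> L}) (x : 'I_3 -> L),
    (exists i, x i != 0) ->
    ~ ((map_mpoly f P).@[x] = 0 /\
       forall i : 'I_3, (map_mpoly f (mderiv i P)).@[x] = 0).

Definition linear_form_mx (F : fieldType) (M : 'M[tform F]_3) : Prop :=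
  forall i j, M i j \is 1.-homog.

Definition det_rep (F : fieldType) (P : tform F) (M : 'M[tform F]_3) : Prop :=
  linear_form_mx M /\ exists lam : F, lam != 0 /\ P = lam *: \det M.

Definition det_rep_equiv (F : fieldType) (M M' : 'M[tform F]_3) : Prop :=
  exists A B : 'M[F]_3, A \in unitmx /\ B \in unitmx /\
    M' = map_mx (fun a => a%:MP) A *m M *m map_mx (fun a => a%:MP) B.

Definition unique_det_rep_class (F : fieldType) (P : tform F) : Prop :=
  exists M, det_rep P M /\ forall M', det_rep P M' -> det_rep_equiv M M'.

Definition lin_subst (F : fieldType) (g : 'M[F]_3) (Q : tform F) : tform F :=
  comp_mpoly [tuple \sum_(j < 3) (g i j)%:MP * 'X_j | i < 3] Q.

Definition proj_equiv (F : fieldType) (P Q : tform F) : Prop :=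
  exists (g : 'M[F]_3) (lam : F), g \in unitmx /\ lam != 0 /\
    lin_subst g Q = lam *: P.

Definition unique_class_rep (F : fieldType) (P : tform F) : Prop :=
  (smooth_cubic P /\ unique_det_rep_class P) /\
  forall Q : tform F, smooth_cubic Q -> unique_det_rep_class Q -> proj_equiv Q P.

Definition cX {F : fieldType} : tform F := 'X_0.
Definition cY {F : fieldType} : tform F := 'X_1.
Definition cZ {F : fieldType} : tform F := 'X_2.

(* Main.v *)
Require Import Defs.
From HB Require Import structures.
From mathcomp Require Import all_boot all_order all_algebra all_field.
From mathcomp Require Import mpoly ring zify.
Set Implicit Arguments. Unset Strict Implicit. Unset Printing Implicit Defensive.
Import GRing.Theory.
Local Open Scope ring_scope.

(* Evaluating a representation at a rational point [p] gives a singular matrix; if [u] spans its left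
   kernel, then smoothness makes the rows [u T_i] span a plane, with normal [v], and [v] lies in the
   right kernel at exactly one further point [t] of the curve. A normal form shows that [t] determines
   the class and that every rational [t <> p] occurs. So a curve with a rational point has one class
   exactly when it has two rational points. A curve without rational points has at least two classes:
   over the cubic extension the number of points is divisible by 3, because Frobenius acts freely on
   them, hence Frobenius fixes at least two of the classes, and fixed classes descend by Hilbert 90.
   If the only rational points are [p] and [t], one of them is a flex, which yields a Weierstrass form
   whose affine part [y <> 0] has no rational point. For [q > 5] a degree count (Euler's criterion for
   [q] odd, the absolute trace for [q] even) excludes this; for [q <= 5] all the Weierstrass forms are
   enumerated. *)

(** * Ternary forms *)

(** Classically the classes of representations of a smooth cubic correspond to its non-trivial line
    bundles of degree 0, hence to the points other than the origin of an elliptic curve. The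
    residual point [t] replaces the line bundle and the base point [p] the origin, so that
    everything becomes linear algebra on three scalar matrices, and contradictions with smoothness
    come from explicit singular points. The point-free case cannot occur, by the Hasse-Weil bound;
    instead of proving this, the argument shows that such a curve would have two classes. There the
    base point lives only over the cubic extension and is moved by Frobenius, so Frobenius acts on
    classes and not directly on residual points; as the base point is left out, the residual points
    number 2 modulo 3, and so do the fixed classes. The bound q > 5 comes out of the degree counts:
    they need (q - 1) / 2 >= 3 for odd q and q / 2 >= 4 for even q. *)

Lemma ord3P (i : 'I_3) : [\/ i = 0, i = 1 | i = 2].
Proof.
by case: i => [[|[|[|//]]] Hi]; [apply: Or31|apply: Or32|apply: Or33]; apply/val_inj.
Qed.

Lemma all3 (Q : 'I_3 -> Prop) : Q 0 -> Q 1 -> Q 2 -> forall i, Q i.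
Proof. by move=> Q0 Q1 Q2 i; case: (ord3P i) => ->. Qed.

Lemma sum3 (V : nmodType) (f : 'I_3 -> V) : \sum_i f i = f 0 + f 1 + f 2.
Proof.
rewrite !big_ord_recl big_ord0 addr0 addrA.
by congr (_ + _ + _); congr (f _); apply/val_inj.
Qed.

Lemma prod3 (R : comNzRingType) (f : 'I_3 -> R) : \prod_i f i = f 0 * f 1 * f 2.
Proof.
rewrite !big_ord_recl big_ord0 mulr1 mulrA.
by congr (_ * _ * _); congr (f _); apply/val_inj.
Qed.

Lemma det3 (R : comNzRingType) (A : 'M[R]_3) :
  \det A = A 0 0 * (A 1 1 * A 2 2 - A 1 2 * A 2 1)
         - A 0 1 * (A 1 0 * A 2 2 - A 1 2 * A 2 0)
         + A 0 2 * (A 1 0 * A 2 1 - A 1 1 * A 2 0).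
Proof.
pose f (m n : nat) := A (inord m) (inord n).
have E i j : A i j = f i j by rewrite /f !inord_val.
rewrite (expand_det_row _ 0) sum3 /cofactor !(expand_det_row _ 0).
rewrite !big_ord_recl !big_ord0 /cofactor !det_mx11 !mxE !E /= /bump /=; ring.
Qed.

Definition mx3 (R : Type) (a b c d e f g h i : R) : 'M[R]_3 :=
  \matrix_(r < 3, s < 3)
    match val r, val s with
    | 0, 0 => a | 0, 1 => b | 0, _ => c
    | 1, 0 => d | 1, 1 => e | 1, _ => f
    | _, 0 => g | _, 1 => h | _, _ => i
    end%N.

Lemma mx3E (R : Type) (a b c d e f g h i : R) (M := mx3 a b c d e f g h i) :
  (((M 0 0 = a) * (M 0 1 = b) * (M 0 2 = c)) *
   ((M 1 0 = d) * (M 1 1 = e) * (M 1 2 = f)) *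
   ((M 2 0 = g) * (M 2 1 = h) * (M 2 2 = i)))%type.
Proof. by rewrite /M !mxE. Qed.

Lemma mx3_eta (R : Type) (A : 'M[R]_3) :
  A = mx3 (A 0 0) (A 0 1) (A 0 2) (A 1 0) (A 1 1) (A 1 2) (A 2 0) (A 2 1) (A 2 2).
Proof. by apply/matrixP => i j; case: (ord3P i) => ->; case: (ord3P j) => ->; rewrite !mx3E. Qed.

Definition col3 (R : Type) (a b c : R) : 'cV[R]_3 :=
  \col_(r < 3) match val r with 0 => a | 1 => b | _ => c end%N.

Lemma col3E (R : Type) (a b c : R) (v := col3 a b c) :
  ((v 0 0 = a) * (v 1 0 = b) * (v 2 0 = c))%type.
Proof. by rewrite /v !mxE. Qed.

Lemma col3_eta (R : Type) (v : 'cV[R]_3) : v = col3 (v 0 0) (v 1 0) (v 2 0).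
Proof. by apply/colP => i; case: (ord3P i) => ->; rewrite !col3E. Qed.

Definition mon (i j k : nat) : 'X_{1..3} := [multinom [tuple i; j; k]].

Lemma monE (i j k : nat) (m := mon i j k) : ((m 0 = i) * (m 1 = j) * (m 2 = k))%type.
Proof. by rewrite /m !multinomE !(tnth_nth 0%N). Qed.

Lemma mon_eq (i j k i' j' k' : nat) :
  (mon i j k == mon i' j' k') = [&& i == i', j == j' & k == k'].
Proof.
apply/eqP/and3P => [E|[/eqP-> /eqP-> /eqP->]] //.
have := congr1 (fun m : 'X_{1..3} => (m 0, m 1, m 2)) E.
by rewrite /= !monE => -[-> -> ->].
Qed.

Lemma mon_eta (m : 'X_{1..3}) : m = mon (m 0) (m 1) (m 2).
Proof. by apply/mnmP => i; case: (ord3P i) => ->; rewrite monE. Qed.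

Lemma mpolyX_mon (R : comNzRingType) (i j k : nat) :
  'X_[mon i j k] = 'X_0 ^+ i * 'X_1 ^+ j * 'X_2 ^+ k :> {mpoly R[3]}.
Proof. by rewrite mpolyXE_id prod3 !monE. Qed.

Lemma mdeg_mon (i j k : nat) : mdeg (mon i j k) = (i + j + k)%N.
Proof. by rewrite mdegE sum3 !monE. Qed.

Section Forms.
Variable R : comNzRingType.
Local Notation X := ('X_0 : {mpoly R[3]}).
Local Notation Y := ('X_1 : {mpoly R[3]}).
Local Notation Z := ('X_2 : {mpoly R[3]}).

Definition lin (a b c : R) : {mpoly R[3]} := a%:MP * X + b%:MP * Y + c%:MP * Z.

Definition cub (xxx xxy xxz xyy xyz xzz yyy yyz yzz zzz : R) : {mpoly R[3]} :=
  xxx%:MP * X ^+ 3 + xxy%:MP * X ^+ 2 * Y + xxz%:MP * X ^+ 2 * Z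
  + xyy%:MP * X * Y ^+ 2 + xyz%:MP * X * Y * Z + xzz%:MP * X * Z ^+ 2
  + yyy%:MP * Y ^+ 3 + yyz%:MP * Y ^+ 2 * Z + yzz%:MP * Y * Z ^+ 2
  + zzz%:MP * Z ^+ 3.

Lemma linE (a b c : R) :
  lin a b c = a%:MP * 'X_[mon 1 0 0] + b%:MP * 'X_[mon 0 1 0] + c%:MP * 'X_[mon 0 0 1].
Proof. by rewrite !mpolyX_mon !expr0 !expr1 !mulr1 !mul1r. Qed.

Lemma cubE (c30 c21 c201 c12 c111 c102 c03 c021 c012 c003 : R) :
  cub c30 c21 c201 c12 c111 c102 c03 c021 c012 c003 =
  c30%:MP * 'X_[mon 3 0 0] + c21%:MP * 'X_[mon 2 1 0] + c201%:MP * 'X_[mon 2 0 1]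
  + c12%:MP * 'X_[mon 1 2 0] + c111%:MP * 'X_[mon 1 1 1] + c102%:MP * 'X_[mon 1 0 2]
  + c03%:MP * 'X_[mon 0 3 0] + c021%:MP * 'X_[mon 0 2 1] + c012%:MP * 'X_[mon 0 1 2]
  + c003%:MP * 'X_[mon 0 0 3].
Proof. by rewrite /cub !mpolyX_mon; ring. Qed.

Lemma lin_coef (a b c : R) (p := lin a b c) :
  ((p@_(mon 1 0 0) = a) * (p@_(mon 0 1 0) = b) * (p@_(mon 0 0 1) = c))%type.
Proof.
by rewrite /p linE !mcoeffD !mcoeffCM !mcoeffX !mon_eq !mulr0 !mulr1 !addr0 !add0r.
Qed.

Lemma cub_coef (c30 c21 c201 c12 c111 c102 c03 c021 c012 c003 : R)
  (p := cub c30 c21 c201 c12 c111 c102 c03 c021 c012 c003) :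
  (((p@_(mon 3 0 0) = c30) * (p@_(mon 2 1 0) = c21) * (p@_(mon 2 0 1) = c201)) *
   ((p@_(mon 1 2 0) = c12) * (p@_(mon 1 1 1) = c111) * (p@_(mon 1 0 2) = c102)) *
   ((p@_(mon 0 3 0) = c03) * (p@_(mon 0 2 1) = c021) * (p@_(mon 0 1 2) = c012)) *
   (p@_(mon 0 0 3) = c003))%type.
Proof.
by rewrite /p cubE !mcoeffD !mcoeffCM !mcoeffX !mon_eq !mulr0 !mulr1 !addr0 !add0r.
Qed.

Lemma lin_eta (p : {mpoly R[3]}) : p \is 1.-homog ->
  p = lin p@_(mon 1 0 0) p@_(mon 0 1 0) p@_(mon 0 0 1).
Proof.
move=> hp; apply/mpolyP => m; have [dm|dm] := eqVneq (mdeg m) 1%N; last first.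
  rewrite (dhomog_nemf_coeff hp dm) linE !mcoeffD !mcoeffCM !mcoeffX.
  have ne i j k : (i + j + k = 1)%N -> (mon i j k == m) = false.
    by move=> e; apply: contraNF dm => /eqP <-; rewrite mdeg_mon e.
  by rewrite !ne // !mulr0 !addr0.
move: dm; rewrite [m]mon_eta mdeg_mon.
case: (m 0) => [|[|//]]; case: (m 1) => [|[|//]]; case: (m 2) => [|[|//]] // _;
  by rewrite lin_coef.
Qed.

Lemma cub_eta (p : {mpoly R[3]}) : p \is 3.-homog ->
  p = cub p@_(mon 3 0 0) p@_(mon 2 1 0) p@_(mon 2 0 1) p@_(mon 1 2 0) p@_(mon 1 1 1)
          p@_(mon 1 0 2) p@_(mon 0 3 0) p@_(mon 0 2 1) p@_(mon 0 1 2) p@_(mon 0 0 3).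
Proof.
move=> hp; apply/mpolyP => m; have [dm|dm] := eqVneq (mdeg m) 3%N; last first.
  rewrite (dhomog_nemf_coeff hp dm) cubE !mcoeffD !mcoeffCM !mcoeffX.
  have ne i j k : (i + j + k = 3)%N -> (mon i j k == m) = false.
    by move=> e; apply: contraNF dm => /eqP <-; rewrite mdeg_mon e.
  by rewrite !ne // !mulr0 !addr0.
move: dm; rewrite [m]mon_eta mdeg_mon.
case: (m 0) => [|[|[|[|//]]]]; case: (m 1) => [|[|[|[|//]]]];
  case: (m 2) => [|[|[|[|//]]]] // _; by rewrite cub_coef.
Qed.

Lemma lin_homog (a b c : R) : lin a b c \is 1.-homog.
Proof.
by rewrite linE !mul_mpolyC; do ?apply: rpredD; apply: rpredZ; rewrite dhomogX; apply/eqP; exact: mdeg_mon.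
Qed.

Lemma cub_homog (c30 c21 c201 c12 c111 c102 c03 c021 c012 c003 : R) :
  cub c30 c21 c201 c12 c111 c102 c03 c021 c012 c003 \is 3.-homog.
Proof.
by rewrite cubE !mul_mpolyC; do ?apply: rpredD; apply: rpredZ; rewrite dhomogX; apply/eqP; exact: mdeg_mon.
Qed.
End Forms.

(** Evaluation, jets, linear substitution and base change all respect sums and products, so
    identities between them need only be checked on constants and variables. *)
Lemma mpoly_ring_ind (R : comNzRingType) (Q : {mpoly R[3]} -> Prop) :
  (forall c, Q c%:MP) -> (forall i, Q 'X_i) ->
  (forall p q, Q p -> Q q -> Q (p + q)) -> (forall p q, Q p -> Q q -> Q (p * q)) ->
  forall p, Q p.
Proof.
move=> QC QX QD QM; elim/mpolyind => [|c m p _ _ Qp]; first by rewrite -mpolyC0.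
have Qn (i : 'I_3) k : Q ('X_i ^+ k).
  elim: k => [|k IH]; first by rewrite expr0 -mpolyC1.
  by rewrite exprS; apply: QM.
apply: QD => //; rewrite -mul_mpolyC; apply: (QM) => //.
by rewrite [m]mon_eta mpolyX_mon; apply: (QM) => //; apply: (QM).
Qed.

(** * Restriction of a form to a line; singular points *)

Section Jets.
Variable R : comNzRingType.
Implicit Types (P : {mpoly R[3]}) (x y : 'cV[R]_3).

Definition ptev P x := P.@[fun i => x i 0].

(** The restriction of [P] to the line through [x] in direction [y], with parameter ['X]. For a
    determinant it is computed entry by entry, which avoids partial derivatives. *)
Definition jet x y P : {poly R} :=
  mmap polyC (fun i => (x i 0)%:P + (y i 0)%:P * 'X) P.

Lemma jetC x y c : jet x y c%:MP = c%:P.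
Proof. by rewrite /jet mmapC. Qed.

Lemma jetX x y i : jet x y 'X_i = (x i 0)%:P + (y i 0)%:P * 'X.
Proof. by rewrite /jet mmapX mmap1U. Qed.

Lemma jetD x y : {morph jet x y : P Q / P + Q}.
Proof. by move=> P Q; rewrite /jet rmorphD. Qed.

Lemma jetM x y : {morph jet x y : P Q / P * Q}.
Proof. by move=> P Q; rewrite /jet rmorphM. Qed.

Lemma jet0 x y P : (jet x y P)`_0 = ptev P x.
Proof.
rewrite /ptev; elim/mpoly_ring_ind: P => [c|i|p q Ep Eq|p q Ep Eq].
- by rewrite jetC mevalC coefC.
- by rewrite jetX mevalXU coefD coefCM coefX coefC mulr0 addr0.
- by rewrite jetD coefD mevalD -Ep -Eq.
- by rewrite jetM coef0M mevalM -Ep -Eq.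
Qed.

Lemma jet1 x y P : (jet x y P)`_1 = \sum_i y i 0 * ptev (mderiv i P) x.
Proof.
rewrite /ptev; elim/mpoly_ring_ind: P => [c|i|p q Ep Eq|p q Ep Eq].
- by rewrite jetC coefC big1 // => i _; rewrite mderivC meval0 mulr0.
- rewrite jetX coefD coefCM coefX coefC add0r mulr1 (bigD1 i) //= big1 => [|j ji].
    by rewrite mderivX mnm1E eqxx -{1}[U_(i)%MM]add0m addmK mpolyX0 scale1r meval1 mulr1 addr0.
  by rewrite mderivX mnm1E eq_sym (negbTE ji) scale0r meval0 mulr0.
- rewrite jetD coefD Ep Eq -big_split.
  by apply: eq_bigr => i _ /=; rewrite mderivD mevalD mulrDr.
- rewrite jetM coefM big_ord_recl big_ord1 /= /bump subn0 subnn Ep Eq !jet0.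
  rewrite mulr_sumr mulr_suml -big_split.
  apply: eq_bigr => i _ /=; rewrite mderivM mevalD !mevalM /ptev; ring.
Qed.

Definition sing P x := ptev P x = 0 /\ forall i, ptev (mderiv i P) x = 0.

(** By [jet1] the linear term along [y] is the gradient paired with [y]; unit vectors recover the
    partial derivatives. In this form singularity is visibly invariant under linear substitution. *)
Lemma singP P x : sing P x <-> forall y, (jet x y P)`_0 = 0 /\ (jet x y P)`_1 = 0.
Proof.
split=> [[P0 P1] y|H]; first by rewrite jet0 jet1 P0 big1 // => i _; rewrite P1 mulr0.
split=> [|i]; first by rewrite -(jet0 x 0) (H 0).1.
have := (H (delta_mx i 0)).2; rewrite jet1 (bigD1 i) //= big1 => [|j ji].
  by rewrite mxE !eqxx mul1r addr0.
by rewrite mxE (negbTE ji) mul0r.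
Qed.

Lemma jet_sing P x : (forall y, exists r, jet x y P = 'X ^+ 2 * r) -> sing P x.
Proof. by move=> H; apply/singP => y; have [r ->] := H y; rewrite !coefXnM. Qed.
End Jets.

Section MapMpoly.
Variables (R S : comNzRingType) (f : {rmorphism R -> S}).

Lemma map_mpolyXU (i : 'I_3) : map_mpoly f 'X_i = 'X_i.
Proof. exact: map_mpolyX. Qed.

Lemma ptev_map (P : {mpoly R[3]}) x : ptev (map_mpoly f P) (map_mx f x) = f (ptev P x).
Proof.
rewrite /ptev; elim/mpoly_ring_ind: P => [c|i|p q Ep Eq|p q Ep Eq].
- by rewrite map_mpolyC !mevalC.
- by rewrite map_mpolyXU !mevalXU mxE.
- by rewrite rmorphD !mevalD rmorphD Ep Eq.
- by rewrite rmorphM !mevalM rmorphM Ep Eq.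
Qed.

Lemma mderiv_map (P : {mpoly R[3]}) i : mderiv i (map_mpoly f P) = map_mpoly f (mderiv i P).
Proof.
elim/mpoly_ring_ind: P => [c|j|p q Ep Eq|p q Ep Eq].
- by rewrite map_mpolyC !mderivC rmorph0.
- by rewrite map_mpolyXU !mderivX map_mpolyZ rmorph_nat map_mpolyX.
- by rewrite rmorphD !mderivD rmorphD /= Ep Eq.
- by rewrite rmorphM !mderivM rmorphD !rmorphM /= Ep Eq.
Qed.

Lemma map_mpoly_homog d (P : {mpoly R[3]}) : P \is d.-homog -> map_mpoly f P \is d.-homog.
Proof.
move=> hP; apply/dhomogP => m; rewrite mcoeff_msupp mcoeff_map_mpoly => nz.
have [//|ne] := eqVneq (mdeg m) d.
by rewrite (dhomog_nemf_coeff hP ne) raddf0 eqxx in nz.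
Qed.

Lemma map_mpoly_inj : injective f -> injective (map_mpoly f : {mpoly R[3]} -> {mpoly S[3]}).
Proof.
move=> inj p q E; apply/mpolyP => m; apply: inj.
by rewrite -!mcoeff_map_mpoly E.
Qed.
End MapMpoly.

Lemma map_mpoly_id (R : comNzRingType) (P : {mpoly R[3]}) (f : {rmorphism R -> R}) :
  f =1 id -> map_mpoly f P = P.
Proof. by move=> E; apply/mpolyP => m; rewrite mcoeff_map_mpoly /= E. Qed.

Lemma map_mpoly_comp2 (R S A : comNzRingType) (f : {rmorphism R -> S})
  (g : {rmorphism S -> A}) (P : {mpoly R[3]}) :
  map_mpoly (g \o f) P = map_mpoly g (map_mpoly f P).
Proof. by apply/mpolyP => m; rewrite !mcoeff_map_mpoly. Qed.

(** * Linear substitutions and smoothness *)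

Section LinSubst.
Variable K : fieldType.
Implicit Types (P Q : {mpoly K[3]}) (g h : 'M[K]_3) (x y : 'cV[K]_3).

Lemma lin_substC g c : lin_subst g c%:MP = c%:MP.
Proof. exact: comp_mpolyC. Qed.

Lemma lin_substX g i : lin_subst g 'X_i = \sum_j (g i j)%:MP * 'X_j.
Proof. by rewrite /lin_subst comp_mpolyXU -tnth_nth tnth_mktuple. Qed.

Lemma lin_substD g : {morph lin_subst g : P Q / P + Q}.
Proof. by move=> P Q; rewrite /lin_subst rmorphD. Qed.

Lemma lin_substM g : {morph lin_subst g : P Q / P * Q}.
Proof. by move=> P Q; rewrite /lin_subst rmorphM. Qed.

Lemma lin_substZ g c P : lin_subst g (c *: P) = c *: lin_subst g P.
Proof. by rewrite /lin_subst linearZ. Qed.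

Lemma lin_subst_mul g h P : lin_subst g (lin_subst h P) = lin_subst (h *m g) P.
Proof.
elim/mpoly_ring_ind: P => [c|i|p q Ep Eq|p q Ep Eq]; last 2 first.
- by rewrite !lin_substD Ep Eq.
- by rewrite !lin_substM Ep Eq.
- by rewrite !lin_substC.
rewrite !lin_substX /lin_subst rmorph_sum /=.
under eq_bigr do rewrite rmorphM /= comp_mpolyC -/(lin_subst g _) lin_substX mulr_sumr.
rewrite exchange_big; apply: eq_bigr => k _ /=; rewrite mxE rmorph_sum mulr_suml.
by apply: eq_bigr => j _; rewrite mulrA rmorphM.
Qed.

Lemma lin_subst1 P : lin_subst 1%:M P = P.
Proof.
elim/mpoly_ring_ind: P => [c|i|p q Ep Eq|p q Ep Eq]; last 2 first.
- by rewrite !lin_substD Ep Eq.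
- by rewrite !lin_substM Ep Eq.
- by rewrite !lin_substC.
rewrite lin_substX (bigD1 i) //= big1 => [|j ji].
  by rewrite mxE eqxx mul1r addr0.
by rewrite mxE eq_sym (negbTE ji) mul0r.
Qed.

Lemma lin_subst_inv g P : g \in unitmx -> lin_subst (invmx g) (lin_subst g P) = P.
Proof. by move=> gU; rewrite lin_subst_mul mulmxV // lin_subst1. Qed.

Lemma jet_subst g x y P : jet x y (lin_subst g P) = jet (g *m x) (g *m y) P.
Proof.
elim/mpoly_ring_ind: P => [c|i|p q Ep Eq|p q Ep Eq]; last 2 first.
- by rewrite lin_substD !jetD Ep Eq.
- by rewrite lin_substM !jetM Ep Eq.
- by rewrite lin_substC !jetC.
rewrite lin_substX jetX !mxE !sum3 !jetD !jetM !jetC !jetX !polyCD !polyCM; ring.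
Qed.

Lemma ptev_subst g x P : ptev (lin_subst g P) x = ptev P (g *m x).
Proof. by rewrite -(jet0 x 0) jet_subst jet0. Qed.

Lemma lin_subst_homog d g P : P \is d.-homog -> lin_subst g P \is d.-homog.
Proof.
move=> hP; rewrite [P]mpolyE /lin_subst rmorph_sum /= big_seq; apply: rpred_sum => m mP.
rewrite linearZ /=; apply: rpredZ; rewrite comp_mpolyX prod3.
have -> : d = (1 * m 0%R + 1 * m 1%R + 1 * m 2%R)%N.
  by rewrite -(dhomog_mf hP mP) /= {1}[m]mon_eta mdeg_mon !mul1n.
have h1 i : tnth [tuple \sum_(j < 3) (g i j)%:MP * 'X_j | i < 3] i \is 1.-homog.
  rewrite tnth_mktuple; apply: rpred_sum => j _; rewrite mul_mpolyC; apply: rpredZ.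
  by rewrite dhomogX; apply/eqP; exact: mdeg1.
by do !apply: dhomogM; apply: dhomogMn.
Qed.

Lemma sing_subst g x P : g \in unitmx -> sing (lin_subst g P) x -> sing P (g *m x).
Proof.
move=> gU /singP H; apply/singP => y.
by have := H (invmx g *m y); rewrite jet_subst mulmxA mulmxV // mul1mx.
Qed.
End LinSubst.

Lemma map_lin_subst (K L : fieldType) (f : {rmorphism K -> L}) g (P : {mpoly K[3]}) :
  map_mpoly f (lin_subst g P) = lin_subst (map_mx f g) (map_mpoly f P).
Proof.
elim/mpoly_ring_ind: P => [c|i|p q Ep Eq|p q Ep Eq]; last 2 first.
- by rewrite !(lin_substD, rmorphD) /= Ep Eq.
- by rewrite !(lin_substM, rmorphM) /= Ep Eq.
- by rewrite map_mpolyC !lin_substC map_mpolyC.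
rewrite map_mpolyXU !lin_substX rmorph_sum; apply: eq_bigr => j _.
by rewrite rmorphM /= map_mpolyC map_mpolyXU mxE.
Qed.

Section Smooth.
Variable K : fieldType.
Implicit Type P : {mpoly K[3]}.

Lemma smoothP P : smooth_cubic P <-> P \is 3.-homog /\
  forall (L : fieldType) (f : {rmorphism K -> L}) (x : 'cV[L]_3),
    x != 0 -> ~ sing (map_mpoly f P) x.
Proof.
split=> -[hP H]; split=> // L f x xN0.
  move=> [P0 P1]; apply: (H L f (fun i => x i 0)).
    case/cV0Pn: xN0 => i xi; by exists i.
  by split=> // i; rewrite -mderiv_map; exact: P1.
have E (Q : {mpoly L[3]}) : Q.@[x] = ptev Q (\col_i x i).
  by apply: meval_eq => i; rewrite mxE.
case: xN0 => i xi [P0 P1]; apply: (H L f (\col_i x i)).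
  by apply/cV0Pn; exists i; rewrite mxE.
by split=> [|j]; rewrite ?mderiv_map -E.
Qed.

Lemma smooth_nsing P x : smooth_cubic P -> x != 0 -> ~ sing P x.
Proof.
move=> /smoothP[_ H] xN0 S; apply: (H K idfun x xN0).
by rewrite map_mpoly_id.
Qed.

Lemma smooth_subst g P : g \in unitmx -> smooth_cubic P -> smooth_cubic (lin_subst g P).
Proof.
move=> gU /smoothP[hP H]; apply/smoothP; split; first exact: lin_subst_homog.
move=> L f x xN0; rewrite map_lin_subst => /sing_subst S.
have gfU : map_mx f g \in unitmx by rewrite map_unitmx.
apply: (H L f _ _ (S gfU)); apply: contraNneq xN0 => E.
by rewrite -(mulKmx gfU x) E mulmx0.
Qed.

End Smooth.

Lemma smooth_map (K L : fieldType) (f : {rmorphism K -> L}) (P : {mpoly K[3]}) :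
  smooth_cubic P -> smooth_cubic (map_mpoly f P).
Proof.
move=> /smoothP[hP H]; apply/smoothP; split; first exact: map_mpoly_homog.
move=> A g x xN0; rewrite -map_mpoly_comp2; exact: H.
Qed.

(** * Determinantal representations as triples of matrices *)

Section Tensors.
Variable R : comNzRingType.

(** A matrix of linear forms is stored as its three scalar coefficient matrices, so that kernels,
    ranks and base changes are taken over the field. *)
Definition tens := {ffun 'I_3 -> 'M[R]_3}.
Implicit Types (T : tens) (x y : 'cV[R]_3) (A B g : 'M[R]_3).

Definition tev T x : 'M[R]_3 := \sum_i x i 0 *: T i.
Definition pencil T : 'M[{mpoly R[3]}]_3 := \sum_i 'X_i *: map_mx (@mpolyC 3 R) (T i).
Definition tact A T B : tens := [ffun i => A *m T i *m B].
Definition tsub g T : tens := [ffun j => \sum_i g i j *: T i].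

Lemma pencilE T a b : pencil T a b = lin (T 0 a b) (T 1 a b) (T 2 a b).
Proof. by rewrite /pencil sum3 !mxE /lin; congr (_ + _ + _); rewrite mulrC. Qed.

Lemma tevE T x a b : tev T x a b = x 0 0 * T 0 a b + x 1 0 * T 1 a b + x 2 0 * T 2 a b.
Proof. by rewrite /tev sum3 !mxE. Qed.

Lemma tev_act A T B x : tev (tact A T B) x = A *m tev T x *m B.
Proof.
rewrite /tev mulmx_sumr mulmx_suml; apply: eq_bigr => i _.
by rewrite ffunE -scalemxAr -scalemxAl.
Qed.

Lemma tev_sub g T x : tev (tsub g T) x = tev T (g *m x).
Proof. by apply/matrixP => a b; rewrite !tevE !mxE !ffunE !sum3 !mxE; ring. Qed.

Lemma pencil_act A T B : pencil (tact A T B) =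
  map_mx (@mpolyC 3 R) A *m pencil T *m map_mx (@mpolyC 3 R) B.
Proof.
rewrite /pencil mulmx_sumr mulmx_suml; apply: eq_bigr => i _.
by rewrite ffunE -scalemxAr -scalemxAl !map_mxM.
Qed.

Lemma det_map_mpolyC A : \det (map_mx (@mpolyC 3 R) A) = (\det A)%:MP.
Proof. by rewrite det_map_mx. Qed.

Lemma det_pencil_act A T B :
  \det (pencil (tact A T B)) = (\det A * \det B) *: \det (pencil T).
Proof. by rewrite pencil_act !det_mulmx !det_map_mpolyC -mul_mpolyC mpolyCM; ring. Qed.

(** Common source of the formulas for evaluation, jets, base change and substitution of the
    determinant: each is a ring morphism, and those commute with [\det]. *)
Lemma map_det_pencil (S : comNzRingType) (f : {rmorphism {mpoly R[3]} -> S}) (h : R -> S) T :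
  (forall c, f c%:MP = h c) ->
  f (\det (pencil T)) = \det (\matrix_(a, b) \sum_i f 'X_i * h (T i a b)).
Proof.
move=> fC; rewrite -det_map_mx; congr (\det _); apply/matrixP => a b.
by rewrite !mxE pencilE /lin sum3 !rmorphD !rmorphM !fC; congr (_ + _ + _); rewrite mulrC.
Qed.

Lemma ptev_det T x : ptev (\det (pencil T)) x = \det (tev T x).
Proof.
rewrite /ptev (@map_det_pencil _ (meval _) id) => [|c]; last exact: mevalC.
by congr (\det _); apply/matrixP => a b; rewrite mxE tevE sum3 /= !mevalXU.
Qed.

Lemma jet_det T x y :
  jet x y (\det (pencil T)) = \det (map_mx polyC (tev T x) + 'X *: map_mx polyC (tev T y)).
Proof.
rewrite /jet (@map_det_pencil _ (mmap _ _) polyC) => [|c]; last by rewrite /= mmapC.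
congr (\det _); apply/matrixP => a b; rewrite !mxE !tevE sum3 /=.
rewrite -!/(jet x y _) !jetX !polyCD !polyCM; ring.
Qed.
End Tensors.

Definition tmap (R S : comNzRingType) (f : R -> S) (T : tens R) : tens S :=
  [ffun i => map_mx f (T i)].

Lemma map_pencil (R S : comNzRingType) (f : {rmorphism R -> S}) (T : tens R) :
  map_mpoly f (\det (pencil T)) = \det (pencil (tmap f T)).
Proof.
rewrite (@map_det_pencil _ _ (map_mpoly f) (@mpolyC 3 S \o f)) => [|c]; last first.
  exact: map_mpolyC.
congr (\det _); apply/matrixP => a b.
by rewrite mxE pencilE /lin sum3 !ffunE !mxE /= !map_mpolyXU ![_%:MP * _]mulrC.
Qed.

Lemma pencil_sub (K : fieldType) (g : 'M[K]_3) (T : tens K) :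
  \det (pencil (tsub g T)) = lin_subst g (\det (pencil T)).
Proof.
rewrite /lin_subst (@map_det_pencil _ _ (comp_mpoly _) (@mpolyC 3 K)) => [|c]; last first.
  exact: comp_mpolyC.
congr (\det _); apply/matrixP => a b; rewrite mxE pencilE sum3 /= -!/(lin_subst g _).
by rewrite !lin_substX !ffunE !sum3 !mxE /lin !mpolyCD !mpolyCM; ring.
Qed.

Section Reps.
Variable K : fieldType.
Implicit Types (P : {mpoly K[3]}) (T : tens K) (A B g : 'M[K]_3) (x : 'cV[K]_3).

Definition rep P T := exists2 lam : K, lam != 0 & P = lam *: \det (pencil T).

Definition teq T T' :=
  exists A B, [/\ A \in unitmx, B \in unitmx & T' = tact A T B].

Lemma tact_comp A A' T B B' : tact A (tact A' T B') B = tact (A *m A') T (B' *m B).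
Proof. by apply/ffunP => i; rewrite !ffunE !mulmxA. Qed.

Lemma tact1 T : tact 1%:M T 1%:M = T.
Proof. by apply/ffunP => i; rewrite !ffunE mul1mx mulmx1. Qed.

Lemma teq_sym T T' : teq T T' -> teq T' T.
Proof.
case=> A [B [Au Bu ->]]; exists (invmx A), (invmx B); split; rewrite ?unitmx_inv //.
by rewrite tact_comp mulVmx // mulmxV // tact1.
Qed.

Lemma teq_trans T T' T'' : teq T T' -> teq T' T'' -> teq T T''.
Proof.
case=> A [B [Au Bu ->]] [A' [B' [Au' Bu' ->]]].
by exists (A' *m A), (B *m B'); split; rewrite ?unitmx_mul ?Au ?Au' ?Bu ?Bu' ?tact_comp.
Qed.

Lemma rep_act P T A B : A \in unitmx -> B \in unitmx -> rep P T -> rep P (tact A T B).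
Proof.
move=> Au Bu [l l0 ->].
have d0 : \det A * \det B != 0 by rewrite mulf_neq0 // -unitfE -unitmxE.
exists (l / (\det A * \det B)); first by rewrite mulf_neq0 // invr_eq0.
by rewrite det_pencil_act scalerA mulfVK.
Qed.

Lemma rep_teq P T T' : teq T T' -> rep P T -> rep P T'.
Proof. by case=> A [B [Au Bu ->]]; apply: rep_act. Qed.

Lemma rep_sub P T g : rep P T -> rep (lin_subst g P) (tsub g T).
Proof. by case=> l l0 ->; exists l => //; rewrite lin_substZ pencil_sub. Qed.

Lemma rep_det P T x : rep P T -> (ptev P x == 0) = (\det (tev T x) == 0).
Proof.
case=> l l0 ->; rewrite -ptev_det /ptev mevalZ mulf_eq0 (negbTE l0) //.
Qed.

Lemma rep_nsing P T x : smooth_cubic P -> rep P T -> x != 0 -> ~ sing (\det (pencil T)) x.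
Proof.
move=> sP [l l0 E] x0 S; apply: (smooth_nsing sP x0); apply/singP => y.
by rewrite E -mul_mpolyC jetM jetC !coefCM ((singP _ _).1 S y).1 ((singP _ _).1 S y).2 !mulr0.
Qed.

(** Turns a rank bound into vanishing rows: after multiplication by [A] the first [\rank W] rows
    come from the row space of [W]. *)
Lemma exists_row_basis n (W : 'M[K]_(n, 3)) : exists2 A : 'M[K]_3, A \in unitmx &
  forall k : 'I_3, (k < \rank W)%N -> (row k A <= W)%MS.
Proof.
exists (row_ebase W); first exact: row_ebase_unit.
move=> k kW; rewrite -(eq_row_base W).
suff -> : row k (row_ebase W) = row (Ordinal kW) (row_base W) by apply: row_sub.
apply/rowP => j; rewrite mxE [in RHS]mxE [in RHS]mxE (bigD1 k) //= big1 => [|l lk].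
  by rewrite mxE eqxx kW mul1r addr0.
by rewrite mxE /= eq_sym (inj_eq val_inj) (negbTE lk) mul0r.
Qed.

Lemma exists_unit_row (u : 'rV[K]_3) : u != 0 -> exists2 A : 'M[K]_3, A \in unitmx & row 0 A = u.
Proof.
move=> u0; have [A Au /(_ 0)] := exists_row_basis u; rewrite rank_rV u0 => /(_ isT).
case/submxP => D E; have D0 : D 0 0 != 0.
  apply: contraTneq Au => D0; apply/negP => Au.
  have : delta_mx 0 0 *m A = 0 :> 'rV_3.
    by rewrite -rowE E [D]mx11_scalar D0 -scalemx1 scale0r mul0mx.
  move/(congr1 (fun M => M *m invmx A)); rewrite mulmxK // mul0mx => /matrixP/(_ 0 0)/eqP.
  by rewrite !mxE !eqxx oner_eq0.
exists ((D 0 0)^-1 *: A); first by rewrite unitmxZ // unitfE invr_eq0.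
apply/rowP => j; rewrite mxE; have /rowP/(_ j) := E; rewrite !mxE big_ord1 => ->.
by rewrite mulKf.
Qed.

Lemma sub_mul0 m n k (u : 'M[K]_(m, 3)) (W : 'M[K]_(n, 3)) (N : 'M[K]_(3, k)) :
  (u <= W)%MS -> W *m N = 0 -> u *m N = 0.
Proof. by case/submxP => D -> E; rewrite -mulmxA E mulmx0. Qed.

Lemma row_mul0 k (A : 'M[K]_3) (N : 'M[K]_(3, k)) i j : row i A *m N = 0 -> (A *m N) i j = 0.
Proof. by rewrite -row_mul => /rowP/(_ j); rewrite !mxE. Qed.

Section Smooth.
Variables (P : {mpoly K[3]}) (T : tens K).
Hypotheses (sP : smooth_cubic P) (rT : rep P T).

(** Two independent left kernel vectors at [x] can be made the first two rows; both then vanish at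
    [x], so the determinant vanishes there to order two and [x] is singular. *)
Lemma rep_corank n (W : 'M[K]_(n, 3)) x : x != 0 -> W *m tev T x = 0 -> (\rank W <= 1)%N.
Proof.
move=> x0 E; rewrite leqNgt; apply/negP => rW.
have [A Au hA] := exists_row_basis W.
have a0 j : (A *m tev T x) 0 j = 0.
  by apply: row_mul0; apply: sub_mul0 E; apply: hA; apply: ltn_trans rW.
have a1 j : (A *m tev T x) 1 j = 0 by apply: row_mul0; apply: sub_mul0 E; apply: hA.
have rT1 : rep P (tact A T 1%:M) by apply: rep_act => //; rewrite unitmx1.
apply: (rep_nsing sP rT1 x0); apply: jet_sing => y.
rewrite jet_det det3 !mxE !tev_act !mulmx1 !a0 !a1 !polyC0 !add0r.
set N := A *m tev T y; set M := A *m tev T x.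
(* The witness is the determinant with a factor ['X] taken out of each of the first two rows. *)
exists ( 
 (N 0 0)%:P * ((N 1 1)%:P * ((M 2 2)%:P + 'X * (N 2 2)%:P) - (N 1 2)%:P * ((M 2 1)%:P + 'X * (N 2 1)%:P))
 - (N 0 1)%:P * ((N 1 0)%:P * ((M 2 2)%:P + 'X * (N 2 2)%:P) - (N 1 2)%:P * ((M 2 0)%:P + 'X * (N 2 0)%:P))
 + (N 0 2)%:P * ((N 1 0)%:P * ((M 2 1)%:P + 'X * (N 2 1)%:P) - (N 1 1)%:P * ((M 2 0)%:P + 'X * (N 2 0)%:P))).
rewrite expr2; ring.
Qed.

(** The derivative of the determinant at [x] in direction [T i] is proportional to [u *m T i *m v].
    Concretely, after a base change the corner entry is identically zero and the first row and
    column vanish at [x], which forces order two. *)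
Lemma rep_kernel (u : 'rV[K]_3) (v x : 'cV[K]_3) : u != 0 -> v != 0 -> x != 0 ->
  u *m tev T x = 0 -> tev T x *m v = 0 -> (forall i, u *m T i *m v = 0) -> False.
Proof.
move=> u0 v0 x0 ux xv uv.
have [A Au uA] := exists_unit_row u0.
have [C Cu vC] : exists2 C : 'M[K]_3, C \in unitmx & row 0 C = v^T.
  by apply: exists_unit_row; rewrite trmx_eq0.
have M0 j : (A *m tev T x *m C^T) 0 j = 0.
  by rewrite -mulmxA; apply: row_mul0; rewrite uA mulmxA ux mul0mx.
have M0' j : (A *m tev T x *m C^T) j 0 = 0.
  rewrite -[A *m _ *m _]trmxK mxE !trmx_mul trmxK; apply: row_mul0.
  by rewrite vC mulmxA -trmx_mul xv trmx0 mul0mx.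
have N0 y : (A *m tev T y *m C^T) 0 0 = 0.
  have -> : (A *m tev T y *m C^T) 0 0 = (u *m tev T y *m v) 0 0.
    rewrite -uA -[v]trmxK -vC !mxE; apply: eq_bigr => j _; rewrite !mxE; congr (_ * _).
    by apply: eq_bigr => k _; rewrite !mxE.
  rewrite /tev mulmx_sumr mulmx_suml summxE big1 // => i _.
  by rewrite -scalemxAr -scalemxAl uv scaler0 mxE.
have rT1 : rep P (tact A T C^T) by apply: rep_act => //; rewrite unitmx_tr.
apply: (rep_nsing sP rT1 x0); apply: jet_sing => y.
rewrite jet_det det3 !mxE !tev_act !M0 !M0' !N0 !polyC0 !add0r !mulr0.
set N := A *m tev T y *m _; set M := A *m tev T x *m _.
exists (- (N 0 1)%:P * ((N 1 0)%:P * ((M 2 2)%:P + 'X * (N 2 2)%:P) - ((M 1 2)%:P + 'X * (N 1 2)%:P) * (N 2 0)%:P)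
 + (N 0 2)%:P * ((N 1 0)%:P * ((M 2 1)%:P + 'X * (N 2 1)%:P) - ((M 1 1)%:P + 'X * (N 1 1)%:P) * (N 2 0)%:P)).
rewrite expr2; ring.
Qed.

End Smooth.
End Reps.

Lemma rep_map (K L : fieldType) (f : {rmorphism K -> L}) (P : {mpoly K[3]}) T :
  rep P T -> rep (map_mpoly f P) (tmap f T).
Proof.
case=> l l0 ->; exists (f l); first by rewrite fmorph_eq0.
by rewrite -!mul_mpolyC rmorphM /= map_mpolyC map_pencil.
Qed.

Lemma quadratic_root (L : closedFieldType) (a b c : L) : a != 0 ->
  exists s, a * s ^+ 2 + b * s + c = 0.
Proof.
move=> a0; have sz : size (a *: 'X^2 + b *: 'X + c%:P) == 3%N.
  have s2 : size (a *: 'X^2 : {poly L}) = 3%N by rewrite size_scale // size_polyXn.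
  rewrite -addrA size_polyDl s2 //; apply: leq_ltn_trans (size_polyD _ _) _.
  rewrite gtn_max (leq_ltn_trans (size_scale_leq _ _)) ?size_polyX //.
  by rewrite (leq_ltn_trans (size_polyC_leq1 _)).
have [s /rootP] : exists s, root (a *: 'X^2 + b *: 'X + c%:P) s.
  by apply/closed_rootP; rewrite (eqP sz).
by rewrite !hornerD !hornerZ hornerX hornerXn hornerC; exists s.
Qed.

(** If the rows [u *m T i] span at most a line, a base change makes the first row of the pencil
    [(0, 0, l)]. The cubic is then the line [l] times a conic, and singular where they meet; the
    meeting point may need a quadratic extension, hence the closed field. *)
Lemma rep_rows_closed (L : closedFieldType) (P : {mpoly L[3]}) T n
    (u : 'rV[L]_3) (V : 'M[L]_(3, n)) :
  smooth_cubic P -> rep P T -> u != 0 -> (forall i, u *m T i *m V = 0) -> (\rank V <= 1)%N.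
Proof.
move=> sP rT u0 uV; rewrite leqNgt; apply/negP; rewrite -mxrank_tr => rV.
have [A Au uA] := exists_unit_row u0; have [B Bu hB] := exists_row_basis V^T.
pose T1 := tact A T B^T.
have rT1 : rep P T1 by apply: rep_act => //; rewrite unitmx_tr.
have T10 (j : 'I_3) i : (j < 2)%N -> T1 i 0 j = 0.
  move=> j2; have -> : T1 i 0 j = (u *m T i *m (row j B)^T) 0 0.
    rewrite ffunE -uA !mxE; apply: eq_bigr => k _; rewrite !mxE; congr (_ * _).
    by apply: eq_bigr => l _; rewrite !mxE.
  have /submxP[D ->] := hB _ (leq_trans j2 rV).
  by rewrite trmx_mul trmxK mulmxA uV mul0mx mxE.
pose l : 'rV[L]_3 := \row_i T1 i 0 2.
(* [l] may be zero, so only a line contained in its zero set is chosen, with equation [row 0 g]. *)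
have [g [gu [c lg]]] : exists g : 'M[L]_3, g \in unitmx /\ exists c, l = c *: row 0 g.
  have [l0|l0] := eqVneq l 0.
    by exists 1%:M; rewrite unitmx1; split=> //; exists 0; rewrite scale0r.
  by have [g gu <-] := exists_unit_row l0; exists g; split=> //; exists 1; rewrite scale1r.
pose N x := tev T1 x.
(* [q] is the minor complementary to [l], and [pt] parametrises the line with equation [row 0 g]. *)
pose q x := N x 1 0 * N x 2 1 - N x 1 1 * N x 2 0.
pose pt (s t : L) := invmx g *m col3 0 s t.
have [s [t [st0 qst]]] : exists s t, col3 0 s t != 0 :> 'cV_3 /\ q (pt s t) = 0.
  have [q1|q1] := eqVneq (q (pt 1 0)) 0.
    exists 1, 0; split=> //; apply/cV0Pn; exists 1; rewrite col3E; exact: oner_neq0.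
  have Npt s t : pt s t = s *: pt 1 0 + t *: pt 0 1.
    rewrite /pt !scalemxAr -mulmxDr; congr (_ *m _); apply/colP => i.
    by case: (ord3P i) => ->; rewrite !mxE /=; ring.
  have [s qs] := quadratic_root (N (pt 1 0) 1 0 * N (pt 0 1) 2 1 + N (pt 0 1) 1 0 * N (pt 1 0) 2 1
    - N (pt 1 0) 1 1 * N (pt 0 1) 2 0 - N (pt 0 1) 1 1 * N (pt 1 0) 2 0) (q (pt 0 1)) q1.
  exists s, 1; split; first by apply/cV0Pn; exists 2; rewrite col3E; exact: oner_neq0.
  rewrite -qs (Npt s 1) /q /N !tevE; have E (a b : 'cV[L]_3) i :
    (s *: a + 1 *: b) i 0 = s * a i 0 + b i 0 by rewrite !mxE mul1r.
  by rewrite !E; ring.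
have x0 : pt s t != 0.
  by apply: contraNneq st0 => E; rewrite -(mulKVmx gu (col3 0 s t)) -/(pt s t) E mulmx0.
have N2 : N (pt s t) 0 2 = 0.
  have -> : N (pt s t) 0 2 = (l *m pt s t) 0 0.
    have lE i : l 0 i = T1 i 0 2 by rewrite mxE.
    by rewrite /N tevE [in RHS]mxE sum3 !lE; ring.
  rewrite lg -scalemxAl -row_mul mulKVmx // mxE; apply/eqP; rewrite mulf_eq0; apply/orP; right.
  by rewrite !mxE.
have Nj y (j : 'I_3) : (j < 2)%N -> N y 0 j = 0 by move=> j2; rewrite tevE !T10 // !mulr0 !addr0.
apply: (rep_nsing sP rT1 x0); apply: jet_sing => y.
rewrite jet_det det3 !mxE -!/(N _) !(Nj _ 0) // !(Nj _ 1) // N2.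
have := congr1 polyC qst; rewrite /q polyCB !polyCM polyC0 => /eqP; rewrite subr_eq0 => /eqP qst'.
set M := N (pt s t) in qst' *; set M' := N y.
exists ((M' 0 2)%:P * ((M 1 0)%:P * (M' 2 1)%:P + (M' 1 0)%:P * ((M 2 1)%:P + 'X * (M' 2 1)%:P)
  - (M 1 1)%:P * (M' 2 0)%:P - (M' 1 1)%:P * ((M 2 0)%:P + 'X * (M' 2 0)%:P))).
rewrite expr2.
transitivity ('X * (M' 0 2)%:P * ((M 1 0)%:P * (M 2 1)%:P - (M 1 1)%:P * (M 2 0)%:P)
 + 'X * 'X * ((M' 0 2)%:P * ((M 1 0)%:P * (M' 2 1)%:P + (M' 1 0)%:P * ((M 2 1)%:P + 'X * (M' 2 1)%:P)
  - (M 1 1)%:P * (M' 2 0)%:P - (M' 1 1)%:P * ((M 2 0)%:P + 'X * (M' 2 0)%:P)))); first by ring.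
by rewrite qst' subrr mulr0 add0r.
Qed.

Section FinReps.
Variable K : finFieldType.
Implicit Types (P : {mpoly K[3]}) (T : tens K).

Lemma rep_rows P T n (u : 'rV[K]_3) (V : 'M[K]_(3, n)) :
  smooth_cubic P -> rep P T -> u != 0 -> (forall i, u *m T i *m V = 0) -> (\rank V <= 1)%N.
Proof.
move=> sP rT u0 uV; have [L [f _]] := countable_algebraic_closure K.
rewrite -(mxrank_map f); apply: (@rep_rows_closed L _ _ _ (map_mx f u) _ (smooth_map f sP) (rep_map f rT)).
  by rewrite map_mx_eq0.
by move=> i; rewrite ffunE -!map_mxM uV map_mx0.
Qed.

Lemma rank2_kernel n (W : 'M[K]_(n, 3)) : (\rank W <= 1)%N ->
  exists V : 'M[K]_3, W *m V = 0 /\ (1 < \rank V)%N.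
Proof.
move=> rW; exists (kermx W^T)^T; split.
  by rewrite -[LHS]trmxK trmx_mul trmxK mulmx_ker trmx0.
by rewrite mxrank_tr mxrank_ker mxrank_tr; case: (\rank W) rW => [|[|]].
Qed.

(** [U] preserves the left kernel of [tev T p], which is a line by [rep_corank], so its generator
    [u] is an eigenvector, with eigenvalue [c]. With [W = V^-1 - c] one has [(U - c) T_i = T_i W];
    [u] bounds the rank of [W] by one, and a non-zero row of [U - c] paired with the kernel of [W]
    contradicts [rep_rows]. *)
Lemma rep_stabilizer P T (p : 'cV[K]_3) (U V : 'M[K]_3) :
  smooth_cubic P -> rep P T -> p != 0 -> ptev P p = 0 -> V \in unitmx ->
  (forall i, U *m T i *m V = T i) -> exists c, U = c%:M.
Proof.
move=> sP rT p0 Pp Vu UTV.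
have /eqP := Pp; rewrite (rep_det _ rT) => /det0P[u u0 up].
have UT i : U *m T i = T i *m invmx V by rewrite -[in RHS]UTV mulmxK.
have UTx x : U *m tev T x = tev T x *m invmx V.
  by rewrite /tev mulmx_sumr mulmx_suml; apply: eq_bigr => i _; rewrite -scalemxAr -scalemxAl UT.
have uUp : u *m U *m tev T p = 0 by rewrite -mulmxA UTx mulmxA up mul0mx.
have rk : (\rank (col_mx u (u *m U)) <= 1)%N.
  by apply: (rep_corank sP rT p0); rewrite mul_col_mx up uUp col_mx0.
have uU : (u *m U <= u)%MS.
  have su : (u <= col_mx u (u *m U))%MS by rewrite -addsmxE addsmxSl.
  have : (col_mx u (u *m U) <= u)%MS.
    by rewrite -(geq_leqif (mxrank_leqif_sup su)) rank_rV u0.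
  by apply: submx_trans; rewrite -addsmxE addsmxSr.
have {uU}[c uU] : exists c, u *m U = c *: u.
  by have /submxP[D ->] := uU; exists (D 0 0); rewrite {1}[D]mx11_scalar mul_scalar_mx.
exists c; apply/eqP; rewrite -subr_eq0; apply/negPn/negP => U0.
pose W := invmx V - c%:M.
have UW i : (U - c%:M) *m T i = T i *m W.
  by rewrite mulmxBl mulmxBr UT mul_scalar_mx mul_mx_scalar.
have rW : (\rank W <= 1)%N.
  apply: (rep_rows sP rT u0) => i.
  by rewrite -mulmxA -UW mulmxA mulmxBr uU mul_mx_scalar subrr mul0mx.
have [Vk [WV rV]] := rank2_kernel rW.
have [i ri] : exists i, row i (U - c%:M) != 0.
  apply/existsP; rewrite -negb_forall; apply: contraNN U0 => /forallP H.
  by apply/eqP/row_matrixP => i; rewrite row0; apply/eqP.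
have : (\rank Vk <= 1)%N.
  by apply: (rep_rows sP rT ri) => j; rewrite -row_mul UW -row_mul -mulmxA WV mulmx0 row0.
by rewrite leqNgt rV.
Qed.
End FinReps.

(** * The residual point of a representation *)

Definition indep (K : fieldType) (p t : 'cV[K]_3) : Prop :=
  forall a b : K, a *: p + b *: t = 0 -> a = 0 /\ b = 0.

Section Residual.
Variable K : fieldType.
Implicit Types (P : {mpoly K[3]}) (T : tens K) (p t : 'cV[K]_3) (A B g : 'M[K]_3).

(* [t] is the point where [v], the common normal of the rows [u T_i], enters the right kernel. *)
Definition residual T p t := exists (u : 'rV[K]_3) (v : 'cV[K]_3),
  [/\ u != 0, v != 0, u *m tev T p = 0, (forall i, u *m T i *m v = 0) & tev T t *m v = 0].

Lemma residual_act T A B p t : A \in unitmx -> B \in unitmx -> residual T p t ->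
  residual (tact A T B) p t.
Proof.
move=> Au Bu [u [v [u0 v0 up uv tv]]]; exists (u *m invmx A), (invmx B *m v); split.
- by apply: contraNneq u0 => E; rewrite -(mulmxKV Au u) E mul0mx.
- by apply: contraNneq v0 => E; rewrite -(mulKVmx Bu v) E mulmx0.
- by rewrite tev_act !mulmxA mulmxKV // up mul0mx.
- by move=> i; rewrite ffunE !mulmxA mulmxKV // mulmxK.
- by rewrite tev_act -!mulmxA mulKVmx // tv mulmx0.
Qed.

Lemma residual_teq T T' p t : teq T T' -> residual T p t -> residual T' p t.
Proof. by case=> A [B [Au Bu ->]]; apply: residual_act. Qed.

Lemma residual_sub T g p t : residual T (g *m p) (g *m t) -> residual (tsub g T) p t.
Proof.
move=> [u [v [u0 v0 up uv tv]]]; exists u, v; split; rewrite ?tev_sub // => i.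
rewrite ffunE mulmx_sumr mulmx_suml big1 // => j _.
by rewrite -scalemxAr -scalemxAl uv scaler0.
Qed.

Lemma tsub_mul g h T : tsub g (tsub h T) = tsub (h *m g) T.
Proof.
apply/ffunP => j; apply/matrixP => a b; rewrite !ffunE !sum3 !ffunE !sum3 !mxE !sum3; ring.
Qed.

Lemma tsub1 T : tsub 1%:M T = T.
Proof.
apply/ffunP => j; rewrite ffunE (bigD1 j) //= big1 => [|i ij].
  by rewrite mxE eqxx scale1r addr0.
by rewrite mxE (negbTE ij) scale0r.
Qed.

Lemma tsub_act g A B T : tsub g (tact A T B) = tact A (tsub g T) B.
Proof.
apply/ffunP => j; rewrite !ffunE mulmx_sumr mulmx_suml; apply: eq_bigr => i _.
by rewrite ffunE -scalemxAr -scalemxAl.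
Qed.

Lemma teq_sub g T T' : g \in unitmx -> teq (tsub g T) (tsub g T') -> teq T T'.
Proof.
move=> gu [A [B [Au Bu E]]]; exists A, B; split=> //.
have := congr1 (tsub (invmx g)) E; rewrite tsub_act !tsub_mul mulmxV // !tsub1 //.
Qed.

Lemma residual_pt P T p t : rep P T -> residual T p t -> ptev P t = 0.
Proof.
move=> rT [u [v [_ v0 _ _ tv]]]; apply/eqP; rewrite (rep_det _ rT) -det_tr; apply/det0P.
by exists v^T; rewrite ?trmx_eq0 // -trmx_mul tv trmx0.
Qed.

(** The rows [u *m T i] are dependent because [p] combines them to zero, which gives [v]; the
    columns [T i *m v] are dependent because [u] kills them, which gives [t]. If [t] were
    proportional to [p], [v] would lie in the right kernel at [p], against [rep_kernel]. *)
Lemma residual_exists P T p : smooth_cubic P -> rep P T -> p != 0 -> ptev P p = 0 ->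
  exists t, indep p t /\ residual T p t.
Proof.
move=> sP rT p0 /eqP; rewrite (rep_det _ rT) => /det0P[u u0 up].
pose W := \matrix_i (u *m T i) : 'M[K]_3.
have pW : p^T *m W = 0.
  rewrite -up /tev mulmx_sumr mulmx_sum_row; apply: eq_bigr => i _.
  by rewrite rowK -scalemxAr mxE.
have /det0P[v' v0 Wv'] : \det W^T == 0.
  by rewrite det_tr; apply/det0P; exists p^T; rewrite ?trmx_eq0.
pose v := v'^T; have vN0 : v != 0 by rewrite trmx_eq0.
have uv i : u *m T i *m v = 0.
  by rewrite -(rowK (fun i => u *m T i)) -row_mul -[_ *m v]trmxK trmx_mul trmxK Wv' trmx0 row0.
pose V := \matrix_i (T i *m v)^T : 'M[K]_3.
have Vu : V *m u^T = 0.
  by apply/row_matrixP => i; rewrite row_mul rowK -trmx_mul mulmxA uv trmx0 row0.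
have /det0P[t' t0 tV] : \det V == 0.
  by rewrite -det_tr; apply/det0P; exists u; rewrite ?u0 // -[u]trmxK -trmx_mul Vu trmx0.
have tN0 : t'^T != 0 by rewrite trmx_eq0.
have tv : tev T t'^T *m v = 0.
  apply/trmx_inj; rewrite trmx0 -tV /tev mulmx_suml linear_sum mulmx_sum_row /=.
  by apply: eq_bigr => i _; rewrite rowK -scalemxAl linearZ /= mxE.
exists t'^T; split; last by exists u, v.
move=> a b E; have [b0|b0] := eqVneq b 0.
  split=> //; move: E; rewrite b0 scale0r addr0 => /eqP.
  by rewrite scaler_eq0 (negbTE p0) orbF => /eqP.
have [a0|a0] := eqVneq a 0.
  move: E; rewrite a0 scale0r add0r => /eqP.
  by rewrite scaler_eq0 (negbTE tN0) orbF => /eqP.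
exfalso; apply: (rep_kernel sP rT u0 vN0 p0 up _ uv).
have -> : p = (- (b / a)) *: t'^T.
  apply: (scalerI a0); rewrite scalerA mulrN mulrC divfK // scaleNr.
  by apply/eqP; rewrite -subr_eq0 opprK E.
rewrite /tev; under eq_bigr do rewrite mxE -scalerA.
by rewrite -scaler_sumr -/(tev _ _) -scalemxAl tv scaler0.
Qed.

Definition ttr T : tens K := [ffun i => (T i)^T].

Lemma rep_tr P T : rep P T -> rep P (ttr T).
Proof.
case=> l l0 ->; exists l; first exact: l0.
suff -> : pencil (ttr T) = (pencil T)^T by rewrite det_tr.
by apply/matrixP => i j; rewrite mxE !pencilE !ffunE !mxE.
Qed.
End Residual.

Lemma rank1_col (K : fieldType) n (v : 'cV[K]_n) (y : 'cV[K]_n) : v != 0 ->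
  (\rank (row_mx v y) <= 1)%N -> exists c, y = c *: v.
Proof.
move=> v0; rewrite -mxrank_tr tr_row_mx => rk.
have su : (v^T <= col_mx v^T y^T)%MS by rewrite -addsmxE addsmxSl.
have : (col_mx v^T y^T <= v^T)%MS.
  by rewrite -(geq_leqif (mxrank_leqif_sup su)) rank_rV trmx_eq0 v0.
have sy : (y^T <= col_mx v^T y^T)%MS by rewrite -addsmxE addsmxSr.
move=> /(submx_trans sy)/submxP[D E].
exists (D 0 0); apply: trmx_inj; rewrite E {1}[D]mx11_scalar mul_scalar_mx linearZ /=.
by [].
Qed.

Section FinResidual.
Variable K : finFieldType.
Implicit Types (P : {mpoly K[3]}) (T : tens K) (p t : 'cV[K]_3) (A B g : 'M[K]_3).

Lemma right_kernel P T (u : 'rV[K]_3) (v y : 'cV[K]_3) :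
  smooth_cubic P -> rep P T -> u != 0 -> v != 0 ->
  (forall i, u *m T i *m v = 0) -> (forall i, u *m T i *m y = 0) -> exists c, y = c *: v.
Proof.
move=> sP rT u0 v0 uv uy; apply: rank1_col => //.
apply: (rep_rows sP rT u0) => i.
by rewrite mul_mx_row uv uy row_mx0.
Qed.

Lemma left_kernel P T (u w : 'rV[K]_3) (v : 'cV[K]_3) :
  smooth_cubic P -> rep P T -> u != 0 -> v != 0 ->
  (forall i, u *m T i *m v = 0) -> (forall i, w *m T i *m v = 0) -> exists c, w = c *: u.
Proof.
move=> sP rT u0 v0 uv wv.
have tr0 (r : 'rV[K]_3) : (forall i, r *m T i *m v = 0) ->
  forall i, v^T *m ttr T i *m r^T = 0.
  by move=> H i; rewrite ffunE -!trmx_mul mulmxA H trmx0.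
have v0' : v^T != 0 by rewrite trmx_eq0.
have u0' : u^T != 0 by rewrite trmx_eq0.
have [c E] := right_kernel sP (rep_tr rT) v0' u0' (tr0 _ uv) (tr0 _ wv).
by exists c; apply: trmx_inj; rewrite E linearZ.
Qed.

(** [u] and [v] are determined up to scalars. Two independent points [t], [t'] would leave rank at
    most one to the matrix of the columns [T i *m v], which [rep_rows] forbids for the transposed
    representation. *)
Lemma residual_unique P T p t t' : smooth_cubic P -> rep P T -> p != 0 -> t != 0 ->
  residual T p t -> residual T p t' -> exists c, t' = c *: t.
Proof.
move=> sP rT p0 t0 [u [v [u0 v0 up uv tv]]] [u' [v' [u0' v0' up' uv' tv']]].
have [c Eu] : exists c, u'^T = c *: u^T.
  apply: rank1_col; rewrite ?trmx_eq0 // -tr_col_mx mxrank_tr.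
  by apply: (rep_corank sP rT p0); rewrite mul_col_mx up up' col_mx0.
have {}Eu : u' = c *: u by apply: trmx_inj; rewrite Eu linearZ.
have c0 : c != 0 by apply: contraNneq u0' => c0; rewrite Eu c0 scale0r.
have [d Ev] : exists d, v' = d *: v.
  apply: (right_kernel sP rT u0 v0 uv) => i.
  by have /eqP := uv' i; rewrite Eu -!scalemxAl scaler_eq0 (negbTE c0) => /eqP.
have d0 : d != 0 by apply: contraNneq v0' => d0; rewrite Ev d0 scale0r.
have {}tv' : tev T t' *m v = 0.
  by have /eqP := tv'; rewrite Ev -scalemxAr scaler_eq0 (negbTE d0) => /eqP.
apply: rank1_col => //.
pose V := \matrix_i (T i *m v)^T : 'M[K]_3.
have tV (s : 'cV[K]_3) : tev T s *m v = 0 -> s^T *m V = 0.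
  move=> sv; apply/trmx_inj; rewrite trmx0 -sv /tev mulmx_suml mulmx_sum_row linear_sum /=.
  by apply: eq_bigr => i _; rewrite rowK -scalemxAl linearZ /= mxE trmxK.
have rV : (\rank (row_mx t t')^T + \rank V <= 3)%N.
  by apply: mulmx0_rank_max; rewrite tr_row_mx mul_col_mx !tV // col_mx0.
rewrite -mxrank_tr leqNgt; apply/negP => r2.
have rV1 : (\rank V <= 1)%N.
  by rewrite -(leq_add2l 2); apply: leq_trans rV; rewrite leq_add2r.
have [W [VW rW]] := rank2_kernel rV1.
have : (\rank W <= 1)%N.
  apply: (@rep_rows K P (ttr T) _ v^T W sP (rep_tr rT)); rewrite ?trmx_eq0 // => i.
  by rewrite ffunE -trmx_mul -(rowK (fun i => (T i *m v)^T)) -row_mul VW row0.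
by rewrite leqNgt rW.
Qed.
End FinResidual.

(** * The normal form with the two points at [e0] and [e1] *)

Definition e0 (K : fieldType) : 'cV[K]_3 := col3 1 0 0.
Definition e1 (K : fieldType) : 'cV[K]_3 := col3 0 1 0.
Definition e2 (K : fieldType) : 'cV[K]_3 := col3 0 0 1.

Lemma tactE (R : comNzRingType) (A B : 'M[R]_3) (T : tens R) i : tact A T B i = A *m T i *m B.
Proof. exact: ffunE. Qed.

Section Canon.
Variable K : fieldType.
Implicit Types (P : {mpoly K[3]}) (T : tens K).

(** The matrix with rows [(Z, -Y, 0)], [(a, b, X)], [(d, f, Z)] for arbitrary linear forms [a], [b],
    [d], [f]. The zero corner expresses [u T_i v = 0]; the first row vanishes at [e0], the last
    column at [e1]. *)
Definition ntens (a0 a1 a2 b0 b1 b2 d0 d1 d2 f0 f1 f2 : K) : tens K :=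
  [ffun i : 'I_3 => match val i with
   | 0 => (mx3 0 0 0 a0 b0 1 d0 f0 0)%R
   | 1 => (mx3 0 (-1) 0 a1 b1 0 d1 f1 0)%R
   | _ => (mx3 1 0 0 a2 b2 0 d2 f2 1)%R
   end%N].

Lemma ntensE a0 a1 a2 b0 b1 b2 d0 d1 d2 f0 f1 f2
  (T := ntens a0 a1 a2 b0 b1 b2 d0 d1 d2 f0 f1 f2) :
  ((T 0 = mx3 0 0 0 a0 b0 1 d0 f0 0) * (T 1 = mx3 0 (-1) 0 a1 b1 0 d1 f1 0) *
   (T 2 = mx3 1 0 0 a2 b2 0 d2 f2 1))%type.
Proof. by rewrite /T !ffunE. Qed.

Lemma det_ntens a0 a1 a2 b0 b1 b2 d0 d1 d2 f0 f1 f2 :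
  \det (pencil (ntens a0 a1 a2 b0 b1 b2 d0 d1 d2 f0 f1 f2)) =
  cub 0 (- d0) (- f0) (- d1) (a0 - f1 - d2) (b0 - f2) 0 a1 (b1 + a2) b2.
Proof.
rewrite det3 !pencilE !ntensE !mx3E /lin /cub !(mpolyCD, mpolyCN, mpolyC0, mpolyC1); ring.
Qed.

(* The arguments are the coefficients of the cubic, as recorded by [det_canon]. *)
Definition canon (xxy xxz xyy xyz xzz yyz yzz zzz : K) : tens K :=
  ntens xyz yyz 0 xzz yzz zzz (- xxy) (- xyy) 0 (- xxz) 0 0.

Lemma det_canon xxy xxz xyy xyz xzz yyz yzz zzz :
  \det (pencil (canon xxy xxz xyy xyz xzz yyz yzz zzz)) =
  cub 0 xxy xxz xyy xyz xzz 0 yyz yzz zzz.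
Proof. by rewrite det_ntens !opprK !subr0 addr0. Qed.

Lemma residual_canon xxy xxz xyy xyz xzz yyz yzz zzz :
  residual (canon xxy xxz xyy xyz xzz yyz yzz zzz) (e0 K) (e1 K).
Proof.
exists (delta_mx 0 0), (delta_mx 2 0); split.
- by apply/rV0Pn; exists 0; rewrite mxE oner_neq0.
- by apply/cV0Pn; exists 2; rewrite mxE oner_neq0.
- apply/rowP => j; rewrite -rowE mxE [RHS]mxE tevE !col3E !ntensE !mul0r mul1r !addr0.
  by case: (ord3P j) => ->; rewrite mx3E.
- apply: all3; apply/rowP => j; rewrite (ord1 j) -rowE -colE !mxE !ntensE; by rewrite mx3E.
- apply/colP => j; rewrite -colE mxE [RHS]mxE tevE !col3E !ntensE !mul0r mul1r add0r addr0.
  by case: (ord3P j) => ->; rewrite mx3E.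
Qed.

Lemma mx3M (a b c d e f g h i a' b' c' d' e' f' g' h' i' : K) :
  mx3 a b c d e f g h i *m mx3 a' b' c' d' e' f' g' h' i' =
  mx3 (a*a'+b*d'+c*g') (a*b'+b*e'+c*h') (a*c'+b*f'+c*i')
      (d*a'+e*d'+f*g') (d*b'+e*e'+f*h') (d*c'+e*f'+f*i')
      (g*a'+h*d'+i*g') (g*b'+h*e'+i*h') (g*c'+h*f'+i*i').
Proof.
by apply/matrixP => r s; rewrite mxE sum3; case: (ord3P r) => ->; case: (ord3P s) => ->;
  rewrite !mx3E.
Qed.

Lemma det_mx3 (a b c d e f g h i : K) : \det (mx3 a b c d e f g h i) =
  a * (e * i - f * h) - b * (d * i - f * g) + c * (d * h - e * g).
Proof. by rewrite det3 !mx3E. Qed.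

Lemma tens_eq (T T' : tens K) : T 0 = T' 0 -> T 1 = T' 1 -> T 2 = T' 2 -> T = T'.
Proof. by move=> E0 E1 E2; apply/ffunP => i; case: (ord3P i) => ->. Qed.

Lemma ntens_canon a0 a1 a2 b0 b1 b2 d0 d1 d2 f0 f1 f2 :
  teq (canon (- d0) (- f0) (- d1) (a0 - f1 - d2) (b0 - f2) a1 (b1 + a2) b2)
      (ntens a0 a1 a2 b0 b1 b2 d0 d1 d2 f0 f1 f2).
Proof.
exists (mx3 1 0 0 a2 1 0 (- f1) 0 1), (mx3 1 0 0 0 1 0 (d2 + f1) f2 1).
split; rewrite ?unitmxE ?det_mx3 ?unitfE; try by apply: contraNneq (oner_neq0 K) => <-; apply/eqP; ring.
by apply: tens_eq; rewrite tactE /canon !ntensE !mx3M; congr mx3; ring.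
Qed.

(** Absorbs the factor between cubic and determinant: dividing the last two rows by [m] would spoil
    the entries [X] and [Z] of the last column, so that column is multiplied by [m]. *)
Lemma canon_scale m xxy xxz xyy xyz xzz yyz yzz zzz : m != 0 ->
  teq (canon (m*xxy) (m*xxz) (m*xyy) (m*xyz) (m*xzz) (m*yyz) (m*yzz) (m*zzz))
      (canon xxy xxz xyy xyz xzz yyz yzz zzz).
Proof.
move=> m0; exists (mx3 1 0 0 0 m^-1 0 0 0 m^-1), (mx3 1 0 0 0 1 0 0 0 m).
split; rewrite ?unitmxE ?det_mx3 ?unitfE.
- by rewrite !(mulr0, mul0r, mul1r, subr0, addr0) mulf_neq0 ?invr_eq0.
- by rewrite !(mulr0, mul0r, mul1r, subr0, addr0).
- by apply: tens_eq; rewrite tactE /canon !ntensE !mx3M; congr mx3; field.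
Qed.

Lemma ptev_cub (c30 c21 c201 c12 c111 c102 c03 c021 c012 c003 : K) x :
  ptev (cub c30 c21 c201 c12 c111 c102 c03 c021 c012 c003) x =
  c30 * x 0 0 ^+ 3 + c21 * x 0 0 ^+ 2 * x 1 0 + c201 * x 0 0 ^+ 2 * x 2 0
  + c12 * x 0 0 * x 1 0 ^+ 2 + c111 * x 0 0 * x 1 0 * x 2 0 + c102 * x 0 0 * x 2 0 ^+ 2
  + c03 * x 1 0 ^+ 3 + c021 * x 1 0 ^+ 2 * x 2 0 + c012 * x 1 0 * x 2 0 ^+ 2
  + c003 * x 2 0 ^+ 3.
Proof. by rewrite /ptev /cub !(mevalD, mevalM, mevalC, mevalXU, rmorphXn) /=. Qed.

Lemma ntens_shape T :
  (forall i, row 0 (T i) = match val i with 0 => 0%R | 1 => (- delta_mx 0 1)%R | _ => (delta_mx 0 0)%R end%N) ->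
  (forall i, col 2 (T i) = match val i with 0 => (delta_mx 1 0)%R | 1 => 0%R | _ => (delta_mx 2 0)%R end%N) ->
  T = ntens (T 0 1 0) (T 1 1 0) (T 2 1 0) (T 0 1 1) (T 1 1 1) (T 2 1 1)
            (T 0 2 0) (T 1 2 0) (T 2 2 0) (T 0 2 1) (T 1 2 1) (T 2 2 1).
Proof.
move=> R C; have Rj i j : T i 0 j = (row 0 (T i)) 0 j by rewrite mxE.
have Cj i j : T i j 2 = (col 2 (T i)) j 0 by rewrite mxE.
by apply: tens_eq; rewrite ntensE [LHS]mx3_eta; congr mx3;
  rewrite ?Rj ?Cj ?R ?C /= !mxE ?oppr0.
Qed.
End Canon.

Definition rows3 (R : Type) n (r0 r1 r2 : 'rV[R]_n) : 'M[R]_(3, n) :=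
  \matrix_(i < 3) match val i with 0 => r0 | 1 => r1 | _ => r2 end%N.

Lemma rows3E (R : Type) n (r0 r1 r2 : 'rV[R]_n) (G := rows3 r0 r1 r2) :
  ((row 0 G = r0) * (row 1 G = r1) * (row 2 G = r2))%type.
Proof. by rewrite /G /rows3 !rowK. Qed.

Section Classify.
Variable K : finFieldType.
Implicit Types (P : {mpoly K[3]}) (T : tens K) (p t : 'cV[K]_3) (A B g : 'M[K]_3).

Lemma tev_e0 T : tev T (e0 K) = T 0.
Proof. by apply/matrixP => i j; rewrite tevE !col3E !mul0r mul1r !addr0. Qed.

Lemma tev_e1 T : tev T (e1 K) = T 1.
Proof. by apply/matrixP => i j; rewrite tevE !col3E !mul0r mul1r add0r addr0. Qed.

Lemma dual_vector (v : 'cV[K]_3) : v != 0 -> exists w : 'rV[K]_3, w *m v = 1%:M.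
Proof.
rewrite -trmx_eq0 => v0; have [A Au Av] := exists_unit_row v0.
exists (col 0 (invmx A))^T; apply: trmx_inj.
rewrite trmx_mul trmxK -Av colE mulmxA -row_mul mulmxV // row1 -rowE.
by apply/matrixP => i j; rewrite !mxE !ord1.
Qed.

Lemma inj_unitmx (G : 'M[K]_3) : (forall y : 'cV_3, G *m y = 0 -> y = 0) -> G \in unitmx.
Proof.
move=> H; rewrite -unitmx_tr unitmxE unitfE; apply/negP => /det0P[y y0 yG].
case/eqP: y0; apply: trmx_inj; rewrite trmx0; apply: H.
by rewrite -[G]trmxK -trmx_mul yG trmx0.
Qed.

(* The rows [u T_2], [- u T_1] and a functional dual to [v] form a basis; in that basis
   the first row of the pencil is [(Z, -Y, 0)]. *)
Lemma row_frame P T (u : 'rV[K]_3) (v : 'cV[K]_3) : smooth_cubic P -> rep P T ->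
  u != 0 -> v != 0 -> u *m T 0 = 0 -> (forall i, u *m T i *m v = 0) ->
  exists G : 'M[K]_3, [/\ G \in unitmx, row 0 G = u *m T 2, row 1 G = - (u *m T 1) &
    G *m v = delta_mx 2 0].
Proof.
move=> sP rT u0 v0 uT0 uv; have [w wv] := dual_vector v0.
pose G := rows3 (u *m T 2) (- (u *m T 1)) w.
have [[G0 G1] G2] := rows3E (u *m T 2) (- (u *m T 1)) w; rewrite -/G in G0 G1 G2.
exists G; split=> //; last first.
  apply/row_matrixP => i; rewrite row_mul; case: (ord3P i) => ->;
  rewrite ?G0 ?G1 ?G2 ?mulNmx ?uv ?wv ?oppr0; apply/rowP => j; rewrite ord1 !mxE //.
apply: inj_unitmx => y Gy.
have [c Ey] : exists c, y = c *: v.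
  apply: (right_kernel sP rT u0 v0 uv); apply: all3; first by rewrite uT0 mul0mx.
    by apply: oppr_inj; rewrite -mulNmx -G1 -row_mul Gy row0 oppr0.
  by rewrite -G0 -row_mul Gy row0.
have /matrixP/(_ 0 0) : w *m y = 0 by rewrite -G2 -row_mul Gy row0.
by rewrite Ey -scalemxAr wv !mxE mulr1 => ->; rewrite scale0r.
Qed.

(** [row_frame] fixes the first row. The frame [H], built dually from a vector that pairs to 1 with
    [u] and from the columns [T 0 *m v], [T 2 *m v], fixes the last column as [(0, X, Z)]. *)
Lemma residual_normal P T : smooth_cubic P -> rep P T -> residual T (e0 K) (e1 K) ->
  exists a0 a1 a2 b0 b1 b2 d0 d1 d2 f0 f1 f2,
  teq T (ntens a0 a1 a2 b0 b1 b2 d0 d1 d2 f0 f1 f2).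
Proof.
move=> sP rT [u [v [u0 v0]]]; rewrite tev_e0 tev_e1 => uT0 uv Tv1.
have [G [Gu G0 G1 Gv]] := row_frame sP rT u0 v0 uT0 uv.
have [H [Hu Hu0 HT0 HT2]] : exists H : 'M[K]_3, [/\ H \in unitmx, u *m H = delta_mx 0 0,
    col 1 H = T 0 *m v & col 2 H = T 2 *m v].
  have uT0' : u^T != 0 by rewrite trmx_eq0.
  have [z zu] := dual_vector uT0'.
  pose H := rows3 z (T 0 *m v)^T (T 2 *m v)^T.
  have [[H0 H1] H2] := rows3E z (T 0 *m v)^T (T 2 *m v)^T; rewrite -/H in H0 H1 H2.
  exists H^T; split; rewrite -?tr_row ?H1 ?H2 ?trmxK //; last first.
    apply: trmx_inj; rewrite trmx_mul trmxK; apply/row_matrixP => i; rewrite row_mul.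
    by case: (ord3P i) => ->; rewrite ?H0 ?H1 ?H2 -?trmx_mul ?mulmxA ?uv ?zu;
      apply/rowP => j; rewrite ord1 !mxE.
  rewrite unitmx_tr; apply: inj_unitmx => y Hy.
  have tv i : row i H *m y = 0 by rewrite -row_mul Hy row0.
  have [c Ey] : exists c, y^T = c *: u.
    apply: (left_kernel sP rT u0 v0 uv); apply: all3; apply: trmx_inj;
      rewrite -mulmxA trmx_mul trmxK trmx0 -?H1 -?H2 ?tv //.
    by rewrite Tv1 trmx0 mul0mx.
  have /matrixP/(_ 0 0) := tv 0; rewrite H0 -[y]trmxK Ey linearZ /= -scalemxAr zu !mxE mulr1.
  by move=> ->; rewrite scale0r.
pose T' := tact (invmx H) T (invmx G).
have E : teq T T' by exists (invmx H), (invmx G); rewrite !unitmx_inv.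
have uH : delta_mx 0 0 *m invmx H = u by rewrite -Hu0 mulmxK.
have Gv' : invmx G *m delta_mx 2 0 = v by rewrite -Gv mulKmx.
exists (T' 0 1 0), (T' 1 1 0), (T' 2 1 0), (T' 0 1 1), (T' 1 1 1), (T' 2 1 1),
  (T' 0 2 0), (T' 1 2 0), (T' 2 2 0), (T' 0 2 1), (T' 1 2 1), (T' 2 2 1).
rewrite -ntens_shape // => i; rewrite tactE.
  rewrite rowE !mulmxA uH; case: (ord3P i) => -> /=.
  - by rewrite uT0 mul0mx.
  - by rewrite -[u *m T 1]opprK -G1 mulNmx -row_mul mulmxV // row1.
  - by rewrite -G0 -row_mul mulmxV // row1.
rewrite colE -!mulmxA Gv'; case: (ord3P i) => -> /=.
- by rewrite -HT0 colE mulKmx.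
- by rewrite Tv1 mulmx0.
- by rewrite -HT2 colE mulKmx.
Qed.
End Classify.

Section Frame.
Variable K : fieldType.
Implicit Types (p t : 'cV[K]_3) (g : 'M[K]_3).

Lemma mul_e0 g : g *m e0 K = col 0 g.
Proof. by apply/colP => i; rewrite !mxE sum3 !col3E mulr1 !mulr0 !addr0. Qed.

Lemma mul_e1 g : g *m e1 K = col 1 g.
Proof. by apply/colP => i; rewrite !mxE sum3 !col3E mulr1 !mulr0 add0r addr0. Qed.

Lemma mul_e2 g : g *m e2 K = col 2 g.
Proof. by apply/colP => i; rewrite !mxE sum3 !col3E mulr1 !mulr0 !add0r. Qed.

Lemma indep_frame p t : indep p t ->
  exists2 g : 'M[K]_3, g \in unitmx & g *m e0 K = p /\ g *m e1 K = t.
Proof.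
move=> I; pose f : 'M[K]_3 := rows3 p^T t^T 0.
have [[f0 f1] f2] := rows3E p^T t^T 0; rewrite -/f in f0 f1 f2.
pose V : 'M[K]_(2, 3) := pid_mx 2.
have V0 : row 0 V = delta_mx 0 0 by apply/rowP => j; rewrite !mxE; case: (ord3P j) => ->.
have V1 : row 1 V = delta_mx 0 1 by apply/rowP => j; rewrite !mxE; case: (ord3P j) => ->.
have VfW : row_free (V *m f).
  apply: inj_row_free => x E.
  have [x0 x1] : x 0 0 = 0 /\ x 0 1 = 0.
    apply: I; apply: trmx_inj; rewrite trmx0 -E !linearD /= !linearZ /= mulmx_sum_row.
    rewrite !big_ord_recl big_ord0 addr0.
    have -> : lift ord0 ord0 = 1 :> 'I_2 by apply/val_inj.
    by rewrite !row_mul V0 V1 -!rowE f0 f1.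
  apply/rowP => j; rewrite mxE.
  by case: j => [[|[|//]] Hj]; [rewrite -[RHS]x0|rewrite -[RHS]x1]; congr (x _ _); apply/val_inj.
have [|g gu E] := @complete_unitmx _ _ _ V f.
  by rewrite (eqP VfW) rank_pid_mx.
exists g^T; first by rewrite unitmx_tr.
have gr (i : 'I_2) (j : 'I_3) : row i V = delta_mx 0 j -> row j g = row j f.
  by move=> Vi; rewrite !rowE -Vi -!row_mul E.
by rewrite mul_e0 mul_e1 -!tr_row (gr 0) // (gr 1) // f0 f1 !trmxK.
Qed.

Lemma e0_neq0 : e0 K != 0.
Proof. by apply/cV0Pn; exists 0; rewrite col3E oner_neq0. Qed.

Lemma indep_neq0 p t : indep p t -> p != 0 /\ t != 0.
Proof.
move=> I; split; apply/negP => /eqP E.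
  by have := I 1 0; rewrite E scaler0 scale0r addr0 => /(_ erefl)[/eqP]; rewrite oner_eq0.
by have := I 0 1; rewrite E scaler0 scale0r addr0 => /(_ erefl)[_ /eqP]; rewrite oner_eq0.
Qed.

Lemma indep_nsub p t : p != 0 -> (forall c, t != c *: p) -> indep p t.
Proof.
move=> p0 H a b E; have [b0|b0] := eqVneq b 0.
  by move: E; rewrite b0 scale0r addr0 => /eqP; rewrite scaler_eq0 (negbTE p0) orbF => /eqP.
case/negP: (H (- (b^-1 * a))); apply/eqP; apply: (scalerI b0).
by rewrite scalerA mulrN mulVKf // scaleNr; apply/eqP; rewrite -addr_eq0 addrC E.
Qed.
End Frame.

Section Classification.
Variable K : finFieldType.
Implicit Types (P : {mpoly K[3]}) (T : tens K) (p t : 'cV[K]_3) (A B g : 'M[K]_3).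

Definition canon_of P := canon P@_(mon 2 1 0) P@_(mon 2 0 1) P@_(mon 1 2 0) P@_(mon 1 1 1)
  P@_(mon 1 0 2) P@_(mon 0 2 1) P@_(mon 0 1 2) P@_(mon 0 0 3).

(** The normal form depends on the cubic alone; hence two representations with the same pair of
    points are equivalent. *)
Lemma canon_of_teq P T : smooth_cubic P -> rep P T -> residual T (e0 K) (e1 K) ->
  teq (canon_of P) T.
Proof.
move=> sP rT dT.
have [a0 [a1 [a2 [b0 [b1 [b2 [d0 [d1 [d2 [f0 [f1 [f2 E]]]]]]]]]]]] := residual_normal sP rT dT.
apply: teq_trans (teq_sym E); have [l l0 ->] := rep_teq E rT.
rewrite det_ntens /canon_of !mcoeffZ !cub_coef.
exact: teq_trans (canon_scale _ _ _ _ _ _ _ _ l0) (ntens_canon _ _ _ _ _ _ _ _ _ _ _ _).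
Qed.

Lemma residual_classify P T T' p t : smooth_cubic P -> rep P T -> rep P T' -> indep p t ->
  residual T p t -> residual T' p t -> teq T T'.
Proof.
move=> sP rT rT' I dT dT'; have [g gu [gp gt]] := indep_frame I.
apply: (teq_sub gu); have sPg := smooth_subst gu sP.
apply: teq_trans (teq_sym (canon_of_teq sPg (rep_sub g rT) _)) (canon_of_teq sPg (rep_sub g rT') _);
  by apply: residual_sub; rewrite gp gt.
Qed.

(** With the points at [e0] and [e1] the coefficients of [X^3] and [Y^3] vanish; [canon] realises
    any values of the other eight. *)
Lemma residual_realize P p t : P \is 3.-homog -> indep p t -> ptev P p = 0 -> ptev P t = 0 ->
  exists T, rep P T /\ residual T p t.
Proof.
move=> hP I Pp Pt; have [g gu [gp gt]] := indep_frame I.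
pose Q := lin_subst g P; have hQ : Q \is 3.-homog by apply: lin_subst_homog.
have Q0 : ptev Q (e0 K) = 0 by rewrite ptev_subst gp.
have Q1 : ptev Q (e1 K) = 0 by rewrite ptev_subst gt.
have rQ : rep Q (canon_of Q).
  exists 1; first exact: oner_neq0.
  rewrite scale1r det_canon [LHS]cub_eta //.
  have -> : Q@_(mon 3 0 0) = 0.
    by rewrite -Q0 [in RHS](cub_eta hQ) ptev_cub !col3E; ring.
  have -> : Q@_(mon 0 3 0) = 0.
    by rewrite -Q1 [in RHS](cub_eta hQ) ptev_cub !col3E; ring.
  by [].
exists (tsub (invmx g) (canon_of Q)); split.
  by rewrite -[P](lin_subst_inv _ gu); apply: rep_sub.
by apply: residual_sub; rewrite -gp -gt !mulKmx //; apply: residual_canon.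
Qed.
End Classification.

(** * Frobenius descent from the cubic extension *)

(** If [b] were no [n]-th power, [(X^(n k) - b^k) / (X^n - b)] would vanish at all [n k] non-zero
    elements, though its degree is [n (k - 1)]. This serves both the norm of the cubic extension and
    Euler's criterion. *)
Lemma finField_nth_root (K : finFieldType) (n k : nat) (b : K) :
  (n * k = #|K|.-1)%N -> b ^+ k = 1 -> exists t : K, t ^+ n = b.
Proof.
move=> nk bk; have k1 : (1 < #|K|)%N := finNzRing_gt1 K.
have nk0 : (0 < n * k)%N by rewrite nk -subn1 subn_gt0.
have [n0 k0] : (0 < n)%N /\ (0 < k)%N by move: nk0; rewrite muln_gt0 => /andP.
have b0 : b != 0.
  by apply: contra_eq_neq bk => ->; rewrite expr0n (gtn_eqF k0) eq_sym oner_neq0.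
have [t /eqP bt|none] := pickP (fun t => t ^+ n == b); first by exists t.
exfalso; pose r : {poly K} := \sum_(i < k) b ^+ (k.-1 - i) *: 'X^(n * i)%N.
have rx x : r.[x] = \sum_(i < k) b ^+ (k.-1 - i) * (x ^+ n) ^+ i.
  by rewrite horner_sum; apply: eq_bigr => i _; rewrite hornerZ hornerXn exprM.
have r0 : r != 0.
  apply/eqP => /(congr1 (fun p => p.[0])); rewrite rx horner0.
  rewrite (bigD1 (Ordinal k0)) //= expr0 mulr1 big1 ?addr0 => [/eqP|i i0].
    by rewrite expf_eq0 (negbTE b0) andbF.
  have i1 : (i == 0 :> nat)%N = false.
    by apply: contraNF i0 => /eqP E; apply/eqP/val_inj.
  by rewrite -exprM expr0n muln_eq0 i1 (gtn_eqF n0) mulr0.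
have sr : (size r <= (n * k.-1).+1)%N.
  apply: leq_trans (size_sum _ _ _) _; apply/bigmax_leqP => i _.
  apply: leq_trans (size_scale_leq _ _) _; rewrite size_polyXn ltnS leq_mul2l.
  by rewrite -ltnS prednK ?ltn_ord ?orbT.
have := max_poly_roots r0 (rs := [seq x <- enum K | x != 0]).
rewrite filter_uniq ?enum_uniq // => /(_ _ isT) lt.
suff : (#|K|.-1 < (n * k.-1).+1)%N.
  by rewrite -nk ltnS leq_pmul2l // -ltnS prednK // ltnn.
apply: leq_trans sr; apply: leq_trans (lt _); last first.
  apply/allP => x; rewrite mem_filter => /andP[x0 _]; apply/rootP.
  have xn : b - x ^+ n != 0 by rewrite subr_eq0 eq_sym none.
  apply: (mulfI xn); rewrite mulr0 rx -subrXX -exprM nk bk.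
  have -> : x ^+ #|K|.-1 = 1.
    by apply: (mulfI x0); rewrite -exprS prednK ?(ltnW k1) // expf_card mulr1.
  by rewrite subrr.
rewrite size_filter ltnS -(cardC1 (0 : K)) cardE size_filter.
by rewrite enumT; apply: sub_count.
Qed.

Section Frobenius.
Variables (F L : finFieldType) (f : {rmorphism F -> L}).
Hypothesis cardL : #|L| = (#|F| ^ 3)%N.

Lemma frobenius_morphism : exists s : {rmorphism L -> L}, forall x, s x = x ^+ #|F|.
Proof.
have [p p_pr charF] := finPcharP F.
have charL : p \in [pchar L] by rewrite (fmorph_pchar f).
have pq : [pchar L].-nat #|F|.
  have [n ->] : exists n, #|F| = (p ^ n)%N by exists (logn p #|F|); exact: card_pprimeChar charF.
  by rewrite (eq_pnat _ (pcharf_eq charL)) pnatX pnat_id.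
pose g (x : L) := x ^+ #|F|.
have gB : zmod_morphism g by move=> x y; rewrite /g exprDn_pchar // exprNn_pchar.
have gM : monoid_morphism g by split=> [|x y]; rewrite /g ?expr1n ?exprMn.
pose gz := GRing.isZmodMorphism.Build L L g gB.
pose gm := GRing.isMonoidMorphism.Build L L g gM.
by exists (HB.pack_for {rmorphism L -> L} g gz gm).
Qed.

Variable s : {rmorphism L -> L}.
Hypothesis sE : forall x, s x = x ^+ #|F|.

Lemma frob_fixed x : s x = x -> exists a, x = f a.
Proof.
rewrite sE => xq; have := congr1 (fun r => (map_poly f r).[x]) (finField_genPoly F).
rewrite rmorphB rmorph_prod /= map_polyX map_polyXn !hornerE xq subrr => /esym/eqP.
rewrite horner_prod prodf_seq_eq0 => /hasP[a _] /=.
by rewrite rmorphB /= map_polyX map_polyC !hornerE subr_eq0 => /eqP ->; exists a.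
Qed.

Lemma frob_id a : s (f a) = f a.
Proof. by rewrite sE -rmorphXn expf_card. Qed.

Lemma frob3 x : s (s (s x)) = x.
Proof. by rewrite !sE -!exprM -[in RHS](expf_card x) cardL !expnS expn0 muln1 mulnA. Qed.

(** The norm is the power [1 + q + q^2], and [(1 + q + q^2) (q - 1) = q^3 - 1]. *)
Lemma frob_norm_surj a : a != 0 -> exists t : L, t * s t * s (s t) = f a.
Proof.
move=> a0; have q1 : (1 < #|F|)%N := finNzRing_gt1 F.
have [||t Et] := @finField_nth_root L (1 + #|F| + #|F| ^ 2) (#|F| - 1) (f a).
- by rewrite cardL -subn1; have := q1; clear; nia.
- have -> : f a ^+ (#|F| - 1) = f (a ^+ (#|F| - 1)) by rewrite rmorphXn.
  have -> : a ^+ (#|F| - 1) = 1; last exact: rmorph1.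
  by apply: (mulfI a0); rewrite -exprS subn1 prednK ?(ltnW q1) // expf_card mulr1.
by exists t; rewrite -Et !exprD expr1 !sE -exprM mulnn.
Qed.

(** Independence of the powers of Frobenius: otherwise a non-zero polynomial of degree at most [q^2]
    has [q^3] roots. *)
Lemma frob_indep (a b c : L) : (forall x, x * a + s x * b + s (s x) * c = 0) -> a = 0.
Proof.
move=> H; pose r := c *: 'X^(#|F| ^ 2) + b *: 'X^#|F| + a *: 'X : {poly L}.
have q1 : (1 < #|F|)%N := finNzRing_gt1 F.
have q2 : (#|F| < #|F| ^ 2)%N by rewrite -{1}[#|F|]expn1 ltn_exp2l.
have r1 : r`_1 = a.
  by rewrite !coefD !coefZ !coefXn coefX (ltn_eqF q1) (ltn_eqF (ltn_trans q1 q2)) !mulr0 !add0r mulr1.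
have [r0|r0] := eqVneq r 0; first by rewrite -r1 r0 coef0.
have sr : (size r <= (#|F| ^ 2).+1)%N.
  have sz k n (e : L) : (n <= k)%N -> (size (e *: 'X^n : {poly L}) <= k.+1)%N.
    by move=> nk; apply: leq_trans (size_scale_leq _ _) _; rewrite size_polyXn.
  rewrite !(leq_trans (size_polyD _ _)) // geq_max; apply/andP; split.
    by rewrite (leq_trans (size_polyD _ _)) // geq_max !sz // ltnW.
  by rewrite -[X in a *: X]expr1 sz // ltnW // (ltn_trans q1).
have /max_poly_roots := r0 => /(_ (enum L)); rewrite enum_uniq => /(_ _ isT).
rewrite -cardE cardL => /(_ _) lt.
suff : (#|F| ^ 3 < (#|F| ^ 2).+1)%N by rewrite ltnS leq_exp2l.
apply: leq_trans sr; apply: lt; apply/allP => x _; apply/rootP.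
have := H x; rewrite !sE -exprM mulnn !hornerD !hornerZ !hornerXn hornerX => <-; ring.
Qed.

Local Notation "M ^s" := (map_mx s M) (at level 2, format "M ^s").

(** The hypothesis makes the cube of the semilinear map [w -> w^s *m A] the identity. Its fixed
    vectors span: if [y] is orthogonal to all of them, it kills the orbit sum of every [x *: v], so
    [v *m y = 0] by [frob_indep]. The rows of [S] are fixed vectors. *)
Lemma hilbert90 (A : 'M[L]_3) : A^s^s *m A^s *m A = 1%:M ->
  exists2 S : 'M[L]_3, S \in unitmx & S^s *m A = S.
Proof.
move=> nA; have AA (M : 'rV[L]_3) : M^s^s^s = M by apply/matrixP => i j; rewrite !mxE frob3.
(* All fixed vectors are listed as rows, with a zero row in place of every other vector. *)
pose W := \matrix_(i < #|{: 'rV[L]_3}|)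
  (if (enum_val i)^s *m A == enum_val i then enum_val i else 0).
have Wfull : row_full W.
  rewrite /row_full -mxrank_tr; apply: inj_row_free => y' yW.
  pose y := y'^T; have {yW}Wy : W *m y = 0 by rewrite -[W]trmxK -trmx_mul yW trmx0.
  have fix0 (w : 'rV[L]_3) : w^s *m A = w -> w *m y = 0.
    move=> fw; have := congr1 (row (enum_rank w)) Wy.
    by rewrite row_mul rowK enum_rankK fw eqxx row0.
  suff vy (v : 'rV[L]_3) : v *m y = 0.
    apply: trmx_inj; rewrite trmx0 -/y; apply/row_matrixP => i.
    by rewrite row0 -[y]mul1mx row_mul vy.
  apply/matrixP => i j; rewrite !ord1 [RHS]mxE.
  apply: (@frob_indep _ ((v^s *m A *m y) 0 0) ((v^s^s *m A^s *m A *m y) 0 0)) => x.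
  have /matrixP/(_ 0 0) : (x *: v + s x *: (v^s *m A) + s (s x) *: (v^s^s *m A^s *m A)) *m y = 0.
    apply: fix0; rewrite !map_mxD !map_mxZ !map_mxM /= AA frob3 !mulmxDl -!scalemxAl.
    have -> : v *m A^s^s *m A^s *m A = v by rewrite -!mulmxA [A^s^s *m _]mulmxA nA mulmx1.
    by rewrite addrC addrA.
  by rewrite !mulmxDl -!scalemxAl !mxE.
exists (rowsub (fullrankfun Wfull) W); first exact: fullrowsub_unit.
apply/row_matrixP => i; rewrite row_mul -map_row row_rowsub rowK.
by case: ifP => [/eqP //|_]; rewrite map_mx0 mul0mx.
Qed.
End Frobenius.

Lemma mulmxZ3 (R : comNzRingType) n (a b c : R) (A B C : 'M[R]_n) :
  (a *: A) *m (b *: B) *m (c *: C) = (a * b * c) *: (A *m B *m C).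
Proof. by rewrite -!scalemxAl -!scalemxAr -scalemxAl !scalerA; congr (_ *: _); ring. Qed.

Section Descent.
Variables (F L : finFieldType) (f : {rmorphism F -> L}) (s : {rmorphism L -> L}).
Hypothesis cardL : #|L| = (#|F| ^ 3)%N.
Hypothesis sE : forall x, s x = x ^+ #|F|.
Variable P : {mpoly F[3]}.
Hypothesis sP : smooth_cubic P.
Local Notation PL := (map_mpoly f P).
Local Notation "M ^s" := (map_mx s M) (at level 2, format "M ^s").

Lemma map_s_PL : map_mpoly s PL = PL.
Proof.
by apply/mpolyP => m; rewrite !mcoeff_map_mpoly /= (frob_id f sE).
Qed.

Lemma map_mx_frob3 m n (M : 'M[L]_(m, n)) : M^s^s^s = M.
Proof. by apply/matrixP => i j; rewrite !mxE (frob3 cardL sE). Qed.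

Lemma map_mx_frob_fixed m n (M : 'M[L]_(m, n)) : M^s = M -> exists N : 'M[F]_(m, n), M = map_mx f N.
Proof.
move=> /matrixP E; have ex i j : exists a, M i j == f a.
  by have [|a ->] := frob_fixed f sE (x := M i j); [rewrite -[RHS]E mxE|exists a].
exists (\matrix_(i, j) xchoose (ex i j)); apply/matrixP => i j; rewrite !mxE.
exact/eqP/(xchooseP (ex i j)).
Qed.

Lemma rep_frob T : rep PL T -> rep PL (tmap s T).
Proof. by move/(rep_map s); rewrite map_s_PL. Qed.

Lemma tmap_act A B (T : tens L) : tmap s (tact A T B) = tact A^s (tmap s T) B^s.
Proof. by apply/ffunP => i; rewrite !ffunE !map_mxM. Qed.

Lemma tmap_frob3 (T : tens L) : tmap s (tmap s (tmap s T)) = T.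
Proof. by apply/ffunP => i; rewrite !ffunE map_mx_frob3. Qed.

Lemma smooth_neq0 (K : fieldType) (Q : {mpoly K[3]}) : smooth_cubic Q -> Q != 0.
Proof.
move=> sQ; apply/eqP => Q0; apply: (smooth_nsing sQ (e0_neq0 K)); rewrite Q0.
by split=> [|i]; rewrite ?mderiv0 /ptev meval0.
Qed.

Lemma rep_neq0 (K : fieldType) (Q : {mpoly K[3]}) T : smooth_cubic Q -> rep Q T -> exists i, T i != 0.
Proof.
move=> sQ [l l0 E]; apply/existsP; rewrite -negb_forall; apply/negP => /forallP T0.
have := smooth_neq0 sQ; rewrite E.
suff -> : pencil T = 0 by rewrite det0 // scaler0 eqxx.
apply/matrixP => a b; rewrite pencilE !(eqP (T0 _)) !mxE /lin mpolyC0; ring.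
Qed.

(** Iterating the equivalence three times gives an automorphism of [T], scalar by [rep_stabilizer].
    Rescaling [A] and [B] by an element of suitable norm makes both of them cocycles; Hilbert 90
    splits these, and the resulting representation equivalent to [T] is fixed by Frobenius. *)
Lemma descend T : rep PL T -> teq T (tmap s T) ->
  forall p : 'cV[L]_3, p != 0 -> ptev PL p = 0 ->
  exists T0 : tens F, rep P T0 /\ teq T (tmap f T0).
Proof.
move=> rT [A [B [Au Bu E]]] p p0 Pp; have sPL := smooth_map f sP.
have sU (M : 'M[L]_3) : (M^s \in unitmx) = (M \in unitmx) by rewrite map_unitmx.
have E3 : tact (A^s^s *m A^s *m A) T (B *m B^s *m B^s^s) = T.
  by rewrite -[RHS]tmap_frob3 E !tmap_act E tmap_act E !tact_comp !mulmxA.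
set U := _ *m A in E3; set V := _ *m B^s^s in E3.
have E3i i : U *m T i *m V = T i by rewrite -tactE E3.
have Uu : U \in unitmx by rewrite !unitmx_mul !sU Au.
have Vu : V \in unitmx by rewrite !unitmx_mul !sU Bu.
have [c Uc] : exists c, U = c%:M.
  exact: (rep_stabilizer sPL rT p0 Pp Vu).
have [d Vd] : exists d, V^T = d%:M.
  apply: (rep_stabilizer sPL (rep_tr rT) p0 Pp (V := U^T)); rewrite ?unitmx_tr // => i.
  by rewrite !ffunE -!trmx_mul mulmxA E3i.
have {}Vd : V = d%:M by rewrite -[V]trmxK Vd tr_scalar_mx.
have cd : c * d = 1.
  have [i Ti] := rep_neq0 sPL rT.
  have := E3i i; rewrite Uc Vd mul_scalar_mx mul_mx_scalar scalerA.
  move/eqP; rewrite -subr_eq0 -{2}[T i]scale1r -scalerBl scaler_eq0 (negbTE Ti) orbF.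
  by rewrite subr_eq0 mulrC => /eqP.
have c0 : c != 0 by apply: contra_eqN cd => /eqP->; rewrite mul0r eq_sym oner_eq0.
have A0 : A != 0 by apply: contraTneq Au => ->; rewrite unitmxE det0 // unitr0.
(* [A] intertwines [U] with its conjugate, so the scalar lies in [F], where its inverse is a
   norm. *)
have sc : s c = c.
  have : U^s *m A = A *m U by rewrite /U !map_mxM /= map_mx_frob3 !mulmxA.
  rewrite Uc map_scalar_mx mul_scalar_mx mul_mx_scalar => /eqP.
  by rewrite -subr_eq0 -scalerBl scaler_eq0 (negbTE A0) orbF subr_eq0 => /eqP.
have [a Ea] := frob_fixed f sE sc.
have a0 : a^-1 != 0 by rewrite invr_eq0 -(fmorph_eq0 f) -Ea.
have [t Nt] := frob_norm_surj f cardL sE a0.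
rewrite fmorphV -Ea in Nt.
have t0 : t != 0.
  by apply: contra_eq_neq Nt => ->; rewrite !mul0r eq_sym invr_eq0.
have [S Su SA] : exists2 S : 'M[L]_3, S \in unitmx & S^s *m (t *: A) = S.
  apply: (hilbert90 cardL sE).
  rewrite !map_mxZ mulmxZ3 -/U Uc scale_scalar_mx.
  have -> : s (s t) * s t * t = t * s t * s (s t) by ring.
  by rewrite Nt mulVf.
have [R Ru RB] : exists2 R : 'M[L]_3, R \in unitmx & R^s *m (t^-1 *: B^T) = R.
  apply: (hilbert90 cardL sE).
  rewrite !map_mxZ mulmxZ3 -!map_trmx -!trmx_mul mulmxA -/V Vd.
  rewrite tr_scalar_mx scale_scalar_mx !fmorphV -!invfM.
  have -> : s (s t) * s t * t = t * s t * s (s t) by ring.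
  rewrite Nt.
  by rewrite invrK cd.
pose T' := tact S T R^T.
have TT' : teq T T' by exists S, R^T; rewrite unitmx_tr.
have sT' : tmap s T' = T'.
  have SA' : S^s *m A = t^-1 *: S by rewrite -{2}SA -scalemxAr scalerA mulVf // scale1r.
  have RB' : B *m R^T^s = t *: R^T.
    rewrite -{2}RB trmx_mul linearZ /= trmxK -scalemxAl scalerA divff // scale1r.
    by rewrite map_trmx.
  rewrite tmap_act E tact_comp SA' RB'; apply/ffunP => i; rewrite !tactE.
  by rewrite -scalemxAl -scalemxAr -scalemxAl scalerA divff // scale1r.
have exT i : exists N, T' i = map_mx f N.
  have := sT'; move/ffunP/(_ i); rewrite [tmap s T' i]ffunE; exact: map_mx_frob_fixed.
have exT' i : exists N, T' i == map_mx f N by have [N ->] := exT i; exists N.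
pose T0 : tens F := [ffun i => xchoose (exT' i)].
have T0E : T' = tmap f T0.
  by apply/ffunP => i; rewrite [RHS]ffunE [T0 i]ffunE; apply/eqP/(xchooseP (exT' i)).
exists T0; rewrite -T0E; split=> //.
have [l l0 El] := rep_teq TT' rT.
have dN0 : \det (pencil T') != 0.
  by apply: contraNneq (smooth_neq0 sPL) => E0; rewrite El E0 scaler0.
have sl : s l = l.
  have := map_s_PL; rewrite El -mul_mpolyC rmorphM /= map_mpolyC map_pencil sT' !mul_mpolyC.
  move/eqP; rewrite -subr_eq0 -scalerBl -mul_mpolyC mulf_eq0 (negbTE dN0) orbF.
  by rewrite mpolyC_eq0 subr_eq0 => /eqP.
have [l1 El1] := frob_fixed f sE sl.
exists l1; first by rewrite -(fmorph_eq0 f) -El1.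
apply: (map_mpoly_inj (fmorph_inj f)); rewrite El El1 T0E.
by rewrite -!mul_mpolyC rmorphM /= map_mpolyC map_pencil.
Qed.
End Descent.

(** The orbits of [h] on [S] have one or three elements; the induction removes one orbit of three at
    a time. *)
Lemma card_order3 (T : finType) (S : {set T}) (h : T -> T) :
  {in S, forall x, h x \in S} -> {in S, forall x, h (h (h x)) = x} ->
  #|S| = #|[set x in S | h x == x]| %[mod 3].
Proof.
have [n] := ubnP #|S|; elim: n => // n IH in S *; rewrite ltnS => leS hS h3.
have [x /andP[xS hx]|none] := pickP [pred x | (x \in S) && (h x != x)]; last first.
  suff -> : [set x in S | h x == x] = S by [].
  apply/setP => x; rewrite inE.
  by have := none x; rewrite /=; case: (x \in S) => //= /negbFE ->.
have hhx : h (h x) != x by apply: contraNneq hx => E; rewrite -{1}E h3.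
have hhx' : h (h x) != h x.
  by apply: contraNneq hx => E; have := h3 x xS; rewrite !E => ->.
pose O := [set x; h x; h (h x)].
have OS : O \subset S.
  by apply/subsetP => y; rewrite !inE => /orP[/orP[]|] /eqP-> //; rewrite !hS.
have cO : #|O| = 3%N.
  by rewrite /O -setUA cardsU1 cards2 !inE negb_or eq_sym hx eq_sym hhx eq_sym hhx'.
have hO y : y \in S -> (h y \in O) = (y \in O).
  move=> yS; have inj z : z \in S -> (h y == h z) = (y == z).
    move=> zS; apply/eqP/eqP => [E|-> //].
    by rewrite -(h3 y yS) E h3.
  rewrite !inE -{1}(h3 x xS) !inj ?hS //.
  by case: (y == x); case: (y == h x); case: (y == h (h x)).
have cS : #|S| = (3 + #|S :\: O|)%N by rewrite -cO -(cardsID O S) (setIidPr OS).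
have -> : [set y in S | h y == y] = [set y in S :\: O | h y == y].
  apply/setP => y; rewrite !inE; case yS: (y \in S); rewrite ?andbF //= andbT.
  have [hy|//] := eqVneq (h y) y; rewrite ?andbF // andbT; symmetry.
  rewrite !negb_or; apply/andP; split; first (apply/andP; split).
  - by apply: contraNneq hx => <-; rewrite hy.
  - by apply: contraNneq hhx' => <-; rewrite hy.
  - by apply: contraNneq hhx => E; rewrite -{2}(h3 x xS) -E hy.
rewrite cS modnDl; apply: IH.
- by apply: leq_trans leS; rewrite cS !addSn add0n ltnS (leq_trans (leqnSn _)).
- by move=> y; rewrite !in_setD => /andP[yO yS]; rewrite hO // yO hS.
- by move=> y; rewrite in_setD => /andP[_ yS]; exact: h3.
Qed.

Section Normal.
Variable K : fieldType.
Implicit Types v p t : 'cV[K]_3.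

(** One representative for each point of the projective plane, so that points can be counted and
    compared by equality. *)
Definition normalv v : bool := (v 0 0 == 1) ||
  (v 0 0 == 0) && ((v 1 0 == 1) || (v 1 0 == 0) && (v 2 0 == 1)).

Lemma normalv_neq0 v : normalv v -> v != 0.
Proof. by apply: contraTneq => ->; rewrite /normalv !mxE eqxx !(eq_sym 0 1) oner_eq0. Qed.

Lemma normalize v : v != 0 -> exists2 c, c != 0 & normalv (c *: v).
Proof.
move=> v0; rewrite /normalv.
have [z0|n0] := eqVneq (v 0 0) 0; last first.
  by exists (v 0 0)^-1; rewrite ?invr_eq0 // !mxE mulVf // eqxx.
have [z1|n1] := eqVneq (v 1 0) 0; last first.
  by exists (v 1 0)^-1; rewrite ?invr_eq0 // !mxE z0 mulr0 mulVf // !eqxx /= !orbT.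
have n2 : v 2 0 != 0.
  apply: contraNneq v0 => z2; apply/eqP/colP => i; rewrite mxE.
  by case: (ord3P i) => ->.
by exists (v 2 0)^-1; rewrite ?invr_eq0 // !mxE z0 z1 !mulr0 mulVf // !eqxx /= !orbT.
Qed.

Lemma normalv_scale c v : normalv v -> normalv (c *: v) -> c = 1.
Proof.
have z1 : (0 == 1 :> K) = false by rewrite eq_sym oner_eq0.
move=> nv nc; have c0 : c != 0.
  by have := normalv_neq0 nc; apply: contraNneq => ->; rewrite scale0r.
move: nv nc; rewrite /normalv !mxE.
case/orP => [/eqP->|/andP[/eqP->]]; first by rewrite mulr1 (negbTE c0) orbF => /eqP.
rewrite mulr0 z1 eqxx /=.
case/orP => [/eqP->|/andP[/eqP->]]; first by rewrite mulr1 (negbTE c0) orbF => /eqP.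
by rewrite mulr0 z1 eqxx /= => /eqP->; rewrite mulr1 => /eqP.
Qed.

Lemma normalv_indep p t : normalv p -> normalv t -> p != t -> indep p t.
Proof.
move=> np nt pt; apply: indep_nsub => [|c]; first exact: normalv_neq0.
apply: contraNneq pt => E; rewrite E in nt *.
by rewrite (normalv_scale np nt) scale1r.
Qed.

Lemma indep_scale c p t : c != 0 -> indep p t -> indep p (c *: t).
Proof.
move=> c0 I a b; rewrite scalerA => /I[-> /eqP]; rewrite mulf_eq0 (negbTE c0) orbF.
by move/eqP.
Qed.

Lemma indep_ne c p t : indep p t -> t <> c *: p.
Proof.
move=> I E; have := I c (-1); rewrite E scaleN1r subrr => /(_ erefl)[_ /eqP].
by rewrite oppr_eq0 oner_eq0.
Qed.

Lemma residual_scale (T : tens K) c p t : residual T p t -> residual T p (c *: t).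
Proof.
move=> [u [v [u0 v0 up uv tv]]]; exists u, v; split=> //.
have -> : tev T (c *: t) = c *: tev T t.
  by apply/matrixP => i j; rewrite !mxE !tevE !mxE; ring.
by rewrite -scalemxAl tv scaler0.
Qed.

Lemma ptev_scale (P : {mpoly K[3]}) c v : P \is 3.-homog ->
  ptev P (c *: v) = c ^+ 3 * ptev P v.
Proof.
move=> hP; rewrite [P](cub_eta hP); move: (P@__) (P@__) (P@__) (P@__) (P@__) (P@__) (P@__) (P@__) (P@__) (P@__).
by move=> *; rewrite !ptev_cub !mxE; ring.
Qed.
End Normal.

Lemma normalv_map (K L : fieldType) (f : {rmorphism K -> L}) (v : 'cV[K]_3) :
  normalv (map_mx f v) = normalv v.
Proof.
have f1 x : (f x == 1) = (x == 1) by rewrite -(inj_eq (fmorph_inj f)) rmorph1.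
by rewrite /normalv !mxE !f1 !fmorph_eq0.
Qed.

Section FinBool.
Variable K : finFieldType.
Implicit Types (P : {mpoly K[3]}) (T : tens K) (p t : 'cV[K]_3).

(** Boolean forms are needed so that related residual points can be found by [pick]. *)
Definition repb P T := [exists l : K, (l != 0) && (P == l *: \det (pencil T))].

Lemma repP P T : reflect (rep P T) (repb P T).
Proof.
apply: (iffP existsP) => [[l /andP[l0 /eqP E]]|[l l0 E]]; exists l; [exact: l0|exact: E|].
by apply/andP; split; [exact: l0|apply/eqP; exact: E].
Qed.

Definition residualb T p t := [exists u : 'rV[K]_3, exists v : 'cV[K]_3,
  [&& u != 0, v != 0, u *m tev T p == 0, [forall i, u *m T i *m v == 0] & tev T t *m v == 0]].

Lemma residualP T p t : reflect (residual T p t) (residualb T p t).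
Proof.
apply: (iffP existsP) => [[u /existsP[v /and5P[u0 v0 /eqP up /forallP uv /eqP tv]]]|].
  by exists u, v; split=> // i; apply/eqP.
move=> [u [v [u0 v0 up uv tv]]]; exists u; apply/existsP; exists v; apply/and5P.
by split=> //; rewrite ?up ?tv //; apply/forallP => i; rewrite uv.
Qed.
End FinBool.

Section NoPoint.
Variables (F L : finFieldType) (f : {rmorphism F -> L}) (s : {rmorphism L -> L}).
Hypothesis cardL : #|L| = (#|F| ^ 3)%N.
Hypothesis sE : forall x, s x = x ^+ #|F|.
Variable P : {mpoly F[3]}.
Hypothesis sP : smooth_cubic P.
Hypothesis noF : forall x : 'cV[F]_3, x != 0 -> ptev P x != 0.
Local Notation PL := (map_mpoly f P).

Variable p : 'cV[L]_3.
Hypotheses (np : normalv p) (Pp : ptev PL p = 0).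

Let sPL : smooth_cubic PL := smooth_map f sP.
Let p0 : p != 0 := normalv_neq0 np.
Let S := [set v : 'cV[L]_3 | normalv v && (ptev PL v == 0)].
(** By [residual_realize] and [residual_classify] these points index the classes over [L]. *)
Let S' := S :\ p.

(** A normalised vector fixed by Frobenius would be a rational point of the curve. *)
Lemma cubic_points_mod3 : #|S| = 0 %[mod 3].
Proof.
rewrite (card_order3 (h := map_mx s)) => [|v|v _]; last 2 first.
- by rewrite !inE normalv_map -{2}(map_s_PL f sE P) ptev_map fmorph_eq0.
- exact: (map_mx_frob3 cardL sE).
suff -> : [set x in S | map_mx s x == x] = set0 by rewrite cards0.
apply/setP => v; rewrite !inE; apply/negP => /andP[/andP[nv /eqP Pv] /eqP sv].
have [w Ew] := map_mx_frob_fixed f sE sv.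
have w0 : w != 0 by rewrite -(map_mx_eq0 f) -Ew normalv_neq0.
by have /eqP := noF w0; apply; apply: (fmorph_inj f); rewrite rmorph0 -ptev_map -Ew.
Qed.

(* Frobenius maps the class with residual point [t] to the class with residual point [t']. *)
Let R (t t' : 'cV[L]_3) :=
  [exists T : tens L, [&& repb PL T, residualb T p t & residualb (tmap s T) p t']].

Lemma RP t t' : reflect (exists T, [/\ rep PL T, residual T p t & residual (tmap s T) p t']) (R t t').
Proof.
apply: (iffP existsP) => [[T /and3P[/repP rT /residualP d1 /residualP d2]]|[T [rT d1 d2]]]; exists T.
  by split.
by apply/and3P; split; [apply/repP|apply/residualP|apply/residualP].
Qed.

Lemma S'_indep t : t \in S' -> indep p t.
Proof. by rewrite !inE => /andP[tp /andP[nt _]]; apply: normalv_indep => //; rewrite eq_sym. Qed.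

Lemma residual_S' T t t' : rep PL T -> t \in S' -> t' \in S' -> residual T p t -> residual T p t' -> t = t'.
Proof.
move=> rT tS t'S d d'; have [c E] := residual_unique sPL rT p0 (indep_neq0 (S'_indep tS)).2 d d'.
move: t'S tS; rewrite !inE => /andP[_ /andP[nt' _]] /andP[_ /andP[nt _]].
by rewrite E in nt' *; rewrite (normalv_scale nt nt') scale1r.
Qed.

Lemma tmap_teq T T' : teq T T' -> teq (tmap s T) (tmap s T').
Proof.
case=> A [B [Au Bu ->]]; exists (map_mx s A), (map_mx s B).
by rewrite !map_unitmx Au Bu tmap_act.
Qed.

(** [R] may be tested on any representation in the class of [t], because the others are equivalent
    to it. *)
Lemma R_step T t t' : rep PL T -> t \in S' -> residual T p t -> R t t' -> residual (tmap s T) p t'.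
Proof.
move=> rT tS d /RP[T' [rT' d' d'']]; apply: residual_teq d''.
exact: tmap_teq (residual_classify sPL rT' rT (S'_indep tS) d' d).
Qed.

Lemma S'_pt t : t \in S' -> ptev PL t = 0.
Proof. by rewrite !inE => /andP[_ /andP[_ /eqP]]. Qed.

Lemma R_exists t : t \in S' -> exists2 t', t' \in S' & R t t'.
Proof.
move=> tS; have [T [rT dT]] := residual_realize (proj1 sPL) (S'_indep tS) Pp (S'_pt tS).
have rsT := rep_frob sE rT.
have [t' [It' dt']] := residual_exists sPL rsT p0 Pp.
have [c c0 nct'] := normalize (indep_neq0 It').2.
exists (c *: t'); last by apply/RP; exists T; split=> //; apply: residual_scale.
rewrite !inE nct' (residual_pt rsT (residual_scale c dt')) eqxx !andbT.
apply/eqP => E; have := indep_ne (indep_scale c0 It') (c := 1).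
by rewrite E scale1r => /(_ erefl).
Qed.

(** The action of Frobenius on classes, read off at the base point [p], which Frobenius itself
    moves. On [S'] the default is never taken, by [R_exists]. *)
Let h t := if [pick t' in S' | R t t'] is Some t' then t' else t.

Lemma hP t : t \in S' -> h t \in S' /\ R t (h t).
Proof.
move=> tS; rewrite /h; case: pickP => [t' /andP[] //|none].
by have [t' t'S Rt] := R_exists tS; have := none t'; rewrite /= t'S Rt.
Qed.

Lemma h3 t : t \in S' -> h (h (h t)) = t.
Proof.
move=> tS; have [t1S R1] := hP tS; have [t2S R2] := hP t1S; have [t3S R3] := hP t2S.
have [T [rT dT]] := residual_realize (proj1 sPL) (S'_indep tS) Pp (S'_pt tS).
have rT1 := rep_frob sE rT; have rT2 := rep_frob sE rT1.
have d3 := R_step rT2 t2S (R_step rT1 t1S (R_step rT tS dT R1) R2) R3.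
rewrite (tmap_frob3 cardL sE) in d3; exact: residual_S' rT t3S tS d3 dT.
Qed.

Lemma fixed_descends t : t \in S' -> h t = t ->
  exists T0 : tens F, rep P T0 /\ residual (tmap f T0) p t.
Proof.
move=> tS ht; have [_] := hP tS; rewrite ht => Rt.
have [T [rT dT]] := residual_realize (proj1 sPL) (S'_indep tS) Pp (S'_pt tS).
have E := residual_classify sPL rT (rep_frob sE rT) (S'_indep tS) dT (R_step rT tS dT Rt).
have [T0 [rT0 ET0]] := descend cardL sE sP rT E p0 Pp.
by exists T0; split=> //; apply: residual_teq ET0 dT.
Qed.

(** Leaving out [p] makes [#|S'|] congruent to 2 modulo 3, so [h] has at least two fixed points.
    Their descended representations are inequivalent, since an equivalence over [F] persists over
    [L] and would identify the residual points. *)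
Lemma two_classes : exists T1 T2 : tens F, [/\ rep P T1, rep P T2 & ~ teq T1 T2].
Proof.
have pS : p \in S by rewrite inE np Pp eqxx.
have c1 : #|S| = #|S'|.+1 by rewrite (cardsD1 p) pS.
have := card_order3 (fun t tS => (hP tS).1) h3.
have := cubic_points_mod3; rewrite c1.
set Fx := [set x in S' | h x == x] => m1 m2.
have : (1 < #|Fx|)%N.
  rewrite ltnNge; apply/negP => le; move: m1; rewrite -addn1 -modnDml m2 modnDml.
  by case: (#|Fx|) le => [|[|]].
have FxP t : t \in Fx -> t \in S' /\ h t = t by rewrite inE => /andP[tS /eqP].
case/card_gt1P => t1 [t2 [/FxP[t1S h1] /FxP[t2S h2] ne]].
have [T1 [r1 d1]] := fixed_descends t1S h1; have [T2 [r2 d2]] := fixed_descends t2S h2.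
exists T1, T2; split=> // -[A [B [Au Bu E]]].
have E' : teq (tmap f T1) (tmap f T2).
  exists (map_mx f A), (map_mx f B); rewrite !map_unitmx; split=> //.
  by rewrite E; apply/ffunP => i; rewrite !ffunE !map_mxM.
case/eqP: ne; exact: residual_S' (rep_map f r2) t1S t2S (residual_teq E' d1) d2.
Qed.
End NoPoint.

Lemma cubic_extension (F : finFieldType) (h : {poly F}) : size h = 4%N ->
  (forall x, ~~ root h x) -> exists (L : finFieldType) (f : {rmorphism F -> L}) (z : L),
  #|L| = (#|F| ^ 3)%N /\ root (map_poly f h) z.
Proof.
move=> sh nr; have irr : irreducible_poly h by apply: cubic_irreducible; rewrite ?sh.
have [L0 dL [z rz _]] := irredp_FAdjoin irr.
exists (finvect_type L0), (GRing.in_alg (finvect_type L0)), z; split; last exact: rz.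
have -> : #|finvect_type L0| = #|(fullv : {vspace finvect_type L0})|.
  by apply: eq_card => v; rewrite memvf.
by rewrite card_vspace -[3%N]/(4%N.-1) -sh -dL.
Qed.

Lemma horner_jet (R : comNzRingType) (P : {mpoly R[3]}) (x y : 'cV[R]_3) c :
  (jet x y P).[c] = ptev P (x + c *: y).
Proof.
rewrite /ptev; elim/mpoly_ring_ind: P => [a|i|p q Ep Eq|p q Ep Eq].
- by rewrite jetC hornerC mevalC.
- by rewrite jetX !hornerE mevalXU !mxE mulrC.
- by rewrite jetD hornerD Ep Eq mevalD.
- by rewrite jetM hornerM Ep Eq mevalM.
Qed.

Lemma map_jet (R S : comNzRingType) (f : {rmorphism R -> S}) (P : {mpoly R[3]}) x y :
  map_poly f (jet x y P) = jet (map_mx f x) (map_mx f y) (map_mpoly f P).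
Proof.
elim/mpoly_ring_ind: P => [a|i|p q Ep Eq|p q Ep Eq].
- by rewrite jetC map_mpolyC jetC map_polyC.
- by rewrite jetX map_mpolyXU jetX rmorphD rmorphM /= !map_polyC map_polyX !mxE.
- by rewrite jetD !rmorphD /= jetD Ep Eq.
- by rewrite jetM !rmorphM /= jetM Ep Eq.
Qed.

Lemma size_jet (K : fieldType) (P : {mpoly K[3]}) : P \is 3.-homog ->
  ptev P (e0 K) != 0 -> size (jet (e1 K) (e0 K) P) = 4%N.
Proof.
move=> hP; rewrite [P](cub_eta hP).
move: (P@__) (P@__) (P@__) (P@__) (P@__) (P@__) (P@__) (P@__) (P@__) (P@__).
move=> c003 c012 c021 c03 c102 c111 c12 c201 c21 c30; rewrite ptev_cub !col3E => c0.
have {}c0 : c30 != 0 by apply: contraNneq c0 => ->; apply/eqP; ring.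
suff -> : jet (e1 K) (e0 K) (cub c30 c21 c201 c12 c111 c102 c03 c021 c012 c003) =
  Poly [:: c03; c12; c21; c30] by rewrite (@PolyK _ c30).
rewrite /= !cons_poly_def /cub !expr2 !exprS !expr0.
by rewrite !jetD !jetM -!mpolyC1 !jetC !jetX !col3E !polyC0 !polyC1; ring.
Qed.

(** On the line through [e1] and [e0] the cubic restricts to a polynomial of degree three, as [e0]
    is off the curve, and without root in [F], hence irreducible. Its root in the cubic extension
    supplies the base point. *)
Theorem no_point_two_classes (F : finFieldType) (P : {mpoly F[3]}) : smooth_cubic P ->
  (forall x : 'cV[F]_3, x != 0 -> ptev P x != 0) ->
  exists T1 T2 : tens F, [/\ rep P T1, rep P T2 & ~ teq T1 T2].
Proof.
move=> sP noF; have [hP _] := sP.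
have sz := size_jet hP (noF _ (e0_neq0 F)).
have e10 c : e1 F + c *: e0 F != 0.
  by apply/cV0Pn; exists 1; rewrite !mxE /= mulr0 addr0 oner_neq0.
have [|L [f [z [cL rz]]]] := cubic_extension sz.
  by move=> c; rewrite /root horner_jet noF.
have [s sE] := frobenius_morphism f.
have z0 : e1 L + z *: e0 L != 0.
  by apply/cV0Pn; exists 1; rewrite !mxE /= mulr0 addr0 oner_neq0.
have [c c0 nc] := normalize z0.
apply: (@two_classes F L f s cL sE P sP noF _ nc).
rewrite ptev_scale; last exact: map_mpoly_homog.
have map_col3 (a b d : F) : map_mx f (col3 a b d) = col3 (f a) (f b) (f d).
  by apply/colP => i; case: (ord3P i) => ->; rewrite !mxE.
move: rz; rewrite /root map_jet horner_jet !map_col3 !rmorph0 !rmorph1 => /eqP E.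
by rewrite [X in _ * X]E mulr0.
Qed.

(** * From triples back to matrices of linear forms *)

Section Link.
Variable K : fieldType.
Implicit Types (P : {mpoly K[3]}) (T : tens K).

Lemma pencil_inj : injective (@pencil K).
Proof.
move=> T T' /matrixP E; apply: tens_eq; apply/matrixP => a b;
  have := E a b; rewrite !pencilE => /mpolyP => {}E.
- by have := E (mon 1 0 0); rewrite !lin_coef.
- by have := E (mon 0 1 0); rewrite !lin_coef.
- by have := E (mon 0 0 1); rewrite !lin_coef.
Qed.

Lemma linear_form_pencil (M : 'M[{mpoly K[3]}]_3) : linear_form_mx M -> exists T, M = pencil T.
Proof.
move=> lM; pose m (i : 'I_3) := match val i with 0 => mon 1 0 0 | 1 => mon 0 1 0 | _ => mon 0 0 1 end%N.
exists [ffun i => \matrix_(a, b) (M a b)@_(m i)]; apply/matrixP => a b.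
by rewrite pencilE !ffunE !mxE; exact: lin_eta.
Qed.

Lemma det_rep_pencil P T : det_rep P (pencil T) <-> rep P T.
Proof.
split=> [[_ [l [l0 E]]]|[l l0 E]]; first by exists l.
split; last by exists l; split; [exact: l0|exact: E].
by move=> a b; rewrite pencilE; exact: lin_homog.
Qed.

Lemma det_rep_equiv_pencil T T' : det_rep_equiv (pencil T) (pencil T') <-> teq T T'.
Proof.
split=> [[A [B [Au [Bu E]]]]|[A [B [Au Bu ->]]]].
  by exists A, B; split=> //; apply: pencil_inj; rewrite E pencil_act.
by exists A, B; split=> //; split=> //; rewrite pencil_act.
Qed.

Lemma unique_tensor P : unique_det_rep_class P <->
  exists T, rep P T /\ forall T', rep P T' -> teq T T'.
Proof.
split=> [[M [rM uM]]|[T [rT uT]]].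
  have [T E] := linear_form_pencil rM.1; rewrite E in rM uM; exists T.
  split; first exact/det_rep_pencil.
  by move=> T' rT'; apply/det_rep_equiv_pencil/uM/det_rep_pencil.
exists (pencil T); split; first exact/det_rep_pencil.
move=> M rM; have [T' E] := linear_form_pencil rM.1; rewrite E in rM *.
by apply/det_rep_equiv_pencil/uT/det_rep_pencil.
Qed.
End Link.

(** * Curves with two rational points and their Weierstrass form *)

Section TwoPoints.
Variable F : finFieldType.
Implicit Types (P Q : {mpoly F[3]}) (p t x : 'cV[F]_3) (g : 'M[F]_3).

Definition two_points P p t := [/\ indep p t, ptev P p = 0, ptev P t = 0 &
  forall x, x != 0 -> ptev P x = 0 -> (exists c, x = c *: p) \/ (exists c, x = c *: t)].

Lemma exists_point P : smooth_cubic P -> unique_det_rep_class P ->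
  exists2 p, p != 0 & ptev P p = 0.
Proof.
move=> sP /unique_tensor[T [rT uT]].
have [/existsP[p /andP[p0 /eqP Pp]]|/negP none] :=
  boolP [exists p : 'cV[F]_3, (p != 0) && (ptev P p == 0)]; first by exists p.
have [x x0|T1 [T2 [r1 r2]]] := no_point_two_classes sP.
  by apply/eqP => Px; apply: none; apply/existsP; exists x; rewrite x0 Px eqxx.
by case; apply: teq_trans (teq_sym (uT _ r1)) (uT _ r2).
Qed.

(** Every further rational point is the residual point of some representation; as all are
    equivalent, it is proportional to [t]. *)
Lemma unique_two_points P : smooth_cubic P -> unique_det_rep_class P ->
  exists p t, two_points P p t.
Proof.
move=> sP uP; have [p p0 Pp] := exists_point sP uP.
have [T [rT uT]] := (unique_tensor P).1 uP.
have [t [It dt]] := residual_exists sP rT p0 Pp.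
exists p, t; split=> // [|x x0 Px]; first exact: residual_pt rT dt.
have [/existsP[c /eqP ->]|/existsPn np] := boolP [exists c, x == c *: p].
  by left; exists c.
right; have Ix : indep p x by apply: indep_nsub.
have [T' [rT' dT']] := residual_realize (proj1 sP) Ix Pp Px.
exact: residual_unique sP rT' p0 (indep_neq0 It).2 (residual_teq (uT _ rT') dt) dT'.
Qed.

Lemma two_points_unique P p t : smooth_cubic P -> two_points P p t -> unique_det_rep_class P.
Proof.
move=> sP [I Pp Pt two]; apply/unique_tensor.
have [T [rT dT]] := residual_realize (proj1 sP) I Pp Pt.
exists T; split=> // T' rT'; have p0 := (indep_neq0 I).1.
have [t' [It' dt']] := residual_exists sP rT' p0 Pp.
have [[c E]|[c E]] := two t' (indep_neq0 It').2 (residual_pt rT' dt').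
  by case: (indep_ne It' E).
apply: (residual_classify sP rT rT' I dT).
have c0 : c != 0 by apply: contraNneq (indep_neq0 It').2 => c0; rewrite E c0 scale0r.
by have := residual_scale c^-1 dt'; rewrite E scalerA mulVf // scale1r.
Qed.

Lemma two_points_sym P p t : two_points P p t -> two_points P t p.
Proof.
move=> [I Pp Pt two]; split=> // [a b|x x0 Px].
  by rewrite addrC => /I[-> ->].
by case: (two x x0 Px) => E; [right|left].
Qed.

Lemma two_points_subst P p t g : g \in unitmx -> two_points P (g *m p) (g *m t) ->
  two_points (lin_subst g P) p t.
Proof.
move=> gu [I Pp Pt two]; split; rewrite ?ptev_subst //.
  move=> a b E; apply: I; rewrite !scalemxAr -mulmxDr.
  by rewrite E mulmx0.
move=> x x0; rewrite ptev_subst => Px.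
have gx0 : g *m x != 0 by apply: contraNneq x0 => E; rewrite -(mulKmx gu x) E mulmx0.
by case: (two _ gx0 Px) => -[c E]; [left|right]; exists c;
  rewrite -(mulKmx gu x) E -scalemxAr mulKmx.
Qed.
End TwoPoints.

Section Weierstrass.
Variable K : fieldType.
Implicit Types (P Q : {mpoly K[3]}) (x : 'cV[K]_3).

(** For [A], [C], [E] non-zero, [e0] is a flex with tangent [Z = 0], and the tangent [Y = 0] at [e2]
    passes through [e0], so [e2] is a point of order two. *)
Definition weier (A B C D E : K) : {mpoly K[3]} := cub 0 0 A 0 B 0 C D E 0.

Lemma sing_mul P Q x : ptev P x = 0 -> ptev Q x = 0 -> sing (P * Q) x.
Proof.
rewrite /sing /ptev => P0 Q0; split=> [|i]; first by rewrite mevalM P0 mul0r.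
by rewrite mderivM mevalD !mevalM P0 Q0 mulr0 mul0r addr0.
Qed.

Lemma mderivXU (i j : 'I_3) : mderiv i ('X_j : {mpoly K[3]}) = (i == j)%:R%:MP.
Proof.
rewrite mderivX mnm1E eq_sym; case: eqVneq => [->|_]; last by rewrite scale0r mpolyC0.
by rewrite -{1}[U_(j)%MM]add0m addmK mpolyX0 scale1r mpolyC1.
Qed.

Lemma sing_weier A B C D E x : sing (weier A B C D E) x ->
  [/\ A * x 0 0 ^+ 2 * x 2 0 + B * x 0 0 * x 1 0 * x 2 0 + C * x 1 0 ^+ 3
      + D * x 1 0 ^+ 2 * x 2 0 + E * x 1 0 * x 2 0 ^+ 2 = 0,
      A * 2%:R * x 0 0 * x 2 0 + B * x 1 0 * x 2 0 = 0,
      B * x 0 0 * x 2 0 + C * 3%:R * x 1 0 ^+ 2 + D * 2%:R * x 1 0 * x 2 0 + E * x 2 0 ^+ 2 = 0 &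
      A * x 0 0 ^+ 2 + B * x 0 0 * x 1 0 + D * x 1 0 ^+ 2 + E * 2%:R * x 1 0 * x 2 0 = 0].
Proof.
rewrite /sing /weier ptev_cub => -[P0 dP]; split; first by rewrite -P0; ring.
- rewrite -(dP 0) /ptev /cub !expr2 !exprS !expr0 !(mderivD, mderivM, mderivC, mderivXU) /=.
  rewrite !(mevalD, mevalM, mevalC, mevalXU, meval1, meval0) /=; ring.
- rewrite -(dP 1) /ptev /cub !expr2 !exprS !expr0 !(mderivD, mderivM, mderivC, mderivXU) /=.
  rewrite !(mevalD, mevalM, mevalC, mevalXU, meval1, meval0) /=; ring.
- rewrite -(dP 2) /ptev /cub !expr2 !exprS !expr0 !(mderivD, mderivM, mderivC, mderivXU) /=.
  rewrite !(mevalD, mevalM, mevalC, mevalXU, meval1, meval0) /=; ring.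
Qed.
End Weierstrass.

Lemma map_cub (K L : fieldType) (f : {rmorphism K -> L}) (c30 c21 c201 c12 c111 c102 c03 c021 c012 c003 : K) :
  map_mpoly f (cub c30 c21 c201 c12 c111 c102 c03 c021 c012 c003) =
  cub (f c30) (f c21) (f c201) (f c12) (f c111) (f c102) (f c03) (f c021) (f c012) (f c003).
Proof. by rewrite /cub !(rmorphD, rmorphM, rmorphXn) /= !map_mpolyC !map_mpolyXU. Qed.

Lemma smooth_weier_E (K : fieldType) (A B C D E : K) : smooth_cubic (weier A B C D E) -> E != 0.
Proof.
move=> sW; apply/eqP => E0; have x0 : e2 K != 0.
  by apply/cV0Pn; exists 2; rewrite col3E oner_neq0.
apply: (smooth_nsing sW x0); apply: jet_sing => y.
exists ((A * y 0 0 ^+ 2)%:P * (1 + (y 2 0)%:P * 'X) + (B * y 0 0 * y 1 0)%:P * (1 + (y 2 0)%:P * 'X)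
  + (C * y 1 0 ^+ 3)%:P * 'X + (D * y 1 0 ^+ 2)%:P * (1 + (y 2 0)%:P * 'X)).
rewrite /weier /cub E0 !expr2 !exprS !expr0 !jetD !jetM -!mpolyC1 !jetC !jetX !col3E.
rewrite !(polyCM, polyC0, polyC1); ring.
Qed.

(** The form is [Z] times a conic; it is singular where the line [Z = 0] meets the conic, over an
    algebraic closure. *)
Lemma cub_reducible (F : finFieldType) (c201 c111 c102 c021 c012 c003 : F) :
  ~ smooth_cubic (cub 0 0 c201 0 c111 c102 0 c021 c012 c003).
Proof.
move=> /smoothP[_ H]; have [L [f _]] := countable_algebraic_closure F.
have [x [y [xy0 q0]]] : exists x y : L, (x != 0) || (y != 0) /\
    f c201 * x ^+ 2 + f c111 * x * y + f c021 * y ^+ 2 = 0.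
  have [z|nz] := eqVneq (f c201) 0.
    by exists 1, 0; rewrite oner_neq0; split=> //; rewrite z; ring.
  have [x Ex] := quadratic_root (f c111) (f c021) nz.
  by exists x, 1; rewrite oner_neq0 orbT; split=> //; rewrite -Ex; ring.
apply: (H L f (col3 x y 0)).
  by case/orP: xy0 => nz; apply/cV0Pn; [exists 0|exists 1]; rewrite col3E.
have -> : map_mpoly f (cub 0 0 c201 0 c111 c102 0 c021 c012 c003) =
  'X_2 * ((f c201)%:MP * 'X_0 ^+ 2 + (f c111)%:MP * 'X_0 * 'X_1 + (f c021)%:MP * 'X_1 ^+ 2
    + ((f c102)%:MP * 'X_0 + (f c012)%:MP * 'X_1 + (f c003)%:MP * 'X_2) * 'X_2).
  by rewrite map_cub rmorph0 /cub mpolyC0; ring.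
apply: sing_mul; first by rewrite /ptev mevalXU col3E.
rewrite /ptev !(mevalD, mevalM, mevalC, mevalXU, rmorphXn) /= !col3E.
by rewrite -[RHS]q0; ring.
Qed.

Lemma lin_subst_cub (K : fieldType) (g : 'M[K]_3) (c30 c21 c201 c12 c111 c102 c03 c021 c012 c003 : K)
  (l := fun i => lin (g i 0) (g i 1) (g i 2)) :
  lin_subst g (cub c30 c21 c201 c12 c111 c102 c03 c021 c012 c003) =
  c30%:MP * l 0 ^+ 3 + c21%:MP * l 0 ^+ 2 * l 1 + c201%:MP * l 0 ^+ 2 * l 2
  + c12%:MP * l 0 * l 1 ^+ 2 + c111%:MP * l 0 * l 1 * l 2 + c102%:MP * l 0 * l 2 ^+ 2
  + c03%:MP * l 1 ^+ 3 + c021%:MP * l 1 ^+ 2 * l 2 + c012%:MP * l 1 * l 2 ^+ 2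
  + c003%:MP * l 2 ^+ 3.
Proof.
have lE i : lin_subst g 'X_i = l i by rewrite lin_substX sum3.
have Xn n Q : lin_subst g (Q ^+ n) = lin_subst g Q ^+ n by rewrite /lin_subst rmorphXn.
by rewrite /cub !(lin_substD, lin_substM, Xn, lin_substC, lE).
Qed.

Section Normalise.
Variable F : finFieldType.
Implicit Types (P Q : {mpoly F[3]}) (p t x : 'cV[F]_3) (g : 'M[F]_3).

(* The tangent at [e0] is the line [Z = 0] through [e1]; then [e1] is a flex, for otherwise the
   tangent at [e1] would meet the curve in a third rational point. *)
Lemma flex_form (c201 c12 c111 c102 c021 c012 c003 : F) (Q := cub 0 0 c201 c12 c111 c102 0 c021 c012 c003) :
  smooth_cubic Q -> two_points Q (e0 F) (e1 F) ->
  exists g A B C D E, [/\ g \in unitmx, lin_subst g Q = weier A B C D E, A != 0 &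
     two_points (weier A B C D E) (e0 F) (e2 F)].
Proof.
move=> sQ [I Q0 Q1 two]; have c12N0 : c12 != 0.
  by apply/eqP => c120; rewrite /Q c120 in sQ; apply: cub_reducible sQ.
(* On the tangent [c12 X + c021 Z = 0] at [e1], parametrised by [(- c021 s, y, c12 s)], the cubic
   restricts to [s^2 (a y + b s)]; its third zero is [s = a], [y = - b]. *)
pose a := c012 * c12 ^+ 2 - c111 * c021 * c12.
pose b := c201 * c021 ^+ 2 * c12 - c102 * c021 * c12 ^+ 2 + c003 * c12 ^+ 3.
have a0 : a = 0.
  apply/eqP/negPn/negP => aN0.
  have [||[c]|[c]] := two (col3 (- c021 * a) (- b) (c12 * a)).
  - by apply/cV0Pn; exists 2; rewrite col3E mulf_neq0.
  - by rewrite ptev_cub !col3E /a /b; ring.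
  - by move/colP/(_ 2)/eqP; rewrite !mxE /= mulr0 mulf_eq0 (negbTE c12N0) (negbTE aN0).
  - by move/colP/(_ 2)/eqP; rewrite !mxE /= mulr0 mulf_eq0 (negbTE c12N0) (negbTE aN0).
(* The columns are the flex [e1], a second point of its tangent, and [e0]. *)
pose g := mx3 0 (- c021) 1 1 0 0 0 c12 0.
have gu : g \in unitmx.
  have dg : \det g = c12 by rewrite det_mx3; ring.
  by rewrite unitmxE dg unitfE.
exists g, c12, (c111 * c12), b, (c102 * c12 ^+ 2 - c201 * c021 * c12 *+ 2), (c201 * c12).
have Eg : lin_subst g Q = weier c12 (c111 * c12) b
    (c102 * c12 ^+ 2 - c201 * c021 * c12 *+ 2) (c201 * c12).
  transitivity (cub 0 0 c12 a (c111 * c12) 0 b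
    (c102 * c12 ^+ 2 - c201 * c021 * c12 *+ 2) (c201 * c12) 0); last first.
    by rewrite a0.
  rewrite /Q lin_subst_cub /cub /lin !mx3E /a /b.
  rewrite !(mpolyCD, mpolyCM, mpolyCN, mpolyC0, mpolyC1, mpolyCMn); ring.
split=> //; rewrite -Eg; apply: two_points_subst => //.
rewrite mul_e0 mul_e2; have -> : col 0 g = e1 F.
  by apply/colP => i; rewrite mxE; case: (ord3P i) => ->; rewrite mx3E col3E.
have -> : col 2 g = e0 F.
  by apply/colP => i; rewrite mxE; case: (ord3P i) => ->; rewrite mx3E col3E.
exact: two_points_sym.
Qed.
End Normalise.

Section WeierstrassForm.
Variable F : finFieldType.
Implicit Types (P Q : {mpoly F[3]}) (p t x : 'cV[F]_3) (g : 'M[F]_3).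

Definition no_finite_points (A B C D E : F) := forall x y : F, y != 0 ->
  A * x ^+ 2 + B * x * y + C * y ^+ 3 + D * y ^+ 2 + E * y != 0.

(** On [Z = 0] the equation reduces to [C y^3 = 0], on [Y = 0] to [A x^2 z = 0]; these give [e0] and
    [e2], and [no_finite_points] excludes the rest. *)
Lemma weier_two_points A B C D E : A != 0 -> C != 0 ->
  two_points (weier A B C D E) (e0 F) (e2 F) <-> no_finite_points A B C D E.
Proof.
move=> A0 C0; split=> [[I _ _ two] x y y0|np].
  apply: contraNneq y0 => W0.
  have [||[c]|[c]] := two (col3 x y 1).
  - by apply/cV0Pn; exists 2; rewrite col3E oner_neq0.
  - by rewrite ptev_cub !col3E -[RHS]W0; ring.
  - by move/colP/(_ 1)/eqP; rewrite !mxE /= mulr0.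
  - by move/colP/(_ 1)/eqP; rewrite !mxE /= mulr0.
split; rewrite /weier ?ptev_cub ?col3E; try ring.
  move=> a b /colP ab; split.
    by have := ab 0; rewrite !mxE /= mulr1 mulr0 addr0.
  by have := ab 2; rewrite !mxE /= mulr1 mulr0 add0r.
move=> v v0; rewrite ptev_cub; rewrite [v]col3_eta !col3E.
move: (v 0 0) (v 1 0) (v 2 0) (col3_eta v) => x y z Ev W0.
have [z0|z0] := eqVneq z 0.
  left; exists x; rewrite z0 in W0 *.
  have : C * y ^+ 3 = 0 by rewrite -[RHS]W0; ring.
  move/eqP; rewrite mulf_eq0 (negbTE C0) expf_eq0 => /eqP ->.
  by apply/colP => i; case: (ord3P i) => ->; rewrite !mxE /= ?mulr1 ?mulr0.
right; exists z; have W1 : A * (x / z) ^+ 2 + B * (x / z) * (y / z) + C * (y / z) ^+ 3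
    + D * (y / z) ^+ 2 + E * (y / z) = 0.
  apply: (mulfI (expf_neq0 3 z0)); rewrite mulr0 -[RHS]W0; field.
  exact: z0.
have y0 : y = 0.
  apply/eqP/negPn/negP => y0; have := np (x / z) (y / z).
  by rewrite W1 eqxx mulf_neq0 ?invr_eq0 // => /(_ isT).
have : A * x ^+ 2 * z = 0 by rewrite -[RHS]W0 y0; ring.
move/eqP; rewrite !mulf_eq0 (negbTE A0) (negbTE z0) orbF orbb => /eqP ->; rewrite y0.
by apply/colP => i; case: (ord3P i) => ->; rewrite !mxE /= ?mulr1 ?mulr0.
Qed.

(** With the two points at [e0] and [e1] the cubic restricts to [X Y (c21 X + c12 Y)] on the line
    joining them. The third zero is rational, so it is [e0] or [e1]: the line is tangent at one of
    them, and a swap of coordinates makes it [e0]. *)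
Lemma weierstrass_form P : smooth_cubic P -> unique_det_rep_class P ->
  exists g A B C D E, [/\ g \in unitmx, lin_subst g P = weier A B C D E,
    [/\ A != 0, C != 0 & E != 0] & no_finite_points A B C D E].
Proof.
move=> sP uP; suff [g [A [B [C [D [E [gu EP A0 two]]]]]]] :
  exists g A B C D E, [/\ g \in unitmx, lin_subst g P = weier A B C D E, A != 0 &
     two_points (weier A B C D E) (e0 F) (e2 F)].
  have sW : smooth_cubic (weier A B C D E) by rewrite -EP; apply: smooth_subst.
  have C0 : C != 0 by apply/eqP => C0; rewrite /weier C0 in sW; apply: cub_reducible sW.
  exists g, A, B, C, D, E; split=> //; first by split=> //; apply: smooth_weier_E sW.
  exact/weier_two_points.
have [p [t tw]] := unique_two_points sP uP.
have flex g c201 c12 c111 c102 c021 c012 c003 : g \in unitmx ->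
    lin_subst g P = cub 0 0 c201 c12 c111 c102 0 c021 c012 c003 ->
    two_points (lin_subst g P) (e0 F) (e1 F) ->
  exists g A B C D E, [/\ g \in unitmx, lin_subst g P = weier A B C D E, A != 0 &
     two_points (weier A B C D E) (e0 F) (e2 F)].
  move=> gu Eg two; have sQ := smooth_subst gu sP; rewrite Eg in sQ two.
  have [h [A [B [C [D [E [hu EW A0 two']]]]]]] := flex_form sQ two.
  exists (g *m h), A, B, C, D, E; split=> //; first by rewrite unitmx_mul gu hu.
  by rewrite -lin_subst_mul Eg EW.
have [I Pp Pt two] := tw; have [g gu [gp gt]] := indep_frame I.
have tw01 : two_points (lin_subst g P) (e0 F) (e1 F) by apply: two_points_subst; rewrite ?gp ?gt.
have [_ Q0 Q1 twQ] := tw01.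
have sQ := smooth_subst gu sP; have EQ := cub_eta (proj1 sQ).
move: EQ (flex g); set Q := lin_subst g P in Q0 Q1 twQ tw01 sQ *.
move: (Q@__) (Q@__) (Q@__) (Q@__) (Q@__) (Q@__) (Q@__) (Q@__) (Q@__) (Q@__).
move=> c003 c012 c021 c03 c102 c111 c12 c201 c21 c30 EQ flexg.
have c30E : c30 = 0 by rewrite -Q0 EQ ptev_cub !col3E; ring.
have c03E : c03 = 0 by rewrite -Q1 EQ ptev_cub !col3E; ring.
rewrite c30E c03E in EQ.
have [c21E|c21N] := eqVneq c21 0; first by apply: (flexg _ _ _ _ _ _ _ gu _ tw01); rewrite EQ c21E.
have [c12E|c12N] := eqVneq c12 0; last first.
  have [||[c]|[c]] := twQ (col3 (- c12) c21 0).
  - by apply/cV0Pn; exists 1; rewrite col3E.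
  - by rewrite EQ ptev_cub !col3E; ring.
  - by move/colP/(_ 1)/eqP; rewrite !mxE /= mulr0 (negbTE c21N).
  - by move/colP/(_ 0)/eqP; rewrite !mxE /= mulr0 oppr_eq0 (negbTE c12N).
pose w := mx3 0 1 0 1 0 0 0 0 1 : 'M[F]_3.
have wu : w \in unitmx.
  have dw : \det w = -1 by rewrite det_mx3; ring.
  by rewrite unitmxE dw unitrN1.
have wE : lin_subst (g *m w) P = cub 0 0 c021 c21 c111 c012 0 c201 c102 c003.
  rewrite -lin_subst_mul -/Q EQ lin_subst_cub /lin !mx3E c12E /cub mpolyC0 mpolyC1; ring.
apply: (flex _ _ _ _ _ _ _ _ _ wE); first by rewrite unitmx_mul gu wu.
rewrite -lin_subst_mul; apply: two_points_subst => //; rewrite mul_e0 mul_e1.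
have -> : col 0 w = e1 F.
  by apply/colP => i; rewrite mxE; case: (ord3P i) => ->; rewrite mx3E col3E.
have -> : col 1 w = e0 F.
  by apply/colP => i; rewrite mxE; case: (ord3P i) => ->; rewrite mx3E col3E.
exact: two_points_sym.
Qed.
End WeierstrassForm.

(** * Fields with more than five elements *)

Section LargeOdd.
Variable F : finFieldType.
Implicit Types A B C D E : F.

Lemma finField_euler (m : nat) (a : F) : #|F| = m.*2.+1 -> a != 0 ->
  (forall s, s ^+ 2 != a) -> a ^+ m = -1.
Proof.
move=> qE a0 ns; have : (a ^+ m) ^+ 2 == 1.
  rewrite -exprM muln2; apply/eqP/(mulfI a0).
  by rewrite -exprS -qE expf_card mulr1.
rewrite sqrf_eq1 => /orP[/eqP am|/eqP //].
have [|s sa] := @finField_nth_root F 2 m a _ am; first by rewrite qE mul2n.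
by have := ns s; rewrite sa eqxx.
Qed.

Lemma finField_card_char : exists2 p, p \in [pchar F] & exists n, #|F| = (p ^ n)%N.
Proof.
have [p p_pr charF] := finPcharP F; exists p => //.
by exists (logn p #|F|); exact: card_pprimeChar charF.
Qed.

Lemma finField_card_eq0 : #|F|%:R = 0 :> F.
Proof.
have [p charp [[|n] cardF]] := finField_card_char.
  by have := finNzRing_gt1 F; rewrite cardF.
by rewrite cardF natrX (pcharf0 charp) expr0n.
Qed.

Lemma vanish_dvdp (p : {poly F}) : (forall y, y != 0 -> p.[y] = 0) -> 'X^(#|F|.-1) - 1 %| p.
Proof.
move=> p0; rewrite -(@dvdp_mul2l _ 'X) ?polyX_eq0 // mulrBr mulr1 -exprS prednK; last first.
  exact: ltnW (finNzRing_gt1 F).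
rewrite finField_genPoly -big_enum; apply: uniq_roots_dvdp; last by rewrite uniq_rootsE enum_uniq.
apply/allP => y _; apply/rootP; rewrite hornerM hornerX.
by have [->|y0] := eqVneq y 0; [rewrite mul0r|rewrite p0 ?mulr0].
Qed.

(* The discriminant [phi] in [x] takes only nonsquare values on [F^*], so [phi ^+ m = -1] there, with
   [2 m + 1 = q]. Differentiating [phi ^+ m + 1 = k (X^(q-1) - 1)] shows that [m X phi' - phi k]
   vanishes on [F]; its degree is too small, so it is [0], but [phi k] has degree [m + 3 > 3]. *)
Lemma no_finite_points_odd A B C D E : (2%:R : F) != 0 -> (5 < #|F|)%N ->
  A != 0 -> C != 0 -> E != 0 -> ~ no_finite_points A B C D E.
Proof.
move=> two0 q5 A0 C0 E0 np.
(* Coefficients of the discriminant in [x] of the equation, a cubic in [y] without constant term. *)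
pose c3 := - (4%:R * A * C); pose c2 := B ^+ 2 - 4%:R * A * D; pose c1 := - (4%:R * A * E).
have four0 : (4%:R : F) != 0 by rewrite (natrM F 2 2) mulf_neq0.
have c30 : c3 != 0 by rewrite oppr_eq0 !mulf_neq0.
pose phi : {poly F} := c3 *: 'X^3 + c2 *: 'X^2 + c1 *: 'X.
have phiE y : phi.[y] = c3 * y ^+ 3 + c2 * y ^+ 2 + c1 * y.
  by rewrite !hornerD !hornerZ !hornerXn hornerX.
have nsq y s : y != 0 -> s ^+ 2 != phi.[y].
  move=> y0; apply/eqP => Es; have /eqP := np ((s - B * y) / (2%:R * A)) y y0; apply.
  have -> : A * ((s - B * y) / (2%:R * A)) ^+ 2 + B * ((s - B * y) / (2%:R * A)) * y +
    C * y ^+ 3 + D * y ^+ 2 + E * y = (s ^+ 2 - phi.[y]) / (4%:R * A).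
    by rewrite phiE /c3 /c2 /c1; field; rewrite A0 two0 four0.
  by rewrite Es subrr mul0r.
have phi0 y : y != 0 -> phi.[y] != 0.
  by move=> y0; have := nsq y 0 y0; rewrite expr0n eq_sym.
have oddq : odd #|F|.
  have [p charp [n cardF]] := finField_card_char; rewrite cardF oddX.
  have p_pr := pcharf_prime charp; have [//|] := boolP (odd p); first by rewrite orbT.
  rewrite -dvdn2 => p2; have : p == 2%N by rewrite -(prime_nt_dvdP _ _ p2) //.
  move=> /eqP p2E; by case/eqP: two0; rewrite -p2E; exact: pcharf0.
pose m := (#|F|)./2; have qE : #|F| = m.*2.+1 by rewrite -{1}[#|F|]odd_double_half oddq add1n.
have m3 : (3 <= m)%N by move: q5; rewrite qE; lia.
have qE1 : #|F|.-1 = m.*2 by rewrite qE.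
pose V : {poly F} := 'X^(m.*2) - 1.
have VP y : y != 0 -> V.[y] = 0 /\ y * V^`().[y] = -1.
  move=> y0.
  have Vy : V.[y] = 0.
    rewrite hornerD hornerN hornerXn hornerC -qE1; apply/eqP; rewrite subr_eq0; apply/eqP.
    by apply: (mulfI y0); rewrite -exprS prednK ?expf_card ?mulr1 // qE.
  have V'y : y * V^`().[y] = -1.
    rewrite derivB derivXn derivC subr0 hornerMn hornerXn.
    rewrite -mulr_natl mulrCA -exprS prednK; last by rewrite double_gt0 (leq_trans _ m3).
    have -> : y ^+ m.*2 = 1.
      apply/eqP; rewrite -subr_eq0; have := Vy.
      by rewrite hornerD hornerN hornerXn hornerC => ->.
    by have := finField_card_eq0; rewrite qE -addn1 natrD mulr1 => /eqP; rewrite addr_eq0 => /eqP.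
  by [].
have [k Ek] : exists k, phi ^+ m + 1 = k * V.
  apply/dvdpP; rewrite /V -qE1; apply: vanish_dvdp => y y0.
  by rewrite hornerD horner_exp hornerC (finField_euler qE (phi0 y y0) (fun s => nsq y s y0)) addNr.
have sphi : size phi = 4%N.
  have s3 : size (c3 *: 'X^3) = 4%N by rewrite size_scale // size_polyXn.
  rewrite /phi -addrA size_polyDl s3 // (leq_ltn_trans (size_polyD _ _)) // gtn_max.
  rewrite (leq_ltn_trans (size_scale_leq _ _)) ?size_polyXn //.
  by rewrite (leq_ltn_trans (size_scale_leq _ _)) ?size_polyX.
clearbody phi; have phiN0 : phi != 0 by rewrite -size_poly_eq0 sphi.
have sphim : size (phi ^+ m + 1) = (3 * m).+1.
  have sm : size (phi ^+ m) = (3 * m).+1.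
    by rewrite -[size _]prednK ?size_poly_gt0 ?expf_neq0 // size_exp sphi.
  by rewrite size_polyDl sm // size_poly1 ltnS; lia.
have sV : size V = m.*2.+1 by rewrite size_XnsubC //; lia.
clearbody V; have VN0 : V != 0 by rewrite -size_poly_eq0 sV.
have kN0 : k != 0.
  by apply: contra_eq_neq sphim => k0; rewrite Ek k0 mul0r size_poly0.
have sk : size k = m.+1.
  by apply: (@addIn m.*2); have := sphim; rewrite Ek size_mul // sV addnS /= => ->; rewrite -muln2; clear; lia.
pose N := m%:R *: ('X * phi^`()) - phi * k.
have sXd : (size (m%:R *: ('X * phi^`())) <= 4)%N.
  apply: leq_trans (size_scale_leq _ _) _; apply: leq_trans (size_polyMleq _ _) _.
  by rewrite size_polyX add2n /= -sphi lt_size_deriv.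
have sN : (size N <= m.*2.+1)%N.
  apply: leq_trans (size_polyD _ _) _; rewrite geq_max size_polyN; apply/andP; split.
    by apply: leq_trans sXd _; rewrite ltnS (leq_trans m3) // -addnn leq_addr.
  apply: leq_trans (size_polyMleq _ _) _; rewrite sphi sk /= -addnn.
  by rewrite addnS ltnS leq_add2r.
have Nroot y : N.[y] = 0.
  rewrite hornerD hornerZ hornerN !hornerM hornerX.
  have [->|y0] := eqVneq y 0; first by rewrite phiE !expr0n /= !mulr0 !addr0 !mul0r mulr0 subr0.
  have [Vy V'y] := VP y y0.
  have d1 : (1 : {poly F})^`() = 0 by rewrite -polyC1 derivC.
  have fm : phi.[y] * phi.[y] ^+ m.-1 = -1.
    rewrite -exprS prednK; last exact: leq_trans m3.
    exact: finField_euler qE (phi0 y y0) (fun s => nsq y s y0).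
  (* Differentiate at [y] and multiply by [y phi(y)]: the term with [V(y)] drops out, [y V'(y) = -1]
     and [phi(y)^m = -1]. *)
  have := congr1 (fun p : {poly F} => y * (phi.[y] * p^`().[y])) Ek.
  rewrite derivD d1 addr0 deriv_exp derivM hornerMn hornerD !hornerM Vy mulr0 add0r horner_exp.
  have -> : y * (phi.[y] * (phi^`().[y] * phi.[y] ^+ m.-1 *+ m)) =
      (phi.[y] * phi.[y] ^+ m.-1) * (m%:R * (y * phi^`().[y])) by rewrite -mulr_natl; ring.
  have -> : y * (phi.[y] * (k.[y] * V^`().[y])) = (y * V^`().[y]) * (phi.[y] * k.[y]) by ring.
  by rewrite fm V'y !mulN1r => /oppr_inj ->; rewrite subrr.
have N0 : N = 0.
  apply/eqP/negPn/negP => N0; have := max_poly_roots N0 (rs := enum F).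
  rewrite enum_uniq -cardE => /(_ _ isT) lt; have : (#|F| < size N)%N.
    by apply: lt; apply/allP => y _; apply/rootP.
  by rewrite qE ltnNge sN.
have : size (phi * k) = m.+4.
  by rewrite size_mul // sphi sk.
have -> : phi * k = m%:R *: ('X * phi^`()) by apply/eqP; rewrite eq_sym -subr_eq0 -/N N0.
by move=> sz; move: sXd m3; rewrite sz; case: (m) => [|[|[|]]].
Qed.
End LargeOdd.

(** * Characteristic two: the absolute trace *)

Section LargeEven.
Variable F : finFieldType.
Variable n : nat.
Hypotheses (char2 : 2 \in [pchar F]) (cardF : #|F| = (2 ^ n)%N).

Lemma char2_addrr (x : F) : x + x = 0.
Proof. exact: addrr_pchar2. Qed.

Definition abs_trace (x : F) := \sum_(i < n) x ^+ (2 ^ i).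

Lemma abs_traceD : {morph abs_trace : x y / x + y}.
Proof.
move=> x y; rewrite /abs_trace -big_split; apply: eq_bigr => i _ /=.
by rewrite exprDn_pchar // (eq_pnat _ (pcharf_eq char2)) pnatX pnat_id.
Qed.

Lemma frob_sum k (x : F) : \sum_(i < k) (x ^+ (2 ^ i)) ^+ 2 + \sum_(i < k) x ^+ (2 ^ i) = x ^+ (2 ^ k) + x.
Proof.
elim: k => [|k IH]; first by rewrite !big_ord0 addr0 expn0 expr1 char2_addrr.
rewrite !big_ord_recr /= addrACA IH -exprM -expnSr.
move: (x ^+ (2 ^ k)) (x ^+ (2 ^ k.+1)) => a b; have -> : a + x + (b + a) = b + x + (a + a) by ring.
by rewrite char2_addrr addr0.
Qed.

Lemma abs_trace_sq x : abs_trace x ^+ 2 = \sum_(i < n) (x ^+ (2 ^ i)) ^+ 2.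
Proof.
rewrite /abs_trace; elim/big_ind2: _ => // [|a b c d <- <-]; first by rewrite expr0n.
by rewrite exprDn_pchar // (eq_pnat _ (pcharf_eq char2)) pnat_id.
Qed.

Lemma abs_trace_bool x : abs_trace x = 0 \/ abs_trace x = 1.
Proof.
have : abs_trace x ^+ 2 + abs_trace x = 0.
  by rewrite abs_trace_sq frob_sum -cardF expf_card char2_addrr.
move/eqP; rewrite expr2 -{3}[abs_trace x]mulr1 -mulrDr mulf_eq0 => /orP[/eqP ->|]; first by left.
by rewrite addr_eq0 oppr_pchar2 // => /eqP; right.
Qed.

Lemma abs_trace_AS z : abs_trace (z ^+ 2 + z) = 0.
Proof.
rewrite abs_traceD; have -> : abs_trace (z ^+ 2) = \sum_(i < n) (z ^+ (2 ^ i)) ^+ 2.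
  by apply: eq_bigr => i _; rewrite -!exprM mulnC.
by rewrite frob_sum -cardF expf_card char2_addrr.
Qed.

(** The trace polynomial vanishes at [w], so it is [r' (X - w)]. If [z^2 + z] never equals [w], then
    [r'] vanishes at every [z^2 + z], and its composite with [X^2 + X], of degree [q - 2], has [q]
    roots. *)
Lemma AS_solvable w : (0 < n)%N -> abs_trace w = 0 -> exists z, z ^+ 2 + z = w.
Proof.
move=> n0 tw; have [z /eqP zw|none] := pickP (fun z => z ^+ 2 + z == w); first by exists z.
exfalso; pose r : {poly F} := \sum_(i < n) 'X^(2 ^ i).
have rE x : r.[x] = abs_trace x.
  by rewrite horner_sum; apply: eq_bigr => i _; rewrite hornerXn.
have [r' Er] : exists r', r = r' * ('X - w%:P).
  by apply/dvdpP; rewrite dvdp_XsubCl; apply/rootP; rewrite rE.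
have sr : size r = (2 ^ n.-1).+1.
  rewrite /r -(prednK n0) big_ord_recr /= addrC size_polyDl size_polyXn //.
  apply: leq_ltn_trans (size_sum _ _ _) _; rewrite ltnS; apply/bigmax_leqP => i _.
  by rewrite size_polyXn ltn_exp2l.
have r0 : r' != 0.
  by apply: contra_eq_neq sr => r0; rewrite Er r0 mul0r size_poly0.
have sr' : size r' = (2 ^ n.-1)%N.
  by have := sr; rewrite Er size_mul ?polyXsubC_eq0 // size_XsubC addn2 => -[].
have sAS : size ('X^2 + 'X : {poly F}) = 3%N by rewrite size_polyDl ?size_polyXn // size_polyX.
pose c := r' \Po ('X^2 + 'X).
have sc : (size c).-1 = ((2 ^ n.-1).-1 * 2)%N by rewrite size_comp_poly sr' sAS.
have c0 : c != 0.
  by rewrite comp_poly_eq0 ?sAS.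
have := max_poly_roots c0 (rs := enum F); rewrite enum_uniq -cardE => /(_ _ isT) lt.
have : (#|F| < size c)%N.
  apply: lt; apply/allP => z _; apply/rootP; rewrite horner_comp !hornerE.
  have zw : z ^+ 2 + z - w != 0 by rewrite subr_eq0 none.
  apply: (mulIf zw); rewrite mul0r -(abs_trace_AS z) -rE Er hornerM hornerXsubC //.
have h0 : (0 < 2 ^ n.-1)%N by rewrite expn_gt0.
rewrite cardF -(prednK n0) expnS /=; case: (size c) sc => [//|k] /= ->.
by rewrite ltnS mulnC leq_pmul2r // -ltnS prednK // ltnn.
Qed.

(* With [h = q / 2], multiplying by [y ^+ h] clears the denominator and [y ^+ (2 h) = y], so that the
   polynomial [G] of degree less than [q - 1] vanishes on [F^*]; its coefficient of [X^(h+1)] is [a]. *)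
Lemma abs_trace_pole_nonconstant (a d e : F) : (2 < n)%N -> a != 0 ->
  ~ forall y, y != 0 -> abs_trace (a * y + d + e / y) = 1.
Proof.
move=> n2 a0 H; pose h := (2 ^ n.-1)%N; have n0 : (0 < n)%N by apply: ltn_trans n2.
have h4 : (4 <= h)%N by rewrite -[4%N]/(2 ^ 2)%N leq_exp2l // -ltnS prednK.
have qh : #|F| = (2 * h)%N by rewrite cardF -{1}(prednK n0) expnS.
have ih i : (i < n.-1)%N -> (2 * 2 ^ i <= h)%N by move=> ik; rewrite -expnS leq_exp2l.
(* The top term of the trace of [a y] becomes [a^h y^(2 h) = a^h y]; it is therefore not in [H1] but
   forms the ['X] term of [G]. *)
pose H1 : {poly F} := \sum_(i < n.-1) a ^+ (2 ^ i) *: 'X^(h + 2 ^ i)%N.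
pose H2 : {poly F} := \sum_(i < n) e ^+ (2 ^ i) *: 'X^(h - 2 ^ i)%N.
pose G := H1 + (a ^+ h *: 'X + H2 + (abs_trace d + 1) *: 'X^h).
have sG : (size G <= (2 * h).-1)%N.
  (* Every exponent in [G] is at most [3 h / 2], and [h >= 4] makes this at most [2 h - 2]. *)
  have sz k (c : F) : (2 * k <= 3 * h)%N -> (size (c *: 'X^k : {poly F}) <= (2 * h).-1)%N.
    move=> kh; apply: leq_trans (size_scale_leq _ _) _; rewrite size_polyXn.
    by move: (h) h4 kh; clear; lia.
  have big m (u : nat -> F) (k : nat -> nat) : (forall i, (i < m)%N -> (2 * k i <= 3 * h)%N) ->
      (size (\sum_(i < m) u i *: 'X^(k i) : {poly F})%R <= (2 * h).-1)%N.
    move=> hk; apply: leq_trans (size_sum _ _ _) _; apply/bigmax_leqP => i _.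
    exact/sz/hk.
  have hle : (2 * h <= 3 * h)%N by rewrite leq_mul2r orbT.
  have add (p q : {poly F}) : (size p <= (2 * h).-1 -> size q <= (2 * h).-1 ->
      size (p + q)%R <= (2 * h).-1)%N.
    by move=> sp sq; apply: leq_trans (size_polyD _ _) _; rewrite geq_max sp sq.
  apply: (add); last (apply: (add); first apply: (add)).
  - apply: (big _ (fun i => a ^+ (2 ^ i)) (fun i => h + 2 ^ i)%N) => i /ih ih'.
    by rewrite mulnDr mulSn addnC leq_add.
  - by rewrite -['X]expr1; apply: sz; apply: leq_trans hle; rewrite muln1 mul2n -addnn (leq_trans (ltnW (ltnW h4))) // leq_addr.
  - apply: (big _ (fun i => e ^+ (2 ^ i)) (fun i => h - 2 ^ i)%N) => i _.
    by apply: leq_trans hle; rewrite leq_mul2l leq_subr.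
  - exact: sz.
have G0 : G = 0.
  apply/eqP/negPn/negP => G0; have := max_poly_roots G0 (rs := [seq x <- enum F | x != 0]).
  rewrite filter_uniq ?enum_uniq // => /(_ _ isT) lt.
  suff : (#|F|.-1 < size G)%N by rewrite qh ltnNge sG.
  apply: leq_trans (lt _); last first.
    apply/allP => y; rewrite mem_filter => /andP[y0 _]; apply/rootP.
    have Ey : y ^+ h * abs_trace (a * y + d + e / y) + y ^+ h = 0.
      by rewrite H // mulr1 char2_addrr.
    rewrite -[RHS]Ey !abs_traceD /G !hornerD !hornerZ hornerX !hornerXn !horner_sum.
    rewrite !mulrDr [y ^+ h * abs_trace (a * y)]mulr_sumr [y ^+ h * abs_trace (e / y)]mulr_sumr.
    have -> : \sum_(i < n) y ^+ h * (a * y) ^+ (2 ^ i) =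
      \sum_(i < n.-1) (a ^+ (2 ^ i) *: 'X^(h + 2 ^ i)).[y] + a ^+ h * y.
      have recr (g : nat -> F) : \sum_(i < n) g i = \sum_(i < n.-1) g i + g n.-1.
        by case: (n) n0 => // m _; rewrite big_ord_recr.
      rewrite (recr (fun i => y ^+ h * (a * y) ^+ (2 ^ i))); congr (_ + _).
        by apply: eq_bigr => i _; rewrite hornerZ hornerXn exprMn exprD; ring.
      by rewrite -/h exprMn mulrCA -exprD addnn -mul2n -qh expf_card.
    have -> : \sum_(i < n) y ^+ h * (e / y) ^+ (2 ^ i) = \sum_(i < n) (e ^+ (2 ^ i) *: 'X^(h - 2 ^ i)).[y].
      apply: eq_bigr => i _; rewrite hornerZ hornerXn exprMn mulrCA; congr (_ * _).
      rewrite exprVn -{1}(subnK (_ : (2 ^ i <= h)%N)) ?exprD ?mulfK ?expf_neq0 //.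
      by rewrite leq_exp2l // -ltnS prednK.
    by ring.
  rewrite size_filter ltnS -(cardC1 (0 : F)) cardE size_filter.
  by rewrite enumT; apply: sub_count.
(* Only the summand of [H1] with [i = 0] has exponent [h + 1]. *)
have : G`_(h + 1) = 0 by rewrite G0 coef0.
have h1 : (h + 1 == 1)%N = false by rewrite -{2}[1%N]add0n eqn_add2r; apply/gtn_eqF/(leq_trans _ h4).
have h1' : (h + 1 == h)%N = false by rewrite addn1 gtn_eqF.
rewrite !coefD !coefZ coefX coefXn h1 h1' !mulr0 add0r addr0 !coef_sum.
rewrite [X in _ + X]big1 => [|i _]; last first.
  rewrite coefZ coefXn gtn_eqF ?mulr0 // addn1 ltnS leq_subr //.
have n10 : (0 < n.-1)%N by rewrite -ltnS prednK // ltnW.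
rewrite addr0 (bigD1 (Ordinal n10)) //= coefZ coefXn expn0 eqxx mulr1 expr1 big1 ?addr0.
  by move=> aE; rewrite aE eqxx in a0.
move=> i i0; have i1 : (0 == i :> nat)%N = false.
  by apply: contraNF i0 => /eqP E; apply/eqP/val_inj.
have i2 : (1 == 2 ^ i)%N = false by rewrite -(eqn_exp2l _ _ (ltnSn 1)) in i1.
by rewrite coefZ coefXn eqn_add2l i2 mulr0.
Qed.

(* For [B <> 0], the substitution [x = B y z / A] turns the curve into
   [z ^+ 2 + z = a y + d + e / y], which is solvable in [z] iff the right hand side has trace [0]. *)
Lemma no_finite_points_even (A B C D E : F) : (5 < #|F|)%N ->
  A != 0 -> C != 0 -> E != 0 -> ~ no_finite_points A B C D E.
Proof.
move=> q5 A0 C0 E0 np.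
have n2 : (2 < n)%N.
  by move: q5; rewrite cardF; case: (n) => [|[|[|]]].
have n0 : (0 < n)%N by apply: ltn_trans n2.
have [B0|B0] := eqVneq B 0.
  (* In characteristic two every [r] is a square, with root [r^(q / 2)]; this gives a point with
     [y = 1]. *)
  pose r := (C + D + E) / A; have /eqP := np (r ^+ (2 ^ n.-1)) 1 (oner_neq0 F); apply.
  rewrite -exprM -expnSr prednK // -cardF expf_card B0 /r.
  have -> : A * ((C + D + E) / A) + 0 * ((C + D + E) / A) ^+ (2 ^ n.-1) * 1 + C * 1 ^+ 3 + D * 1 ^+ 2 + E * 1 =
    (C + D + E) + (C + D + E) by field.
  exact: char2_addrr.
have a0 : A * C / B ^+ 2 != 0 by rewrite !mulf_neq0 ?invr_eq0 ?expf_neq0.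
apply: (@abs_trace_pole_nonconstant (A * C / B ^+ 2) (A * D / B ^+ 2) (A * E / B ^+ 2) n2 a0) => y y0.
have [t0|//] := abs_trace_bool (A * C / B ^+ 2 * y + A * D / B ^+ 2 + A * E / B ^+ 2 / y).
have [z zE] := AS_solvable n0 t0.
have /eqP := np (B * y * z / A) y y0; case.
have -> : A * (B * y * z / A) ^+ 2 + B * (B * y * z / A) * y + C * y ^+ 3 + D * y ^+ 2 + E * y =
  B ^+ 2 * y ^+ 2 / A * ((z ^+ 2 + z) + (A * C / B ^+ 2 * y + A * D / B ^+ 2 + A * E / B ^+ 2 / y)).
  by field; rewrite A0 B0 y0.
by rewrite zE char2_addrr mulr0.
Qed.
End LargeEven.

Lemma no_finite_points_large (F : finFieldType) (A B C D E : F) : (5 < #|F|)%N ->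
  A != 0 -> C != 0 -> E != 0 -> ~ no_finite_points A B C D E.
Proof.
have [two0|two0] := eqVneq (2%:R : F) 0; last exact: no_finite_points_odd.
have char2 : 2%N \in [pchar F] by rewrite inE /= two0 eqxx.
have [p charp [n cardF]] := finField_card_char F.
have p2 : p = 2%N by have := charp; rewrite (pcharf_eq char2) inE => /eqP.
by rewrite p2 in cardF; exact: no_finite_points_even char2 cardF _ _ _ _ _.
Qed.

(** * Fields with at most five elements *)

Section Tables.
Variables (n : nat) (add mul : nat -> nat -> nat).

(** The field is abstract and does not compute; the enumeration runs on numbers with operation
    tables and is transported to the field along [emb]. *)
Definition code_weier A B C D E x y := add (mul A (mul x x)) (add (mul B (mul x y))
  (add (mul C (mul y (mul y y))) (add (mul D (mul y y)) (mul E y)))).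

Definition code_no_points A B C D E :=
  all (fun y => all (fun x => code_weier A B C D E x y != 0%N) (iota 0 n)) (iota 1 n.-1).

(* Compares [l] times the form [A..E] with the image of the form [1, B0..E0] under [X -> X + b Y],
   [Y -> c Y], [Z -> l A Z]; field elements are encoded by the numbers below [n]. *)
Definition code_equiv B0 C0 D0 E0 A B C D E l c b := let d := mul l A in
  [&& add (mul (add b b) d) (mul B0 (mul c d)) == mul l B,
      mul C0 (mul c (mul c c)) == mul l C,
      add (mul (mul b b) d) (add (mul B0 (mul b (mul c d))) (mul D0 (mul (mul c c) d))) == mul l D
    & mul E0 (mul c (mul d d)) == mul l E].

Definition code_unique B0 C0 D0 E0 :=
  all (fun A => all (fun B => all (fun C => all (fun D => all (fun E =>
    if code_no_points A B C D E then
      has (fun l => has (fun c => has (code_equiv B0 C0 D0 E0 A B C D E l c)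
        (iota 0 n)) (iota 1 n.-1)) (iota 1 n.-1)
    else true)
  (iota 1 n.-1)) (iota 0 n)) (iota 1 n.-1)) (iota 0 n)) (iota 1 n.-1).

Variables (F : finFieldType) (emb : nat -> F).
Hypotheses (embD : forall i j, emb (add i j) = emb i + emb j)
  (embM : forall i j, emb (mul i j) = emb i * emb j)
  (emb0 : emb 0 = 0) (emb1 : emb 1 = 1)
  (emb_neq0 : forall i, (0 < i < n)%N -> emb i != 0)
  (emb_surj : forall x, exists2 i, (i < n)%N & x = emb i)
  (add_lt : forall i j, (add i j < n)%N).

Lemma emb_weier A B C D E x y : emb (code_weier A B C D E x y) =
  emb A * emb x ^+ 2 + emb B * emb x * emb y + emb C * emb y ^+ 3 + emb D * emb y ^+ 2 + emb E * emb y.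
Proof. by rewrite /code_weier !(embD, embM); ring. Qed.

Lemma emb_iota0 x : exists2 i, i \in iota 0 n & x = emb i.
Proof. by have [i ilt ->] := emb_surj x; exists i; rewrite // mem_iota. Qed.

Lemma mem_iota1 i : (i \in iota 1 n.-1) = (0 < i < n)%N.
Proof. by rewrite mem_iota add1n; case: n => [|m] //=; case: i. Qed.

Lemma emb_iota1 x : x != 0 -> exists2 i, i \in iota 1 n.-1 & x = emb i.
Proof.
move=> x0; have [i ilt E] := emb_surj x; exists i => //; rewrite mem_iota1 ilt andbT lt0n.
by apply: contraNneq x0 => i0; rewrite E i0 emb0.
Qed.

Lemma code_no_pointsP A B C D E : code_no_points A B C D E <->
  no_finite_points (emb A) (emb B) (emb C) (emb D) (emb E).
Proof.
split=> [/allP H x y y0|H].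
  have [j jn ->] := emb_iota1 y0; have [i iin ->] := emb_iota0 x.
  have /allP/(_ i iin) := H j jn; rewrite -emb_weier => c0; apply: emb_neq0.
  by rewrite lt0n c0 add_lt.
apply/allP => j jn; apply/allP => i _; have j0 : emb j != 0 by apply: emb_neq0; rewrite -mem_iota1.
by have := H (emb i) (emb j) j0; rewrite -emb_weier; apply: contraNneq => ->; rewrite emb0.
Qed.

Lemma code_unique_proj B0 C0 D0 E0 (Q : {mpoly F[3]}) : code_unique B0 C0 D0 E0 ->
  smooth_cubic Q -> unique_det_rep_class Q ->
  proj_equiv Q (weier 1 (emb B0) (emb C0) (emb D0) (emb E0)).
Proof.
move=> chk sQ uQ.
have [g [a [b' [c' [d' [e [gu EW [/emb_iota1[A An EA] /emb_iota1[C Cn EC] /emb_iota1[E En EE]] np]]]]]]] :=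
  weierstrass_form sQ uQ.
have [B Bn EB] := emb_iota0 b'; have [D Dn ED] := emb_iota0 d'; move: EW np.
rewrite {}EA {}EB {}EC {}ED {}EE => EW /code_no_pointsP np.
move/allP: chk => /(_ A An)/allP/(_ B Bn)/allP/(_ C Cn)/allP/(_ D Dn)/allP/(_ E En).
rewrite np => /hasP[l ln /hasP[c cn /hasP[b bn]]].
case/and4P => /eqP/(congr1 emb) e1 /eqP/(congr1 emb) e2 /eqP/(congr1 emb) e3 /eqP/(congr1 emb) e4.
rewrite !(embD, embM) in e1 e2 e3 e4.
have [l0 c0 A0] : [/\ emb l != 0, emb c != 0 & emb A != 0].
  by split; apply: emb_neq0; rewrite -mem_iota1.
clear np.
move: (emb A) (emb B) (emb C) (emb D) (emb E) (emb b) (emb c) (emb l) (emb B0) (emb C0) (emb D0) (emb E0)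
  l0 c0 A0 gu EW e1 e2 e3 e4.
clear=> A' B' C' D' E' b c l B0 C0 D0 E0 l0 c0 A0 gu EW e1 e2 e3 e4.
pose h := mx3 1 b 0 0 c 0 0 0 (l * A').
have hu : h \in unitmx.
  have dh : \det h = c * (l * A') by rewrite det_mx3; ring.
  by rewrite unitmxE dh unitfE !mulf_neq0.
exists (h *m invmx g), l; split; [|split] => //.
  by rewrite unitmx_mul hu unitmx_inv.
rewrite -lin_subst_mul -[Q in RHS](lin_subst_inv _ gu) EW -lin_substZ; congr lin_subst.
have -> : l *: weier A' B' C' D' E' = weier (l * A') (l * B') (l * C') (l * D') (l * E').
  by rewrite /weier /cub -mul_mpolyC !mpolyCM mpolyC0; ring.
rewrite -e1 -e2 -e3 -e4 /weier lin_subst_cub /lin !mx3E /cub.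
by rewrite !(mpolyCM, mpolyCD) !(mpolyC0, mpolyC1); ring.
Qed.

Lemma code_unique_class B0 C0 D0 E0 (W := weier 1 (emb B0) (emb C0) (emb D0) (emb E0)) :
  [&& (0 < C0 < n)%N, code_no_points 1 B0 C0 D0 E0 & code_unique B0 C0 D0 E0] ->
  smooth_cubic W -> unique_class_rep W.
Proof.
case/and3P => C0n np chk sW; split=> [|Q]; last exact: code_unique_proj.
split=> //; apply: (two_points_unique sW (p := e0 F) (t := e2 F)).
by apply/weier_two_points; rewrite ?oner_neq0 ?emb_neq0 // -emb1; apply/code_no_pointsP.
Qed.
End Tables.

(** * Smoothness of the representatives *)

Section Smooth.
Variable F : fieldType.
Implicit Types A B C D E : F.

(** Points with [Z = 0] are excluded once and for all: there the equation gives [y = 0] and the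
    derivative in [Z] gives [x = 0]. The premise treats the affine points. *)
Lemma smooth_weier A B C D E : A != 0 -> C != 0 ->
  (forall (L : fieldType) (f : {rmorphism F -> L}) (x y z : L), z != 0 ->
    f A * x ^+ 2 * z + f B * x * y * z + f C * y ^+ 3 + f D * y ^+ 2 * z + f E * y * z ^+ 2 = 0 ->
    f A * 2%:R * x * z + f B * y * z = 0 ->
    f B * x * z + f C * 3%:R * y ^+ 2 + f D * 2%:R * y * z + f E * z ^+ 2 = 0 ->
    f A * x ^+ 2 + f B * x * y + f D * y ^+ 2 + f E * 2%:R * y * z = 0 -> False) ->
  smooth_cubic (weier A B C D E).
Proof.
move=> A0 C0 H; apply/smoothP; split=> [|L f v v0]; first exact: cub_homog.
rewrite /weier map_cub !rmorph0 => /sing_weier[W0 dX dY dZ].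
have [z0|z0] := eqVneq (v 2 0) 0; last exact: (H L f _ _ _ z0 W0 dX dY dZ).
have y0 : v 1 0 = 0.
  move: W0; rewrite z0 expr0n !mulr0 !addr0 add0r => /eqP.
  by rewrite mulf_eq0 fmorph_eq0 (negbTE C0) expf_eq0 => /eqP.
have x0 : v 0 0 = 0.
  move: dZ; rewrite z0 y0 expr0n !mulr0 !addr0 => /eqP.
  by rewrite mulf_eq0 fmorph_eq0 (negbTE A0) expf_eq0 => /eqP.
by case/eqP: v0; rewrite [v]col3_eta x0 y0 z0; apply/colP => i; case: (ord3P i) => ->; rewrite !mxE.
Qed.

(** The derivative in [X] gives [y = 0], then that in [Z] gives [x = 0], and that in [Y] leaves
    [E z^2 = 0]. *)
Lemma smooth_weier_char2 A B C D E : 2 \in [pchar F] ->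
  [/\ A != 0, B != 0, C != 0 & E != 0] -> smooth_cubic (weier A B C D E).
Proof.
move=> char2 [A0 B0 C0 E0]; apply: smooth_weier => // L f x y z z0 _.
have two0 : (2%:R : L) = 0 by rewrite -(rmorph_nat f) (pcharf0 char2) rmorph0.
rewrite two0 !(mulr0, mul0r, addr0, add0r) => /eqP.
rewrite !mulf_eq0 fmorph_eq0 (negbTE B0) (negbTE z0) orbF /= => /eqP ->.
rewrite expr0n !(mulr0, mul0r, addr0, add0r) => + /eqP.
rewrite mulf_eq0 fmorph_eq0 (negbTE A0) expf_eq0 => + /eqP x0.
rewrite x0 !(mulr0, mul0r, addr0, add0r) => /eqP.
by rewrite mulf_eq0 fmorph_eq0 (negbTE E0) expf_eq0 (negbTE z0).
Qed.

Lemma smooth_weier_3 : 3 \in [pchar F] -> smooth_cubic (weier (1 : F) 0 2%:R 1 1).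
Proof.
move=> char3; have two0 : (2%:R : F) != 0 by rewrite -(dvdn_pcharf char3).
apply: smooth_weier => // [|L f x y z z0]; first exact: oner_neq0.
have three0 : (3%:R : L) = 0 by rewrite -(rmorph_nat f) (pcharf0 char3) rmorph0.
have two0' : (2%:R : L) != 0 by rewrite -(rmorph_nat f) fmorph_eq0.
rewrite rmorph0 rmorph1 !rmorph_nat three0 !(mulr0, mul0r, addr0, add0r, mul1r) => W0 /eqP.
rewrite !mulf_eq0 (negbTE two0') (negbTE z0) orbF /= => /eqP x0.
(* As [2 = -1], the derivative in [Y] gives [z = y]; the equation then reads [4 z^3 = 0], that is,
   [z^3 = 0]. *)
move=> dY _; have yz : z = y.
  have : z * (z - y) = 0.
    have -> : z * (z - y) = 2%:R * y * z + z ^+ 2 - 3%:R * y * z by ring.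
    by rewrite dY three0 !mul0r subr0.
  by move/eqP; rewrite mulf_eq0 (negbTE z0) subr_eq0 => /eqP.
have : z ^+ 3 = 0.
  have -> : z ^+ 3 = 2%:R * y ^+ 3 + y ^+ 2 * z + y * z ^+ 2 - 3%:R * z ^+ 3 by rewrite yz; ring.
  by rewrite three0 mul0r subr0 -[RHS]W0 x0; ring.
by move/eqP; rewrite expf_eq0 (negbTE z0).
Qed.

Lemma smooth_weier_5 : 5 \in [pchar F] -> smooth_cubic (weier (1 : F) 0 1 0 2%:R).
Proof.
move=> char5; have two0 : (2%:R : F) != 0 by rewrite -(dvdn_pcharf char5).
apply: smooth_weier => [||L f x y z z0]; try exact: oner_neq0.
have two0' : (2%:R : L) != 0 by rewrite -(rmorph_nat f) fmorph_eq0.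
rewrite rmorph0 rmorph1 !rmorph_nat !(mulr0, mul0r, addr0, add0r, mul1r) => _ /eqP.
rewrite !mulf_eq0 (negbTE two0') (negbTE z0) orbF /= => /eqP ->.
rewrite expr0n !(mulr0, mul0r, addr0, add0r) => + /eqP.
rewrite !mulf_eq0 (negbTE two0') (negbTE z0) orbF /= => + /eqP y0.
rewrite y0 expr0n !(mulr0, mul0r, addr0, add0r) => /eqP.
by rewrite mulf_eq0 expf_eq0 (negbTE two0') (negbTE z0).
Qed.
End Smooth.

(** * Transfer of the tables to the fields with 2, 3, 4 and 5 elements *)

Lemma prime_field_class (F : finFieldType) p B0 C0 D0 E0
  (add := fun i j => ((i + j) %% p)%N) (mul := fun i j => ((i * j) %% p)%N)
  (W : {mpoly F[3]} := weier 1 B0%:R C0%:R D0%:R E0%:R) : #|F| = p -> p \in [pchar F] ->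
  [&& (0 < C0 < p)%N, code_no_points p add mul 1 B0 C0 D0 E0 & code_unique p add mul B0 C0 D0 E0] ->
  smooth_cubic W -> unique_class_rep W.
Proof.
move=> cardF charp; have p0 := prime_gt0 (pcharf_prime charp).
have neq0 i : (0 < i < p)%N -> (i%:R : F) != 0.
  by case/andP => i0 ip; rewrite -(dvdn_pcharf charp) gtnNdvd.
apply: (@code_unique_class p add mul F (fun i => i%:R)) => //.
- by move=> i j; rewrite (GRing.natr_mod_pchar charp) natrD.
- by move=> i j; rewrite (GRing.natr_mod_pchar charp) natrM.
- move=> x; have inj : injective (fun i : 'I_p => (i : nat)%:R : F).
    move=> i j; wlog ij : i j / (i <= j)%N.
      by move=> H; case/orP: (leq_total i j) => /H // + /esym => /[apply].
    move=> E; have : ((j - i)%:R : F) == 0 by rewrite natrB // E subrr.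
    rewrite -(dvdn_pcharf charp); case: (posnP (j - i)) => [ji0 _|ji0].
      by apply/val_inj/eqP; rewrite eqn_leq ij -subn_eq0 ji0.
    by rewrite gtnNdvd // (leq_ltn_trans (leq_subr _ _)).
  have le : (#|F| <= #|'I_p|)%N by rewrite card_ord cardF.
  by have /codomP[i ->] := inj_card_onto inj le x; exists i.
- by move=> i j; rewrite ltn_mod.
Qed.

Lemma card_prime_char (F : finFieldType) p : prime p -> #|F| = p -> p \in [pchar F].
Proof.
move=> p_pr cardF; have [r charr [k Ek]] := finField_card_char F.
have r_pr := pcharf_prime charr; suff -> : p = r by [].
have : (p %| r ^ k)%N by rewrite -Ek cardF.
by rewrite Euclid_dvdX // dvdn_prime2 // => /andP[/eqP].
Qed.

(* [0], [1], [2], [3] encode [0], [1], [w], [w + 1]. *)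
Definition add4 i j := nth 0%N (nth [::]
  [:: [:: 0; 1; 2; 3]; [:: 1; 0; 3; 2]; [:: 2; 3; 0; 1]; [:: 3; 2; 1; 0]]%N (i %% 4)) (j %% 4).
Definition mul4 i j := nth 0%N (nth [::]
  [:: [:: 0; 0; 0; 0]; [:: 0; 1; 2; 3]; [:: 0; 2; 3; 1]; [:: 0; 3; 1; 2]]%N (i %% 4)) (j %% 4).

Section FourElements.
Variables (F : finFieldType) (w : F).
Hypotheses (cardF : #|F| = 4%N) (wE : w ^+ 2 + w + 1 = 0).

Lemma four_char2 : 2 \in [pchar F].
Proof.
have [r charr [k Ek]] := finField_card_char F.
have r_pr := pcharf_prime charr; suff <- : r = 2 by [].
have : (r %| 2 ^ 2)%N by rewrite -[(2 ^ 2)%N]cardF Ek; case: k Ek => [|k]; rewrite ?cardF // expnS dvdn_mulr.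
by rewrite Euclid_dvdX // dvdn_prime2 // => /andP[/eqP].
Qed.

(** Reduction modulo 4 makes [emb4] compatible with the tables on all numbers, as
    [code_unique_class] demands. *)
Let emb4 i : F := nth 0 [:: 0; 1; w; w + 1] (i %% 4).

Lemma emb4_neq0 i : (0 < i < 4)%N -> emb4 i != 0.
Proof.
have w0 : w != 0 by apply: contraPneq wE => ->; rewrite expr0n !add0r; apply/eqP/oner_neq0.
have w10 : w + 1 != 0.
  by apply: contraPneq wE => E; rewrite -addrA E addr0; apply/eqP; rewrite expf_neq0.
by case: i => [|[|[|[|]]]] // _; rewrite /emb4 /= ?oner_neq0.
Qed.

Lemma emb4D i j : emb4 (add4 i j) = emb4 i + emb4 j.
Proof.
have two0 : (2%:R : F) = 0 := pcharf0 four_char2.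
have id4 k : emb4 (k %% 4) = emb4 k by rewrite /emb4 modn_mod.
rewrite -(id4 i) -(id4 j) /add4; move: (ltn_pmod i (isT : (0 < 4)%N)) (ltn_pmod j (isT : (0 < 4)%N)).
by case: (i %% 4)%N => [|[|[|[|//]]]]; case: (j %% 4)%N => [|[|[|[|//]]]] _ _; rewrite /emb4 /=; ring: two0.
Qed.

Lemma emb4M i j : emb4 (mul4 i j) = emb4 i * emb4 j.
Proof.
have two0 : (2%:R : F) = 0 := pcharf0 four_char2.
have id4 k : emb4 (k %% 4) = emb4 k by rewrite /emb4 modn_mod.
have sq : w ^+ 2 = w + 1.
  have -> : w ^+ 2 = w ^+ 2 + w + 1 - 2%:R * (w + 1) + (w + 1) by ring.
  by rewrite wE two0; ring.
rewrite -(id4 i) -(id4 j) /mul4; move: (ltn_pmod i (isT : (0 < 4)%N)) (ltn_pmod j (isT : (0 < 4)%N)).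
by case: (i %% 4)%N => [|[|[|[|//]]]]; case: (j %% 4)%N => [|[|[|[|//]]]] _ _; rewrite /emb4 /=; ring: two0 sq.
Qed.

Lemma emb4_surj x : exists2 i, (i < 4)%N & x = emb4 i.
Proof.
have inj : injective (fun i : 'I_4 => emb4 i).
  (* In characteristic two equal images have sum zero, and the addition table is zero only on its
     diagonal. *)
  move=> i j E; have : emb4 (add4 i j) = 0.
    by rewrite emb4D E (addrr_pchar2 four_char2).
  case: i j {E} => [[|[|[|[|//]]]] ?] [[|[|[|[|//]]]] ?]; rewrite /add4 /= => /eqP E;
  by first [exact: val_inj | rewrite (negbTE (emb4_neq0 _)) in E].
have le : (#|F| <= #|'I_4|)%N by rewrite card_ord cardF.
by have /codomP[i ->] := inj_card_onto inj le x; exists i.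
Qed.

Lemma four_class (W := weier 1 w 1 1 w) : smooth_cubic W -> unique_class_rep W.
Proof.
apply: (@code_unique_class 4 add4 mul4 F emb4 emb4D emb4M _ _ emb4_neq0 emb4_surj _ 2 1 1 2) => //.
by move=> i j; rewrite /add4; move: (ltn_pmod i (isT : (0 < 4)%N)) (ltn_pmod j (isT : (0 < 4)%N));
  case: (i %% 4)%N => [|[|[|[|//]]]]; case: (j %% 4)%N => [|[|[|[|//]]]].
Qed.
End FourElements.

Theorem theorem6p2 (F : finFieldType) :
  ((5 < #|F|)%N ->
    forall P : {mpoly F[3]}, smooth_cubic P -> ~ unique_det_rep_class P)
  /\
  (#|F| = 2%N ->
    unique_class_rep (cX^+2 * cZ + cX * cY * cZ + cY^+3 + cY^+2 * cZ + cY * cZ^+2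
                      : {mpoly F[3]}))
  /\
  (#|F| = 3%N ->
    unique_class_rep (cX^+2 * cZ - cY^+3 + cY^+2 * cZ + cY * cZ^+2 : {mpoly F[3]}))
  /\
  (#|F| = 4%N -> forall w : F, w^+2 + w + 1 = 0 ->
    unique_class_rep (cX^+2 * cZ + w%:MP * cX * cY * cZ + cY^+3 + cY^+2 * cZ
                      + w%:MP * cY * cZ^+2 : {mpoly F[3]}))
  /\
  (#|F| = 5%N ->
    unique_class_rep (cX^+2 * cZ + cY^+3 + 2%:R%:MP * cY * cZ^+2 : {mpoly F[3]})).
Proof.
have weierE (A B C D E : F) : weier A B C D E = A%:MP * cX ^+ 2 * cZ + B%:MP * cX * cY * cZ
    + C%:MP * cY ^+ 3 + D%:MP * cY ^+ 2 * cZ + E%:MP * cY * cZ ^+ 2.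
  by rewrite /weier /cub mpolyC0 /cX /cY /cZ; ring.
split; [|split; [|split; [|split]]].
- move=> q5 P sP uP.
  have [g [A [B [C [D [E [gu EP [A0 C0 E0] np]]]]]]] := weierstrass_form sP uP.
  exact: no_finite_points_large q5 A0 C0 E0 np.
- move=> cardF; have char2 := card_prime_char (isT : prime 2) cardF.
  have -> : cX ^+ 2 * cZ + cX * cY * cZ + cY ^+ 3 + cY ^+ 2 * cZ + cY * cZ ^+ 2 = weier 1 1 1 1 1 :> tform F.
    by rewrite weierE mpolyC1; ring.
  apply: (@prime_field_class F 2 1 1 1 1 cardF char2); first by vm_compute.
  by apply: smooth_weier_char2; rewrite ?oner_neq0.
- move=> cardF; have char3 := card_prime_char (isT : prime 3) cardF.
  (* The coefficient [-1] of [Y^3] is encoded by the number 2. *)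
  have two : 2%:R = -1 :> F by apply/eqP; rewrite -subr_eq0 opprK -(natrD _ 2 1) (pcharf0 char3).
  have -> : cX ^+ 2 * cZ - cY ^+ 3 + cY ^+ 2 * cZ + cY * cZ ^+ 2 = weier 1 0 2%:R 1 1 :> tform F.
    by rewrite weierE two mpolyCN mpolyC0 mpolyC1; ring.
  apply: (@prime_field_class F 3 0 2 1 1 cardF char3); first by vm_compute.
  exact: smooth_weier_3.
- move=> cardF w wE.
  have -> : cX ^+ 2 * cZ + w%:MP * cX * cY * cZ + cY ^+ 3 + cY ^+ 2 * cZ + w%:MP * cY * cZ ^+ 2 =
      weier 1 w 1 1 w.
    by rewrite weierE mpolyC1; ring.
  apply: four_class => //; apply: smooth_weier_char2 (four_char2 cardF) _.
  by have := emb4_neq0 wE (isT : (0 < 2 < 4)%N); rewrite /= => w0; rewrite oner_neq0.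
- move=> cardF; have char5 := card_prime_char (isT : prime 5) cardF.
  have -> : cX ^+ 2 * cZ + cY ^+ 3 + 2%:R%:MP * cY * cZ ^+ 2 = weier 1 0 1 0 2%:R :> tform F.
    by rewrite weierE mpolyC0 mpolyC1; ring.
  apply: (@prime_field_class F 5 0 1 0 2 cardF char5); first by vm_compute.
  exact: smooth_weier_5.
Qed.
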